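(* Let $\alpha>0$, $n=\lceil\alpha\rceil$, $\sigma>0$, $\eta\in\mathbb{R}$ and $a_1,\dots,a_n\in\mathbb{R}$. Let $f:(a,b]\times\mathbb{R}\to\mathbb{R}$ be a function such that $t\mapsto f(t,t^{-\sigma(\alpha+\eta)}x)$ belongs to $L^1_{\psi^{\eta+1}}(a,b)$ for every $x\in\mathbb{R}$. Assume there exists $K>0$ such that for all $t\in(a,b]$ and all $(x,y)\in\mathbb{R}^2$ $$|f(t,x)-f(t,y)|\le K\,t^{\sigma\alpha}|x-y|.$$ Then the Cauchy problem $$\begin{cases}{}^{EK}D_{a,\sigma,\eta}^{\alpha}u(t)=f(t,u(t)),\quad t\in[a,b],\\ {}^{EK}D_{a,\sigma,0}^{\alpha-k}\big(t^{\sigma(k+\eta)}u(t)\big)(a)=a_k,\ k=1,\dots,n-1,\qquad \lim_{t\to a}I_{a,\sigma,\alpha-n}^{n-\alpha}\big(t^{\sigma(n+\eta)}u(t)\big)=a_n,\end{cases}$$ admits a unique solution $u\in L^\alpha_{\sigma,\eta}(a,b)$, where $L^\alpha_{\sigma,\eta}(a,b)=\{\varphi\in L^1_{\psi^{\alpha+\eta+1}}(a,b):\ {}^{EK}D^\alpha_{a,\sigma,\eta}\varphi\in L^1_{\psi^{\eta+1}}(a,b)\}$.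
   Context: Let $0\le a<b<\infty$ and $\psi(t)=t^\sigma$. For $\lambda\in\mathbb{R}$, $L^1_{\psi^\lambda}(a,b)$ is the set of (classes of) measurable functions $g$ on $[a,b]$ with $\int_a^bs^{\sigma\lambda-1}|g(s)|\,ds<\infty$. The Erdélyi-Kober fractional integral of order $\gamma>0$ is $$I^\gamma_{a,\sigma,\eta}u(t)=\frac{\sigma t^{-\sigma(\gamma+\eta)}}{\Gamma(\gamma)}\int_a^t\frac{s^{\sigma\eta+\sigma-1}u(s)}{(t^\sigma-s^\sigma)^{1-\gamma}}\,ds,\qquad I^0_{a,\sigma,\eta}u=u,$$ and, with $m=\lceil\gamma\rceil$, the Erdélyi-Kober derivative of order $\gamma>0$ is $${}^{EK}D^\gamma_{a,\sigma,\eta}u(t)=t^{-\sigma\eta}\Big(\frac1{\sigma t^{\sigma-1}}\frac{d}{dt}\Big)^m\,t^{\sigma(m+\eta)}I^{m-\gamma}_{a,\sigma,\eta+\gamma}u(t).$$ With $\varrho=\frac1{\sigma t^{\sigma-1}}\frac{d}{dt}$, $AC^m_\psi[a,b]$ is the set of functions $w$ such that $\varrho^{m-1}w$ is (extends to) an absolutely continuous function on $[a,b]$; that the derivative ${}^{EK}D^\gamma_{a,\sigma,\eta}u$ exists in the required $L^1$ space is understood to include that $t^{\sigma(m+\eta)}I^{m-\gamma}_{a,\sigma,\eta+\gamma}u$ (has a representative that) belongs to $AC^m_\psi[a,b]$. The differential equation is understood for a.e. $t$, and values at $a$ as limits $t\to a^+$. *)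

(* Defs.v *)
From HB Require Import structures.
From mathcomp Require Import all_boot all_order all_algebra.
From mathcomp Require Import all_classical all_reals all_analysis.
Set Implicit Arguments.
Unset Strict Implicit.
Unset Printing Implicit Defensive.
Import Order.TTheory GRing.Theory Num.Theory.
Import numFieldNormedType.Exports.

Local Open Scope classical_set_scope.
Local Open Scope ring_scope.

Section ErdelyiKober.
Context {R : realType}.
Notation leb := (@lebesgue_measure R).

Definition Gamma (x : R) : R :=
  \int[leb]_(t in `]0, +oo[) (t `^ (x - 1) * expR (- t)).

(* L^1_(psi^lam)(a,b) for psi(t) = t^sigma.  Since [measurable_fun] is Borel
   measurability, the almost everywhere equal h makes this the space of
   Lebesgue measurable functions, closed under modification on null sets. *)
Definition L1psi (a b sigma lam : R) : set (R -> R) :=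
  [set g | exists h : R -> R,
     [/\ measurable_fun `[a, b]%classic h,
         ae_eq leb `[a, b]%classic g h &
         (\int[leb]_(s in `[a, b])
            (s `^ (sigma * lam - 1) * `|h s|)%:E < +oo)%E]].

Definition abs_cont (a b : R) (F : R -> R) : Prop :=
  forall e : R, 0 < e -> exists2 d : R, 0 < d &
    forall (N : nat) (x y : 'I_N -> R),
      (forall i, a <= x i <= y i /\ y i <= b) ->
      trivIset setT (fun i => `]x i, y i[%classic) ->
      \sum_(i < N) (y i - x i) < d ->
      \sum_(i < N) `|F (y i) - F (x i)| < e.

Definition rho (sigma : R) (w : R -> R) : R -> R :=
  fun t => (sigma * t `^ (sigma - 1))^-1 * derive1 w t.

(* AC^m_psi[a,b], m >= 1.  Differentiability is asked on ]a, b[ only: rho is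
   singular at a = 0, and [derive1] at an end point would depend on values
   outside [a, b]. *)
Definition ACpsi (a b sigma : R) (m : nat) : set (R -> R) :=
  [set w | (forall j : nat, (j.+1 < m)%N ->
              forall t, t \in `]a, b[ -> derivable (iter j (rho sigma) w) t 1) /\
           exists2 F : R -> R, abs_cont a b F &
             forall t, t \in `]a, b[ -> F t = iter m.-1 (rho sigma) w t].

Definition EKint (a sigma eta gam : R) (u : R -> R) : R -> R := fun t =>
  if gam == 0 then u t else
  sigma * t `^ (- (sigma * (gam + eta))) / Gamma gam *
  \int[leb]_(s in `[a, t])
    (s `^ (sigma * eta + sigma - 1) * u s /
     (t `^ sigma - s `^ sigma) `^ (1 - gam)).

Definition ceiln (x : R) : nat := `|Num.ceil x|%N.

(* The function to which rho^m is applied in the derivative of order gam. *)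
Definition EKpre (a sigma eta gam : R) (u : R -> R) : R -> R := fun t =>
  let m := ceiln gam in
  t `^ (sigma * (m%:R + eta)) * EKint a sigma (eta + gam) (m%:R - gam) u t.

Definition EKreps (a b sigma eta gam : R) (u : R -> R) : set (R -> R) :=
  [set w | ACpsi a b sigma (ceiln gam) w /\
           ae_eq leb `]a, b[%classic w (EKpre a sigma eta gam u)].

Definition EKderivable (a b sigma eta gam : R) (u : R -> R) : Prop :=
  EKreps a b sigma eta gam u !=set0.

(* u is only a class, so rho^m is applied to the AC^m_psi representative of
   [EKpre], which is unique on ]a, b[.  Meaningful on ]a, b[, under
   [EKderivable]. *)
Definition EKderiv (a b sigma eta gam : R) (u : R -> R) : R -> R := fun t =>
  t `^ (- (sigma * eta)) *
  iter (ceiln gam) (rho sigma)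
    (xget (EKpre a sigma eta gam u) (EKreps a b sigma eta gam u)) t.

Definition Lalpha (a b sigma eta alpha : R) : set (R -> R) :=
  [set u | [/\ L1psi a b sigma (alpha + eta + 1) u,
               EKderivable a b sigma eta alpha u &
               L1psi a b sigma (eta + 1) (EKderiv a b sigma eta alpha u)]].

(* Limit at a+ of the class of w modulo null sets: some representative on
   ]a, b[ has limit l (and l does not depend on the representative). *)
Definition class_lim_right (a b : R) (w : R -> R) (l : R) : Prop :=
  exists2 w' : R -> R, ae_eq leb `]a, b[%classic w' w & w' t @[t --> a^'+] --> l.

Definition EKCauchy (a b sigma eta alpha : R) (c : nat -> R)
    (f : R -> R -> R) (u : R -> R) : Prop :=
  let n := ceiln alpha in
  [/\ ae_eq leb `]a, b[%classic (EKderiv a b sigma eta alpha u) (fun t => f t (u t)),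
      forall k : nat, (1 <= k <= n.-1)%N ->
        let v := fun t => t `^ (sigma * (k%:R + eta)) * u t in
        EKderivable a b sigma 0 (alpha - k%:R) v /\
        EKderiv a b sigma 0 (alpha - k%:R) v t @[t --> a^'+] --> c k &
      class_lim_right a b
        (EKint a sigma (alpha - n%:R) (n%:R - alpha)
           (fun t => t `^ (sigma * (n%:R + eta)) * u t))
        (c n)].

End ErdelyiKober.

(* Main.v *)
Require Import Defs.
From HB Require Import structures.
From mathcomp Require Import all_boot all_order all_algebra.
From mathcomp Require Import all_classical all_reals all_analysis.
From mathcomp Require Import measurable_realfun ring lra.
Import Order.TTheory GRing.Theory Num.Theory.
Import numFieldNormedType.Exports HBNNSimple.
Local Open Scope classical_set_scope.
Local Open Scope ring_scope.
Set Implicit Arguments.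
Unset Strict Implicit.
Unset Printing Implicit Defensive.

(** Put psi(t) = t^sigma, phi = t^(sigma (alpha + eta)) u and
    w = I^(n - alpha) phi, the fractional integral of phi with respect to psi.
    Every Erdelyi-Kober operator of the problem is a power of t times
    rho^m w, so the problem reads rho^n w = G phi, (rho^(n - k) w)(a+) = c_k,
    where the superposition operator
    G phi (t) = t^(sigma eta) f(t, t^(- sigma (alpha + eta)) phi(t))
    is K-Lipschitz on L^1(psi' dt).  Absolutely continuous functions are
    integrals of their derivatives, so this is w = J_n, where J_0 = G phi and
    J_i is c_i plus the primitive of J_(i - 1) with respect to psi.  Abel's
    inversion of I^(n - alpha) turns it into the fixed point equation
    phi = c_n kappa + const I^(1 - n + alpha) J_(n - 1), whose right-hand side is a
    contraction of L^1 with weight psi' exp(- M psi), M large. *)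

(** * Weighted L^1 spaces and kernel operators *)

(** A single w serves because the orders match: for k below n the ceiling of alpha - k is n - k, so
    every derivative in the problem has the same fractional defect n - alpha. Both weighted spaces
    reduce to L^1(psi' dt) since sigma t^(sigma (r + 1) - 1) = psi'(t) t^(sigma r), and the factor
    t^(sigma alpha) of the Lipschitz condition is what the powers of t in G cancel. Neither K nor b
    - a is small, so the contraction has to come from the weight: with y = psi(t) - psi(s), the
    factor exp(- M psi(t)) turns the norm of a kernel of order gamma into a truncated Laplace
    transform of y^(gamma - 1), which tends to 0 as M grows, uniformly in s. The Beta constant
    enters only as a finite positive number, absorbed in the normalisation of the inverse kernel.
    Two obstacles shape the details. For a = 0 the function psi' may vanish or blow up at a, so
    substitution and differentiation take place on open intervals. And u is only a class, while
    divergent real integrals have a default value, so operator identities hold almost everywhere and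
    have to be carried over to continuous representatives. *)

(** The integral of a nonnegative function is a supremum over simple functions below it. Such a
    function, cut off on the null set where [f] and [g] differ, keeps its integral and lies below
    [g]. *)
Lemma ge0_ae_le_integral_nonmeas d (T : measurableType d) (R : realType)
    (mu : {measure set T -> \bar R}) (D : set T) (f g : T -> \bar R) :
  (forall x, 0 <= f x)%E -> (forall x, 0 <= g x)%E -> ae_eq mu D f g ->
  (\int[mu]_(x in D) f x <= \int[mu]_(x in D) g x)%E.
Proof.
move=> f0 g0 [N [mN N0 subN]].
rewrite ge0_integralE// ge0_integralE//.
apply: ge_ereal_sup => _ [h /= hf <-].
rewrite -integralT_nnsfun (@ge0_negligible_integral _ _ _ _ _ N)//; last 2 first.
- exact/measurable_EFinP.
- by move=> x _; rewrite lee_fin.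
have mCN : measurable (~` N) by exact: measurableC.
rewrite setTD integral_mkcond.
pose h' := mul_nnsfun h (indic_nnsfun R mCN).
have -> : ((fun x => (h x)%:E) \_ (~` N) = EFin \o h')%E.
  apply/funext => x; rewrite patchE /= mindicE.
  by case: ifPn => xN; rewrite ?mulr1 ?mulr0.
rewrite integralT_nnsfun; apply: ereal_sup_ubound.
exists h' => // x /=; rewrite mindicE.
have [xN|xN] := boolP (x \in ~` N); last first.
  by rewrite mulr0 erestrict_ge0.
rewrite mulr1; apply: (le_trans (hf x)).
rewrite !patchE; case: ifPn => // xD.
suff -> : f x = g x by [].
apply: contrapT => fg; move: xN; rewrite inE; apply; apply: subN => /=.
by apply/not_implyP; split => //; exact/set_mem.
Qed.

(* Unlike [ae_eq_integral], this does not assume measurability. *)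
Lemma ae_eq_integral_nonmeas d (T : measurableType d) (R : realType)
    (mu : {measure set T -> \bar R}) (D : set T) (f g : T -> \bar R) :
  ae_eq mu D f g -> (\int[mu]_(x in D) f x = \int[mu]_(x in D) g x)%E.
Proof.
move=> /ae_eq_funeposneg[fgp fgn].
rewrite integralE [RHS]integralE; congr (_ - _)%E; apply/eqP;
  rewrite eq_le !ge0_ae_le_integral_nonmeas//; exact: ae_eq_sym.
Qed.

Section weighted_L1.
Context d (T : measurableType d) (R : realType).
Variables (mu : {measure set T -> \bar R}) (w : T -> R).
Implicit Types f g h : T -> R.
Hypotheses (mw : measurable_fun setT w) (w0 : forall x, 0 <= w x).

Definition wnorm (f : T -> R) : \bar R := (\int[mu]_x (w x * `|f x|)%:E)%E.

Definition wL1 (f : T -> R) : Prop :=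
  measurable_fun setT f /\ (wnorm f < +oo)%E.

Lemma measurable_wnorm f : measurable_fun setT f ->
  measurable_fun setT (fun x => (w x * `|f x|)%:E).
Proof.
move=> mf; apply/measurable_EFinP; apply: measurable_funM => //.
exact: measurableT_comp.
Qed.

Lemma wnorm_ge0 f : (0 <= wnorm f)%E.
Proof. by apply: integral_ge0 => x _; rewrite lee_fin mulr_ge0. Qed.

Lemma wnorm_le f g : measurable_fun setT f -> measurable_fun setT g ->
  {ae mu, forall x, w x * `|f x| <= w x * `|g x|} ->
  (wnorm f <= wnorm g)%E.
Proof.
move=> mf mg fg; apply: ae_ge0_le_integral => //.
- by move=> x _; rewrite lee_fin mulr_ge0.
- exact: measurable_wnorm.
- by move=> x _; rewrite lee_fin mulr_ge0.
- exact: measurable_wnorm.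
- by apply: filterS fg => x fg _; rewrite lee_fin.
Qed.

Lemma wnormD f g : measurable_fun setT f -> measurable_fun setT g ->
  (wnorm (fun x => f x + g x)%R <= wnorm f + wnorm g)%E.
Proof.
move=> mf mg; rewrite /wnorm -ge0_integralD//.
- apply: ge0_le_integral => //.
  + by move=> x _; rewrite lee_fin mulr_ge0.
  + by apply: measurable_wnorm; exact: measurable_funD.
  + by apply: emeasurable_funD; exact: measurable_wnorm.
  + by move=> x _; rewrite -EFinD lee_fin -mulrDr ler_wpM2l// ler_normD.
- by move=> x _; rewrite lee_fin mulr_ge0.
- exact: measurable_wnorm.
- by move=> x _; rewrite lee_fin mulr_ge0.
- exact: measurable_wnorm.
Qed.

Lemma wnormN f : wnorm (fun x => - f x) = wnorm f.
Proof. by apply: eq_integral => x _; rewrite normrN. Qed.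

Lemma wnormB f g : wnorm (fun x => f x - g x) = wnorm (fun x => g x - f x).
Proof. by apply: eq_integral => x _; rewrite distrC. Qed.

Lemma wnormB_le f g h : measurable_fun setT f -> measurable_fun setT g ->
  measurable_fun setT h ->
  (wnorm (fun x => f x - h x)%R <=
   wnorm (fun x => f x - g x)%R + wnorm (fun x => g x - h x)%R)%E.
Proof.
move=> mf mg mh; rewrite (_ : (fun x => f x - h x) =
  (fun x => (f x - g x) + (g x - h x))); last first.
  by apply/funext => x; rewrite addrA subrK.
by apply: wnormD; exact: measurable_funB.
Qed.

Lemma wL1D f g : wL1 f -> wL1 g -> wL1 (fun x => f x + g x).
Proof.
move=> [mf fy] [mg gy]; split; first exact: measurable_funD.
by apply: (le_lt_trans (wnormD mf mg)); rewrite lte_add_pinfty.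
Qed.

Lemma wL1B f g : wL1 f -> wL1 g -> wL1 (fun x => f x - g x).
Proof.
move=> f1 [mg gy]; apply: wL1D => //.
by split; [exact: measurableT_comp|rewrite wnormN].
Qed.

Lemma wL10 : wL1 (cst 0).
Proof.
split => //; rewrite /wnorm (eq_integral (cst 0%E)) ?integral0 ?ltry//.
by move=> x _; rewrite /= normr0 mulr0.
Qed.

Lemma wnorm_eq0 f : measurable_fun setT f -> wnorm f = 0 ->
  {ae mu, forall x, w x != 0 -> f x = 0}.
Proof.
move=> mf f0; have /ae_eq_integral_abs : measurable_fun setT (fun x => (w x * f x)%:E).
  by apply/measurable_EFinP; exact: measurable_funM.
move=> /(_ mu measurableT)[+ _]; rewrite -[X in (X = _ -> _)](_ : wnorm f = _); last first.
  by apply: eq_integral => x _; rewrite /= normrM (ger0_norm (w0 x)).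
move=> /(_ f0); apply: filterS => x /(_ I) [/eqP].
by rewrite mulf_eq0 => /orP[->//|/eqP].
Qed.

(** Riesz-Fischer for a geometrically Cauchy sequence. The sum [h] of the weighted increments has
    integral at most [C / (1 - k)], so it is finite almost everywhere; there, if [w] is positive,
    the telescoping series converges absolutely. *)
Lemma wL1_complete (u : nat -> T -> R) (k C : R) : 0 <= k < 1 -> 0 <= C ->
  (forall m, wL1 (u m)) ->
  (forall m, wnorm (fun x => u m.+1 x - u m x)%R <= (k ^+ m * C)%:E)%E ->
  exists2 f, wL1 f &
    forall m, (wnorm (fun x => f x - u m x)%R <= (k ^+ m * C / (1 - k))%:E)%E.
Proof.
move=> /andP[k0 k1] C0 u1 du.
have mu_ m : measurable_fun setT (u m) by case: (u1 m).
have tail m j : (wnorm (fun x => u (m + j)%N x - u m x)%R <=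
    (k ^+ m * C / (1 - k))%:E)%E.
  (* The induction on [j] runs on the exact partial geometric sum, with its factor [1 - k ^+ j]. *)
  suff : (wnorm (fun x => u (m + j)%N x - u m x)%R <=
      (k ^+ m * C * (1 - k ^+ j) / (1 - k))%:E)%E.
    move=> /le_trans; apply; rewrite lee_fin ler_pM2r ?invr_gt0 ?subr_gt0//.
    by rewrite ler_piMr ?mulr_ge0 ?exprn_ge0// gerBl exprn_ge0.
  elim: j => [|j ih].
    rewrite addn0 expr0 subrr mulr0 mul0r /wnorm (eq_integral (cst 0%E)) ?integral0//.
    by move=> x _; rewrite subrr normr0 mulr0.
  apply: (le_trans (@wnormB_le _ (u (m + j)%N) _ _ _ _)) => //.
  rewrite addnS; apply: (le_trans (leeD (du _) ih)).
  rewrite -EFinD lee_fin exprD exprS le_eqVlt; apply/orP; left; apply/eqP.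
  have : 1 - k != 0 by rewrite subr_eq0 gt_eqF.
  by move=> ?; field.
pose h x := (\sum_(m <oo) (w x * `|u m.+1 x - u m x|)%:E)%E.
have mterm m : measurable_fun setT (fun x => (w x * `|u m.+1 x - u m x|)%:E).
  by apply: (@measurable_wnorm (fun x => u m.+1 x - u m x)); exact: measurable_funB.
have mh : measurable_fun setT h.
  by apply: ge0_emeasurable_sum => // m x _ _; rewrite lee_fin mulr_ge0.
have hy : (\int[mu]_x h x < +oo)%E.
  rewrite integral_nneseries//; last by move=> m x _; rewrite lee_fin mulr_ge0.
  apply: (@le_lt_trans _ _ (C / (1 - k))%:E); last exact: ltry.
  apply: lime_le.
    by apply: is_cvg_nneseries => m _ _; exact: wnorm_ge0.
  apply: nearW => m.
  apply: (@le_trans _ _ (\sum_(0 <= i < m) (k ^+ i * C)%:E)%E).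
    by apply: lee_sum => i _; exact: du.
  rewrite sumEFin lee_fin -mulr_suml mulrC ler_wpM2l//.
  have := @geometric_seriesE R 1 k; rewrite lt_eqF// => /(_ isT) /(congr1 (@^~ m)).
  rewrite /series/= mul1r; under eq_bigr do rewrite mul1r.
  by move=> ->; rewrite ler_pdivrMr ?subr_gt0// mulVf ?subr_eq0 ?gt_eqF// gerBl exprn_ge0.
pose E := [set x | (h x < +oo)%E] `&` [set x | 0 < w x].
have mE : measurable E.
  apply: measurableI.
    rewrite -[X in measurable X]setTI; apply: emeasurable_fun_infty_o => //.
  rewrite -[X in measurable X]setTI.
  have -> : [set: T] `&` [set x | 0 < w x] = setT `&` w @^-1` `]0, +oo[.
    by apply/seteqP; split=> x [_] /=; rewrite in_itv/= andbT.
  exact: mw.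
(* The indicator makes the sequence converge at every point, which is what measurability of the
   limit asks for. Almost every point outside [E] has weight 0. *)
pose v m x := u m x * \1_E x.
have cv x : cvgn (v ^~ x).
  rewrite /v; have [|nE] := pselect (E x); last first.
    apply/cvg_ex; exists 0; under eq_fun do rewrite indicE memNset// mulr0.
    exact: cvg_cst.
  move=> Ex; have [hx wx] := Ex; rewrite indicE mem_set//.
  under eq_fun do rewrite mulr1.
  have : cvgn (series (telescope (u ^~ x))).
    apply: normed_cvg; apply: nondecreasing_is_cvgn.
      by apply: nondecreasing_series => // n _ _; exact: normr_ge0.
    exists (fine (h x) / w x) => _ [m _ <-].
    rewrite ler_pdivlMr// -lee_fin fineK; last first.
      rewrite ge0_fin_numE//; apply: nneseries_ge0 => i _ _.
      by rewrite lee_fin mulr_ge0.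
    rewrite /series/= mulr_suml -sumEFin.
    apply: (le_trans _ (nneseries_lim_ge m _)) => /=; last first.
      by move=> i _; rewrite lee_fin mulr_ge0.
    by apply: lee_sum => i _; rewrite lee_fin mulrC.
  move=> /cvg_ex[l sl]; apply/cvg_ex; exists (u 0%N x + l).
  have -> : (fun m => u m x) = (fun m => u 0%N x + series (telescope (u ^~ x)) m).
    by apply/funext => m; exact: (eq_sum_telescope (u ^~ x)).
  by apply: cvgD => //; exact: cvg_cst.
pose f x := limn (v ^~ x).
have mf : measurable_fun setT f.
  apply: (measurable_fun_cvg (h := v)); last by move=> x _; exact: cv.
  by move=> m; apply: measurable_funM.
have h0 x : (0 <= h x)%E.
  by apply: nneseries_ge0 => i _ _; rewrite lee_fin mulr_ge0.
have aeE : {ae mu, forall x, (h x < +oo)%E}.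
  have : mu.-integrable setT h.
    apply/integrableP; split => //.
    by rewrite (eq_integral h)// => x _; rewrite gee0_abs.
  move=> /(integrable_ae measurableT); apply: filterS => x /(_ I).
  by rewrite ge0_fin_numE.
have bnd m : (wnorm (fun x => f x - u m x)%R <= (k ^+ m * C / (1 - k))%:E)%E.
  (* Fatou's lemma in [j] carries the bound [tail] over to the limit. *)
  pose F j x := (w x * `|u (m + j)%N x - u m x|)%:E.
  have mF j : measurable_fun setT (F j).
    by apply: (@measurable_wnorm (fun x => u (m + j)%N x - u m x)); exact: measurable_funB.
  apply: (@le_trans _ _ (\int[mu]_x limn_einf (F ^~ x))%E).
    apply: ae_ge0_le_integral => //.
    - by move=> x _; rewrite lee_fin mulr_ge0.
    - by apply: (@measurable_wnorm (fun x => f x - u m x)); exact: measurable_funB.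
    - move=> x _; rewrite limn_einf_lim; apply: lime_ge; first exact: is_cvg_einfs.
      apply: nearW => j; apply: le_ereal_inf_tmp => _ [i _ <-].
      by rewrite lee_fin mulr_ge0.
    - rewrite (_ : (fun x => _) = (fun x => - limn_esup (-%E \o F ^~ x))%E); last first.
        by apply/funext => x; rewrite limn_esupN oppeK.
      apply: measurableT_comp => //.
      apply: (@measurable_fun_limn_esup _ _ _ _ (fun j x => - F j x)%E) => j.
      exact: measurableT_comp.
    apply: filterS aeE => x hx _.
    have [wx|wx] := ltP 0 (w x); last first.
      have -> : w x = 0 by apply/eqP; rewrite eq_le wx w0.
      rewrite mul0r limn_einf_lim; apply: lime_ge; first exact: is_cvg_einfs.
      apply: nearW => j; apply: le_ereal_inf_tmp => _ [i _ <-].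
      by rewrite lee_fin mulr_ge0.
    have Ex : E x by split.
    have cF : F ^~ x @ \oo --> (w x * `|f x - u m x|)%:E.
      apply/cvg_EFin; first by apply: nearW.
      apply: cvgMr; apply: cvg_norm; apply: cvgB; last exact: cvg_cst.
      have := cv x; rewrite /v indicE mem_set//; under eq_fun do rewrite mulr1.
      move=> /cvg_ex[l ul].
      have -> : f x = l.
        rewrite /f /v indicE mem_set//; under eq_fun do rewrite mulr1.
        by apply/cvg_lim.
      rewrite /comp/=.
      move: ul; rewrite -(cvg_shiftn m); apply: cvg_trans; apply: near_eq_cvg.
      by apply: nearW => j; rewrite addnC.
    by rewrite is_cvg_limn_einfE; [rewrite (cvg_lim _ cF)|apply/cvg_ex; eexists; exact: cF].
  apply: (le_trans (fatou _ _ _ _)) => //.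
    by move=> j x _; rewrite lee_fin mulr_ge0.
  rewrite limn_einf_lim; apply: lime_le; first exact: is_cvg_einfs.
  apply: nearW => j; apply: ge_ereal_inf.
  by exists (\int[mu]_x F j x)%E; [exists j => /=|exact: tail].
exists f => //; split => //.
have -> : f = (fun x => (f x - u 0%N x) + u 0%N x) by apply/funext => x; rewrite subrK.
apply: (le_lt_trans (wnormD _ _)) => //; first exact: measurable_funB.
rewrite lte_add_pinfty//; first by apply: (le_lt_trans (bnd _)); exact: ltry.
by case: (u1 0%N).
Qed.

End weighted_L1.

Lemma wL1_weight_le d (T : measurableType d) (R : realType)
    (mu : {measure set T -> \bar R}) (w w' : T -> R) (C : R) (f : T -> R) :
  measurable_fun setT w -> measurable_fun setT w' -> (forall x, 0 <= w x) ->
  (forall x, w x <= C * w' x) -> 0 <= C -> (forall x, 0 <= w' x) ->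
  wL1 mu w' f -> wL1 mu w f.
Proof.
move=> mw mw' w0 ww' C0 w'0 [mf fy]; split => //.
apply: (@le_lt_trans _ _ (C%:E * wnorm mu w' f)%E); last exact: lte_mul_pinfty.
rewrite /wnorm -ge0_integralZl//; last 2 first.
- exact: measurable_wnorm.
- by move=> x _; rewrite lee_fin mulr_ge0.
apply: ge0_le_integral => //.
- by move=> x _; rewrite lee_fin mulr_ge0.
- exact: measurable_wnorm.
- by apply: measurable_funeM; exact: measurable_wnorm.
- by move=> x _; rewrite -EFinM lee_fin mulrA ler_wpM2r.
Qed.

Lemma wnorm_scale_le d (T : measurableType d) (R : realType)
    (mu : {measure set T -> \bar R}) (w : T -> R) (K : R) (f g : T -> R) :
  measurable_fun setT w -> (forall x, 0 <= w x) -> 0 <= K ->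
  measurable_fun setT f -> measurable_fun setT g ->
  (forall x, `|f x| <= K * `|g x|) -> (wnorm mu w f <= K%:E * wnorm mu w g)%E.
Proof.
move=> mw w0 K0 mf mg fg; rewrite /wnorm -ge0_integralZl//; last 2 first.
- exact: measurable_wnorm.
- by move=> x _; rewrite lee_fin mulr_ge0.
apply: ge0_le_integral => //.
- by move=> x _; rewrite lee_fin mulr_ge0.
- exact: measurable_wnorm.
- by apply: measurable_funeM; exact: measurable_wnorm.
- by move=> x _; rewrite -EFinM lee_fin mulrCA ler_wpM2l.
Qed.

Lemma wL1_scale_le d (T : measurableType d) (R : realType)
    (mu : {measure set T -> \bar R}) (w : T -> R) (K : R) (f g : T -> R) :
  measurable_fun setT w -> (forall x, 0 <= w x) -> 0 <= K ->
  measurable_fun setT f -> wL1 mu w g ->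
  (forall x, `|f x| <= K * `|g x|) -> wL1 mu w f.
Proof.
move=> mw w0 K0 mf [mg gy] fg; split => //.
apply: (le_lt_trans (wnorm_scale_le mu mw w0 K0 mf mg fg)).
exact: lte_mul_pinfty.
Qed.

Lemma wL1Z d (T : measurableType d) (R : realType)
    (mu : {measure set T -> \bar R}) (w : T -> R) (c : R) (f : T -> R) :
  measurable_fun setT w -> (forall x, 0 <= w x) ->
  wL1 mu w f -> wL1 mu w (fun x => c * f x).
Proof.
move=> mw w0 f1; have [mf _] := f1.
apply: (wL1_scale_le mw w0 (normr_ge0 c) _ f1); first exact: measurable_funM.
by move=> x; rewrite normrM.
Qed.

(** * Contractions of a weighted L^1 space *)

Section contraction.
Context d (T : measurableType d) (R : realType).
Variables (mu : {measure set T -> \bar R}) (w : T -> R).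
Hypotheses (mw : measurable_fun setT w) (w0 : forall x, 0 <= w x).
Variables (S : (T -> R) -> T -> R) (k : R).
Hypotheses (k01 : 0 <= k < 1) (S1 : forall f, wL1 mu w f -> wL1 mu w (S f)).
Hypothesis Sk : forall f g, wL1 mu w f -> wL1 mu w g ->
  (wnorm mu w (fun x => S f x - S g x)%R <=
   k%:E * wnorm mu w (fun x => f x - g x)%R)%E.

(** Picard iteration from 0. Since [wnorm] is only a seminorm on functions, the fixed point is one
    up to a function of norm 0. *)
Lemma contraction_fixpoint :
  exists2 f, wL1 mu w f & wnorm mu w (fun x => S f x - f x) = 0%E.
Proof.
have /andP[k0 k1] := k01.
pose u m := iter m S (cst 0).
have u1 m : wL1 mu w (u m) by elim: m => [|m ih]; [exact: wL10|exact: S1].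
have Nfin f : wL1 mu w f -> wnorm mu w f \is a fin_num.
  by move=> [_ fy]; rewrite ge0_fin_numE// wnorm_ge0.
pose C := fine (wnorm mu w (fun x => u 1%N x - u 0%N x)).
have du m : (wnorm mu w (fun x => u m.+1 x - u m x)%R <= (k ^+ m * C)%:E)%E.
  elim: m => [|m ih].
    by rewrite expr0 mul1r /C fineK// Nfin//; exact: wL1B.
  apply: (le_trans (Sk (u1 m.+1) (u1 m))).
  by rewrite exprS -mulrA EFinM lee_wpmul2l// lee_fin.
have C0 : 0 <= C by rewrite fine_ge0// wnorm_ge0.
have [f f1 fu] := wL1_complete mw w0 k01 C0 u1 du.
exists f => //; apply/eqP; rewrite eq_le wnorm_ge0// andbT.
have bnd m : (wnorm mu w (fun x => S f x - f x)%R <=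
    (k ^+ m * (2 * C / (1 - k)))%:E)%E.
  have mf : measurable_fun setT f by case: f1.
  have mSf : measurable_fun setT (S f) by case: (S1 f1).
  have mum : measurable_fun setT (u m.+1) by case: (u1 m.+1).
  apply: (le_trans (wnormB_le mu mw w0 mSf mum mf)).
  have -> : k ^+ m * (2 * C / (1 - k)) =
    k ^+ m * C / (1 - k) + k ^+ m * C / (1 - k) by ring.
  rewrite EFinD leeD//.
    apply: (le_trans (Sk f1 (u1 m))); apply: (le_trans _ (fu m)).
    rewrite -[leRHS]mul1e lee_wpmul2r ?wnorm_ge0// lee_fin; exact: ltW.
  rewrite wnormB; apply: (le_trans (fu m.+1)).
  rewrite lee_fin ler_wpM2r ?invr_ge0 ?subr_ge0 ?(ltW k1)//.
  by rewrite ler_wpM2r// exprS ler_piMl ?exprn_ge0// ltW.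
have : (fun m => (k ^+ m * (2 * C / (1 - k)))%:E) @ \oo --> (0 * (2 * C / (1 - k)))%:E.
  apply: cvg_EFin; first exact: nearW.
  apply: cvgMl; apply: cvg_expr; rewrite ger0_norm//.
rewrite mul0r => lim0.
apply: (@le_trans _ _ (limn (fun m => (k ^+ m * (2 * C / (1 - k)))%:E))).
  by apply: lime_ge; [apply/cvg_ex; eexists; exact: lim0|exact: nearW].
by rewrite (cvg_lim _ lim0).
Qed.

Lemma contraction_unique f g : wL1 mu w f -> wL1 mu w g ->
  wnorm mu w (fun x => S f x - f x) = 0%E ->
  wnorm mu w (fun x => S g x - g x) = 0%E ->
  wnorm mu w (fun x => f x - g x) = 0%E.
Proof.
move=> f1 g1 Sf Sg.
have [mf _] := f1; have [mg _] := g1.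
have [mSf _] := S1 f1; have [mSg _] := S1 g1.
have := wnormB_le mu mw w0 mf mSf mg.
rewrite [X in (_ <= X + _)%E]wnormB Sf add0e => /le_trans/(_ (wnormB_le mu mw w0 mSf mSg mg)).
rewrite Sg adde0 => /le_trans/(_ (Sk f1 g1)).
have [_ fgy] := wL1B mw w0 f1 g1.
have := wnorm_ge0 mu w0 (fun x => f x - g x).
(* Finiteness of the norm is what turns N <= k N into N = 0. *)
rewrite -ge0_fin_numE ?wnorm_ge0// in fgy.
rewrite -(fineK fgy) -EFinM !lee_fin => n0 nk.
congr (_%:E); apply/eqP; rewrite eq_le n0 andbT leNgt; apply/negP => npos.
by move: nk; rewrite leNgt gtr_pMl//; case/andP : k01 => _ ->.
Qed.

End contraction.

(** * Integral operators with nonnegative kernels *)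

Section kernel_operator.
Context d (T : measurableType d) (R : realType).
Variable mu : {sigma_finite_measure set T -> \bar R}.
Implicit Types (k : T * T -> R) (f g w : T -> R).

(** Where the integral is infinite this takes the default value 0, so linearity in [f] is available
    only at points of integrability. *)
Definition kop k f (t : T) : R := \int[mu]_s (k (t, s) * f s).

Lemma measurable_section k t : measurable_fun setT k ->
  measurable_fun setT (fun s => k (t, s)).
Proof. by move=> mk; apply: measurableT_comp => //; exact: measurable_pair1. Qed.

Lemma measurable_kop k f : measurable_fun setT k -> measurable_fun setT f ->
  measurable_fun setT (kop k f).
Proof.
move=> mk mf.
pose h (z : T * T) := (k z * f z.2)%:E.
have mh : measurable_fun setT h.
  apply/measurable_EFinP; apply: measurable_funM => //.
  exact: measurableT_comp.
rewrite /kop /Rintegral; apply: measurableT_comp => //.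
rewrite (_ : (fun t => _) = (fubini_F mu h^\+ \- fubini_F mu h^\-)%E); last first.
  apply/funext => t; rewrite integralE /fubini_F /=.
  by congr (_ - _)%E; apply: eq_integral => s _; rewrite ?funeposE ?funenegE.
apply: emeasurable_funB; apply: measurable_fun_fubini_tonelli_F => //.
  exact: measurable_funepos.
exact: measurable_funeneg.
Qed.

Lemma kop_ext k f g t : {ae mu, forall s, k (t, s) != 0 -> f s = g s} ->
  kop k f t = kop k g t.
Proof.
move=> fg; congr fine; apply: ae_eq_integral_nonmeas.
apply: filterS fg => s fg _; have [->|/fg ->//] := eqVneq (k (t, s)) 0.
by rewrite !mul0r.
Qed.

Variable w : T -> R.
Hypotheses (mw : measurable_fun setT w) (w0 : forall x, 0 <= w x).
Variables (k : T * T -> R) (M : R).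
Hypotheses (mk : measurable_fun setT k) (k0 : forall z, 0 <= k z) (M0 : 0 <= M).
Hypothesis wk : forall s, (\int[mu]_t (w t * k (t, s))%:E <= (M * w s)%:E)%E.

(** Schur's test for L^1: Tonelli puts the integral over [t] inside, where the column bound [wk]
    applies. *)
Let kabs_bound f : measurable_fun setT f ->
  (\int[mu]_t ((w t)%:E * \int[mu]_s (k (t, s) * `|f s|)%:E) <=
   M%:E * wnorm mu w f)%E.
Proof.
move=> mf; pose h (z : T * T) := (w z.1 * (k z * `|f z.2|))%:E.
have mh : measurable_fun setT h.
  apply/measurable_EFinP; apply: measurable_funM; first exact: measurableT_comp.
  by apply: measurable_funM => //; do 2 apply: measurableT_comp => //.
have h0 z : (0 <= h z)%E by rewrite lee_fin !mulr_ge0.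
have mkf t : measurable_fun setT (fun s => (k (t, s) * `|f s|)%:E).
  apply/measurable_EFinP; apply: measurable_funM; first exact: measurable_section.
  exact: measurableT_comp.
rewrite (eq_integral (fun t => \int[mu]_s h (t, s))%E); last first.
  move=> t _; rewrite -ge0_integralZl//; last 2 first.
  - by move=> s _; rewrite lee_fin mulr_ge0.
  - by rewrite lee_fin.
rewrite (fubini_tonelli h)// /wnorm -ge0_integralZl//; last 2 first.
- exact: measurable_wnorm.
- by move=> s _; rewrite lee_fin mulr_ge0.
have mwk s : measurable_fun setT (fun t => (w t * k (t, s))%:E).
  apply/measurable_EFinP; apply: measurable_funM => //.
  by apply: measurableT_comp => //; exact: measurable_pair2.
apply: ge0_le_integral => //.
- by move=> s _; apply: integral_ge0.
- exact: (measurable_fun_fubini_tonelli_G h).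
- by apply: measurable_funeM; exact: measurable_wnorm.
move=> s _; rewrite (eq_integral (fun t => (`|f s|)%:E * (w t * k (t, s))%:E)%E); last first.
  by move=> t _; rewrite /h -EFinM; congr EFin => /=; ring.
rewrite ge0_integralZl//; last first.
  by move=> t _; rewrite lee_fin mulr_ge0.
apply: (le_trans (lee_wpmul2l _ (wk s))); first by rewrite lee_fin.
by rewrite -!EFinM lee_fin le_eqVlt; apply/orP; left; apply/eqP; ring.
Qed.

Lemma kop_bound f : measurable_fun setT f ->
  (wnorm mu w (kop k f) <= M%:E * wnorm mu w f)%E.
Proof.
move=> mf; apply: (le_trans _ (kabs_bound mf)).
have mkf t : measurable_fun setT (fun s => (k (t, s) * f s)%:E).
  by apply/measurable_EFinP; apply: measurable_funM => //; exact: measurable_section.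
apply: ge0_le_integral => //.
- by move=> t _; rewrite lee_fin mulr_ge0.
- by apply: measurable_wnorm => //; exact: measurable_kop.
- apply: emeasurable_funM; first exact/measurable_EFinP.
  apply: (measurable_fun_fubini_tonelli_F (fun z : T * T => (k z * `|f z.2|)%:E)).
    apply/measurable_EFinP; apply: measurable_funM => //.
    by do 2 apply: measurableT_comp => //.
  by move=> z; rewrite lee_fin mulr_ge0.
move=> t _; rewrite EFinM lee_wpmul2l ?lee_fin//.
have /(le_trans _) := le_abse_integral mu measurableT (mkf t).
rewrite /kop /Rintegral; case: (X in `|X|%E) => [r| |] /=; last 2 first.
  by rewrite normr0 => _; apply: integral_ge0 => s _; rewrite lee_fin mulr_ge0.
  by rewrite normr0 => _; apply: integral_ge0 => s _; rewrite lee_fin mulr_ge0.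
rewrite /= => /(_ _ (lexx _))/le_trans; apply.
rewrite le_eqVlt; apply/orP; left; apply/eqP; apply: eq_integral => s _.
by rewrite normrM (ger0_norm (k0 _)).
Qed.

Lemma wL1_kop f : wL1 mu w f -> wL1 mu w (kop k f).
Proof.
move=> [mf fy]; split; first exact: measurable_kop.
apply: (le_lt_trans (kop_bound mf)); rewrite lte_mul_pinfty//.
Qed.

(** The double integral in [kabs_bound] is finite, so its outer integrand is finite almost
    everywhere, and a nonzero weight can be divided out. *)
Lemma kop_integrable_ae f : wL1 mu w f ->
  {ae mu, forall t, w t != 0 ->
    mu.-integrable setT (fun s => (k (t, s) * f s)%:E)}.
Proof.
move=> [mf fy].
have mkf t : measurable_fun setT (fun s => (k (t, s) * f s)%:E).
  by apply/measurable_EFinP; apply: measurable_funM => //; exact: measurable_section.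
have : mu.-integrable setT
    (fun t => (w t)%:E * \int[mu]_s (k (t, s) * `|f s|)%:E)%E.
  apply/integrableP; split.
    apply: emeasurable_funM; first exact/measurable_EFinP.
    apply: (measurable_fun_fubini_tonelli_F (fun z : T * T => (k z * `|f z.2|)%:E)).
      apply/measurable_EFinP; apply: measurable_funM => //.
      by do 2 apply: measurableT_comp => //.
    by move=> z; rewrite lee_fin mulr_ge0.
  rewrite (eq_integral (fun t => (w t)%:E * \int[mu]_s (k (t, s) * `|f s|)%:E)%E).
    apply: (le_lt_trans (kabs_bound mf)); rewrite lte_mul_pinfty//.
  move=> t _; rewrite gee0_abs// mule_ge0 ?lee_fin//.
  by apply: integral_ge0 => s _; rewrite lee_fin mulr_ge0.
move=> /(integrable_ae measurableT); apply: filterS => t /(_ I) fint wt.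
apply/integrableP; split => //.
rewrite (eq_integral (fun s => (k (t, s) * `|f s|)%:E)); last first.
  by move=> s _ /=; rewrite normrM (ger0_norm (k0 _)).
rewrite -ge0_fin_numE; last first.
  by apply: integral_ge0 => s _; rewrite lee_fin mulr_ge0.
move: fint; case: (X in ((w t)%:E * X)%E) => [r|//|] //.
  by rewrite gt0_muley// lte_fin lt0r wt w0.
by rewrite gt0_muleNy// lte_fin lt0r wt w0.
Qed.

Lemma kop_lipschitz f g : wL1 mu w f -> wL1 mu w g ->
  (wnorm mu w (fun t => kop k f t - kop k g t)%R <=
   M%:E * wnorm mu w (fun t => f t - g t)%R)%E.
Proof.
move=> f1 g1; have [mf _] := f1; have [mg _] := g1.
apply: (le_trans _ (kop_bound (measurable_funB mf mg))).
apply: wnorm_le => //.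
- by apply: measurable_funB; exact: measurable_kop.
- by apply: measurable_kop => //; exact: measurable_funB.
move: (kop_integrable_ae f1) (kop_integrable_ae g1).
apply: filterS2 => t; have [->|wt] := eqVneq (w t) 0; first by rewrite !mul0r.
move=> /(_ isT) ft /(_ isT) gt.
rewrite /kop; under [X in _ <= _ * `|X|]eq_Rintegral do rewrite mulrBr.
by rewrite RintegralB.
Qed.

End kernel_operator.

(** Fubini at a fixed [t]. As [k1] and [k2] are nonnegative, Tonelli makes integrability against the
    composed kernel [k3] the same as integrability of the triple product in both variables. *)
Lemma kop_comp d (T : measurableType d) (R : realType)
    (mu : {sigma_finite_measure set T -> \bar R}) (k1 k2 k3 : T * T -> R)
    (f : T -> R) (t : T) :
  measurable_fun setT k1 -> measurable_fun setT k2 -> measurable_fun setT f ->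
  (forall z, 0 <= k1 z) -> (forall z, 0 <= k2 z) ->
  (forall s, (\int[mu]_r (k1 (t, r) * k2 (r, s))%:E)%E = (k3 (t, s))%:E) ->
  mu.-integrable setT (fun s => (k3 (t, s) * f s)%:E) ->
  kop mu k1 (kop mu k2 f) t = kop mu k3 f t.
Proof.
move=> mk1 mk2 mf k10 k20 k12 k3f.
have k30 s : 0 <= k3 (t, s).
  by rewrite -lee_fin -k12; apply: integral_ge0 => r _; rewrite lee_fin mulr_ge0.
pose h (z : T * T) := (k1 (t, z.1) * k2 z * f z.2)%:E.
have mh : measurable_fun setT h.
  apply/measurable_EFinP; apply: measurable_funM; last exact: measurableT_comp.
  apply: measurable_funM => //.
  by apply: (measurableT_comp (measurable_section t mk1)).
have mk12 s : measurable_fun setT (fun r => (k1 (t, r) * k2 (r, s))%:E).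
  apply/measurable_EFinP; apply: measurable_funM; first exact: measurable_section.
  by apply: measurableT_comp => //; exact: measurable_pair2.
have inth : (mu \x mu)%E.-integrable setT h.
  apply/integrable21ltyP => //.
  move/integrableP : k3f => [_]; apply: le_lt_trans.
  rewrite le_eqVlt; apply/orP; left; apply/eqP; apply: eq_integral => s _.
  rewrite (eq_integral (fun r => (`|f s|)%:E * (k1 (t, r) * k2 (r, s))%:E)%E).
    rewrite ge0_integralZl//; last first.
      by move=> r _; rewrite lee_fin mulr_ge0.
    by rewrite k12 -EFinM /= normrM (ger0_norm (k30 _)) mulrC.
  move=> r _; rewrite /h -EFinM /=.
  by rewrite !normrM (ger0_norm (k10 _)) (ger0_norm (k20 _)) mulrC.
have := Fubini inth.
rewrite [X in _ = X -> _](eq_integral (fun s => (k3 (t, s) * f s)%:E)); last first.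
  move=> s _; rewrite (eq_integral (fun r => (f s)%:E * (k1 (t, r) * k2 (r, s))%:E)%E).
    rewrite integralZl//; last first.
      apply/integrableP; split => //.
      rewrite (eq_integral (fun r => (k1 (t, r) * k2 (r, s))%:E)) ?k12 ?ltry//.
      by move=> r _; rewrite gee0_abs// lee_fin mulr_ge0.
    by rewrite k12 -EFinM mulrC.
  by move=> r _; rewrite /h -EFinM mulrC.
move=> h12; rewrite /kop /Rintegral -h12; congr fine.
apply: ae_eq_integral_nonmeas.
have := ae_integrable1 inth.
apply: filterS => r hr _.
(* Integrability of the inner function is inherited from [h] by dividing by [k1 (t, r)]; where this
   factor is 0 both sides vanish. *)
have [k1r|k1r] := eqVneq (k1 (t, r)) 0.
  by rewrite k1r mul0r integral0_eq// => s _; rewrite /h /= k1r !mul0r.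
have k2f : mu.-integrable setT (fun s => (k2 (r, s) * f s)%:E).
  apply: (eq_integrable measurableT (fun s => ((k1 (t, r))^-1)%:E * h (r, s))%E).
    by move=> s _; rewrite /h -EFinM /= !mulrA mulVf// mul1r.
  exact: integrableZl.
rewrite EFinM /Rintegral fineK; last exact: integrable_fin_num.
rewrite -integralZl//; apply: eq_integral => s _.
by rewrite /h -EFinM /= mulrA.
Qed.

Lemma kop_linear d (T : measurableType d) (R : realType)
    (mu : {sigma_finite_measure set T -> \bar R}) (k : T * T -> R) (c : R) (f g : T -> R) t :
  mu.-integrable setT (fun s => (k (t, s) * f s)%:E) ->
  mu.-integrable setT (fun s => (k (t, s) * g s)%:E) ->
  kop mu k (fun s => c * f s + g s) t = c * kop mu k f t + kop mu k g t.
Proof.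
move=> kf kg; rewrite /kop -RintegralZl// -RintegralD//; last exact: (integrableZl _ _ kf).
by apply: eq_Rintegral => s _; rewrite mulrDr mulrCA.
Qed.

(** * Absolutely continuous functions *)

Section abs_cont_seq.
Variable R : realType.
Implicit Types (a b e x y : R) (F G : R -> R) (p q : R * R) (s : seq (R * R)).

Definition nonoverlapping p q := (p.2 <= q.1) || (q.2 <= p.1).

Definition subitv a b p := (a <= p.1) && ((p.1 <= p.2) && (p.2 <= b)).

(** Lists replace the families indexed by ordinals, so that an interval can be replaced by the
    pieces of a partition of it. *)
Definition abs_cont_seq a b F := forall e, 0 < e -> exists2 d, 0 < d &
  forall s, all (subitv a b) s -> pairwise nonoverlapping s ->
    \sum_(p <- s) (p.2 - p.1) < d -> \sum_(p <- s) `|F p.2 - F p.1| < e.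

Lemma nonoverlappingC p q : nonoverlapping p q = nonoverlapping q p.
Proof. by rewrite /nonoverlapping orbC. Qed.

Lemma abs_cont_abs_cont_seq a b F : abs_cont a b F -> abs_cont_seq a b F.
Proof.
move=> acF e e0; have [d d0 dF] := acF e e0; exists d => // s sab sno sd.
pose p (i : 'I_(size s)) := nth (a, a) s i.
have := dF (size s) (fun i => (p i).1) (fun i => (p i).2).
rewrite !(big_nth (a, a)) !big_mkord in sd *; apply => //.
- move=> i; have /andP[? /andP[? ?]] := all_nthP (a, a) sab i (ltn_ord i).
  by split => //; apply/andP; split.
- apply/trivIsetP => i j _ _ ij.
  wlog ltij : i j ij / (i < j)%N.
    move=> H; have := ij; rewrite neq_ltn => /orP[ltij|ltji]; first exact: H.
    by rewrite setIC; apply: H => //; rewrite eq_sym.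
  have := pairwiseP (a, a) sno i j (ltn_ord i) (ltn_ord j) ltij.
  move=> ijno; apply/seteqP; split => // x /=.
  rewrite !in_itv/= => -[/andP[xi1 xi2] /andP[xj1 xj2]].
  case/orP : ijno => h.
    by have := lt_trans xj1 (lt_le_trans xi2 h); rewrite ltxx.
  by have := lt_trans xi1 (lt_le_trans xj2 h); rewrite ltxx.
Qed.

(** Lists the consecutive intervals of a partition, so that [variation] becomes a sum over pairs to
    which [abs_cont_seq] applies. *)
Fixpoint chain x (l : seq R) : seq (R * R) :=
  if l is y :: l' then (x, y) :: chain y l' else [::].

Lemma sum_chain (h : R -> R -> R) x l y0 :
  \sum_(p <- chain x l) h p.1 p.2 =
  \sum_(0 <= n < size l) h (nth y0 (x :: l) n) (nth y0 (x :: l) n.+1).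
Proof.
elim: l x => [|y l ih] x /=; first by rewrite big_nil big_geq.
by rewrite big_cons ih big_nat_recl.
Qed.

Lemma chain_length x l : \sum_(p <- chain x l) (p.2 - p.1) = last x l - x.
Proof.
elim: l x => [|y l ih] x /=; first by rewrite big_nil subrr.
by rewrite big_cons ih /= addrC addrA subrK.
Qed.

Lemma chain_subitv x l : path <%O x l -> all (subitv x (last x l)) (chain x l).
Proof.
elim: l x => [//|y l ih] x /= /andP[xy pl].
have yl : y <= last y l.
  by elim: l y {ih xy} pl => //= z l ih y /andP[/ltW yz /ih]; exact: le_trans.
rewrite /subitv /= lexx (ltW xy) yl/=.
apply: sub_all (ih _ pl) => p /andP[h1 h2]; rewrite /subitv h2 andbT.
exact: le_trans (ltW xy) h1.
Qed.

Lemma chain_nonoverlapping x l :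
  path <%O x l -> pairwise nonoverlapping (chain x l).
Proof.
elim: l x => [//|y l ih] x /= /andP[xy pl]; rewrite ih// andbT.
apply: sub_all (chain_subitv pl) => p /andP[h _].
by rewrite /nonoverlapping /= h.
Qed.

Lemma subitv_trans x y p q : subitv x y p -> subitv p.1 p.2 q -> subitv x y q.
Proof.
move=> /andP[xp /andP[_ py]] /andP[pq /andP[qq qp]].
by rewrite /subitv (le_trans xp pq) qq (le_trans qp py).
Qed.

Lemma nonoverlapping_sub p q r :
  nonoverlapping p q -> subitv p.1 p.2 r -> nonoverlapping r q.
Proof.
move=> /orP[h|h] /andP[pr /andP[_ rp]]; apply/orP; [left|right].
  exact: le_trans rp h.
exact: le_trans h pr.
Qed.

(** Subdividing the intervals changes neither their total length nor the fact that they do not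
    overlap, so the same [d] controls all partitions at once. *)
Lemma abs_cont_seq_total_variation a b F : abs_cont_seq a b F ->
  forall e, 0 < e -> exists2 d, 0 < d &
  forall s, all (subitv a b) s -> pairwise nonoverlapping s ->
    \sum_(p <- s) (p.2 - p.1) < d ->
    (\sum_(p <- s) total_variation p.1 p.2 F <= e%:E)%E.
Proof.
move=> acF e e0; have [d d0 dF] := acF e e0; exists d => // s sab sno sd.
(* Intervals are upgraded one at a time: those of [s1] count by total variation, those of [s2] by
   increments. The head of [s1] is cut by an arbitrary partition whose pieces join [s2], and then
   the supremum over partitions is taken. *)
suff gen s1 s2 : all (subitv a b) (s1 ++ s2) ->
    pairwise nonoverlapping (s1 ++ s2) ->
    \sum_(p <- s1 ++ s2) (p.2 - p.1) < d ->
    (\sum_(p <- s1) total_variation p.1 p.2 F +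
      (\sum_(p <- s2) `|F p.2 - F p.1|)%:E <= e%:E)%E.
  by have := gen s [::]; rewrite cats0 big_nil adde0; apply.
elim: s1 s2 => [|p s1 ih] s2 /=.
  by move=> h1 h2 h3; rewrite big_nil add0e lee_fin ltW// dF.
move=> /andP[pab s12ab] /andP[pno s12no]; rewrite big_cons => len.
have /andP[ap /andP[pp pb]] := pab.
have [s1ab s2ab] : all (subitv a b) s1 /\ all (subitv a b) s2.
  by move: s12ab; rewrite all_cat => /andP[].
have [ps1 ps2] : all (nonoverlapping p) s1 /\ all (nonoverlapping p) s2.
  by move: pno; rewrite all_cat => /andP[].
have step l : itv_partition p.1 p.2 l ->
   (\sum_(p <- s1) total_variation p.1 p.2 F +
      (variation p.1 p.2 F l + \sum_(p <- s2) `|F p.2 - F p.1|)%:E <= e%:E)%E.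
  move=> [pl /eqP lastl].
  have -> : variation p.1 p.2 F l = \sum_(q <- chain p.1 l) `|F q.2 - F q.1|.
    by rewrite (sum_chain (fun x y => `|F y - F x|) _ _ p.2).
  have csub := chain_subitv pl; rewrite lastl in csub.
  have cno := chain_nonoverlapping pl.
  have := ih (chain p.1 l ++ s2).
  rewrite !all_cat s1ab s2ab/= andbT => /(_ _)/wrap[].
    by apply: sub_all csub => q; exact: subitv_trans.
  have sub_no (q : R * R) (t : seq (R * R)) : q \in chain p.1 l ->
      all (nonoverlapping p) t -> all (nonoverlapping q) t.
    move=> /(allP csub) qp; apply: sub_all => r /nonoverlapping_sub; exact.
  move: s12no; rewrite !pairwise_cat => /and3P[s12 s1no s2no] /(_ _)/wrap[].
    rewrite s1no cno s2no !andbT allrel_catr s12 andbT.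
    apply/andP; split.
      rewrite allrelC; apply/allrelP => q r qc rs; rewrite nonoverlappingC.
      by rewrite (allP (sub_no _ _ qc ps1)).
    by apply/allrelP => q r qc rs; rewrite (allP (sub_no _ _ qc ps2)).
  rewrite !big_cat/= chain_length lastl => /(_ _)/wrap[].
    by move: len; rewrite big_cat/= addrCA.
  by [].
rewrite [X in (X + _ <= _)%E]big_cons.
have TV0 (q : R * R) : subitv a b q -> (0 <= total_variation q.1 q.2 F)%E.
  by move=> /andP[_ /andP[qq _]]; exact: total_variation_ge0.
have X0 : (0 <= \sum_(p <- s1) total_variation p.1 p.2 F)%E.
  by rewrite big_seq; apply: sume_ge0 => q qs; apply: TV0; exact: (allP s1ab).
move: step; set X := (\sum_(p <- s1) _)%E in X0 *.
set y := \sum_(p <- s2) _ => step.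
clearbody X y.
have [l0 pl0] : exists l, itv_partition p.1 p.2 l.
  move: pp; rewrite le_eqVlt => /predU1P[->|pp]; first by exists [::]; split => /=.
  by exists [:: p.2]; exact: itv_partition1.
(* One partition already shows that [X] is finite, so it can be moved to the other side before the
   supremum is taken. *)
have Xfin : X \is a fin_num.
  rewrite ge0_fin_numE//; rewrite ltNge leye_eq; apply/negP => /eqP Xy.
  by have := step _ pl0; rewrite Xy addye.
rewrite -(fineK Xfin) in step *.
rewrite -addeA -EFinD -leeBrDr// -EFinB.
apply: ge_ereal_sup => _ [_ [l /step h <-] <-].
by move: h; rewrite -EFinD !lee_fin => h; lra.
Qed.
End abs_cont_seq.

Section abs_cont_decomposition.
Variable R : realType.
Implicit Types (a b e x y : R) (F G : R -> R).

(** Intervals shorter than the [d] belonging to [e = 1] have variation at most 1, and finitely many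
    steps of length [d / 2] cover the interval. *)
Lemma abs_cont_seq_TV_fin a b F : a <= b -> abs_cont_seq a b F ->
  total_variation a b F \is a fin_num.
Proof.
move=> ab /abs_cont_seq_total_variation /(_ _ ltr01)[d d0 dF].
have small x y : a <= x -> x <= y -> y <= b -> y - x < d ->
    (total_variation x y F <= 1)%E.
  move=> ax xy yb xyd; have := dF [:: (x, y)].
  by rewrite !big_seq1/= /subitv/= ax xy yb; apply.
have d20 : 0 < d / 2 by rewrite divr_gt0.
suff : forall n x, a <= x -> x <= b -> x - a <= n%:R * (d / 2) ->
    total_variation a x F \is a fin_num.
  apply; [exact: ab|exact: lexx|].
  rewrite -ler_pdivrMr//; apply: ltW; apply: archi_boundP.
  by rewrite divr_ge0 ?subr_ge0// ltW.
elim=> [|n ih] x ax xb.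
  rewrite mul0r subr_le0 => xa; have -> : x = a by apply/eqP; rewrite eq_le xa.
  by rewrite total_variationxx.
move=> xn; pose z := Num.max a (x - d / 2).
have az : a <= z by rewrite le_max lexx.
have zx : z <= x by rewrite ge_max ax gerBl ltW.
rewrite (total_variationD F az zx) fin_numD ih//=; last 2 first.
- exact: le_trans xb.
- rewrite lerBlDr ge_max lerDr mulr_ge0 ?(ltW d20)//=.
  by move: xn; rewrite -natr1 mulrDl mul1r; lra.
rewrite ge0_fin_numE ?total_variation_ge0//.
apply: (@le_lt_trans _ _ 1%E); last exact: ltry.
apply: small => //; rewrite ltrBlDr -ltrBlDl lt_max; apply/orP; right.
by rewrite ltrBlDl; lra.
Qed.

(** Jordan decomposition, with [V t] the variation of [F] on [[a, t]]: increments of [F] are bounded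
    by those of [V], and [V] is absolutely continuous by [abs_cont_seq_total_variation]. *)
Lemma abs_cont_decomposition a b F : a <= b -> abs_cont a b F ->
  exists2 V : R -> R,
    {in `[a, b] &, nondecreasing_fun V} /\ abs_cont_seq a b V &
    {in `[a, b] &, nondecreasing_fun (fun t => V t - F t)} /\
    abs_cont_seq a b (fun t => V t - F t).
Proof.
move=> ab /abs_cont_abs_cont_seq acF.
pose V t := fine (total_variation a t F).
have TVfin x y : a <= x -> x <= y -> y <= b -> total_variation x y F \is a fin_num.
  move=> ax xy yb; have := abs_cont_seq_TV_fin ab acF.
  rewrite (total_variationD F (le_trans ax xy) yb) (total_variationD F ax xy).
  by rewrite !fin_numD => /andP[/andP[]].
have VB x y : a <= x -> x <= y -> y <= b -> V y - V x = fine (total_variation x y F).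
  move=> ax xy yb; rewrite /V (total_variationD F ax xy) fineD ?TVfin//.
    by rewrite addrC addKr.
  exact: le_trans yb.
have FV x y : a <= x -> x <= y -> y <= b -> `|F y - F x| <= V y - V x.
  move=> ax xy yb; rewrite VB// -lee_fin fineK ?TVfin//.
  exact: total_variation_ge.
have acV : abs_cont_seq a b V.
  move=> e e0; have e20 : 0 < e / 2 by rewrite divr_gt0.
  have [d d0 dF] := abs_cont_seq_total_variation acF e20.
  exists d => // s sab sno sd; have := dF s sab sno sd.
  rewrite (_ : \sum_(p <- s) _ = (\sum_(p <- s) `|V p.2 - V p.1|)%:E)%E.
    by rewrite lee_fin => /le_lt_trans; apply; lra.
  rewrite -sumEFin; apply: eq_big_seq => p ps.
  have /andP[ap /andP[pp pb]] := allP sab _ ps.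
  rewrite VB// ger0_norm ?fineK ?TVfin//.
  by rewrite fine_ge0// total_variation_ge0.
exists V; split => //.
- move=> x y; rewrite !in_itv/= => /andP[ax xb] /andP[ay yb] xy.
  by rewrite -subr_ge0; apply: le_trans (FV _ _ ax xy yb).
- move=> x y; rewrite !in_itv/= => /andP[ax xb] /andP[ay yb] xy.
  have := FV _ _ ax xy yb; have := ler_norm (F y - F x); lra.
move=> e e0; have e20 : 0 < e / 2 by rewrite divr_gt0.
have [d1 d10 dV] := acV _ e20; have [d2 d20 dF] := acF _ e20.
exists (Num.min d1 d2); first by rewrite lt_min d10.
move=> s sab sno; rewrite lt_min => /andP[sd1 sd2].
have := ltrD (dV s sab sno sd1) (dF s sab sno sd2).
rewrite -big_split/= -splitr; apply: le_lt_trans; apply: ler_sum => p _.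
rewrite (_ : _ - _ = (V p.2 - V p.1) - (F p.2 - F p.1)); last by ring.
exact: ler_normB.
Qed.
End abs_cont_decomposition.

(** * Densities of absolutely continuous functions *)

Section abs_cont_density.
Variable R : realType.
Implicit Types (a b e x y t : R) (F G : R -> R).
Notation leb := (@lebesgue_measure R).

(** Composition with this projection onto [[a, b]] extends a monotone function to the line, as the
    Lebesgue-Stieltjes measure requires. *)
Definition clamp a b t : R := Num.max a (Num.min t b).

Lemma clamp_itv a b t : a <= b -> a <= clamp a b t <= b.
Proof. by move=> ab; rewrite /clamp le_max lexx ge_max ab ge_min lexx orbT. Qed.

Lemma clamp_id a b t : a <= t <= b -> clamp a b t = t.
Proof. by move=> /andP[at_ tb]; rewrite /clamp min_l// max_r. Qed.

Lemma clamp_homo a b x y : x <= y -> clamp a b x <= clamp a b y.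
Proof.
move=> xy; rewrite /clamp ge_max !le_max lexx/=; apply/orP; right.
by rewrite le_min !ge_min xy lexx orbT.
Qed.

Lemma clamp_lip a b x y : a <= b -> x <= y -> clamp a b y - clamp a b x <= y - x.
Proof.
move=> ab xy; rewrite /clamp !maxEle !minEle.
by case: (leP y b) => ?; case: (leP x b) => ?;
  case: (leP a x) => ?; case: (leP a y) => ?; rewrite ?ab; lra.
Qed.

Lemma open_interval_bounded (X : set R) : open X -> is_interval X ->
  X !=set0 -> (leb X < +oo)%E -> exists x y, x < y /\ X = `]x, y[%classic.
Proof.
move=> /interior_id oX /is_intervalP XE [z Xz]; move: oX Xz.
rewrite XE; case: (Rhull X) => [[bl x|[]] [br y|[]]]; rewrite ?interior_itv.
- move=> <- /=; rewrite in_itv/= => /andP[xz zy] _.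
  by exists x, y; rewrite (lt_trans xz zy).
all: by [move=> _; rewrite set_itv_ge
        |move=> _ _; rewrite lebesgue_measure_itv/= ?ltNyr ?ltry].
Qed.

(** The density is the Radon-Nikodym derivative of the Lebesgue-Stieltjes measure [nu] of the
    clamped [G]; absolute continuity of the function gives absolute continuity of the measure. *)
Lemma nondecreasing_abs_cont_density a b G : a <= b ->
  {in `[a, b] &, nondecreasing_fun G} -> abs_cont_seq a b G ->
  exists2 g : R -> R, leb.-integrable setT (EFin \o g) &
    forall t, a <= t <= b -> G t - G a = \int[leb]_(s in `]a, t]) g s.
Proof.
move=> ab ndG acG; pose H t := G (clamp a b t).
have clab t : clamp a b t \in `[a, b] by rewrite in_itv/= clamp_itv.
have ndH : nondecreasing H.
  by move=> x y xy; apply: ndG => //; exact: clamp_homo.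
have small e : 0 < e -> exists2 d : R, 0 < d & forall x y, x <= y -> y - x < d ->
    H y - H x < e.
  move=> e0; have [d d0 dG] := acG e e0; exists d => // x y xy xyd.
  have := dG [:: (clamp a b x, clamp a b y)].
  rewrite !big_seq1/= andbT => dGxy; apply: (le_lt_trans (ler_norm _)).
  apply: dGxy => //; last exact: le_lt_trans (clamp_lip ab xy) xyd.
  rewrite /subitv/=; have /andP[-> _] := clamp_itv x ab.
  by have /andP[_ ->] := clamp_itv y ab; rewrite clamp_homo.
have rcH : right_continuous H.
  move=> x; apply/cvgrPdist_lt => e e0; have [d d0 dH] := small e e0.
  near=> y; have xy : x <= y by apply: ltW; near: y; exact: nbhs_right_gt.
  rewrite distrC ger0_norm ?subr_ge0 ?ndH//; apply: dH => //.
  by rewrite ltrBlDl; near: y; apply: nbhs_right_lt; rewrite ltrDl.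
pose c : cumulative R R := HB.pack H (isCumulative.Build R _ R H ndH rcH).
pose nu := lebesgue_stieltjes_measure c.
have nuE x y : x <= y -> nu `]x, y]%classic = (H y - H x)%:E.
  move=> xy; rewrite /nu /lebesgue_stieltjes_measure /measure_extension.
  rewrite measurable_mu_extE/=; last exact: is_ocitv.
  by rewrite wlength_itv_bnd.
have nuT : (nu setT <= (G b - G a)%:E)%E.
  rewrite -(bigcup_itvT false false).
  pose I n : set R := `]- (n%:R), n%:R]%classic.
  have cI : (nu \o I) n @[n --> \oo] --> nu (\bigcup_n I n).
    apply: nondecreasing_cvg_mu; rewrite /I//; first exact: bigcup_measurable.
    by move=> *; apply/subsetPset/subset_itv; rewrite leBSide/= ?lerN2 ler_nat.
  rewrite -(cvg_lim _ cI)//; apply: lime_le; first by apply/cvg_ex; eexists; exact: cI.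
  apply: nearW => n /=; rewrite /I nuE; last by apply: (@le_trans _ _ 0); rewrite ?oppr_le0 ?ler0n.
  rewrite lee_fin lerB// ndG//; rewrite ?in_itv/= ?lexx ?ab//.
    by have /andP[] := clamp_itv n%:R ab.
  by have /andP[] := clamp_itv (- n%:R) ab.
have nufin : fin_num_fun nu.
  move=> A mA; rewrite ge0_fin_numE//; apply: (@le_lt_trans _ _ (nu setT)).
    by apply: le_measure; rewrite ?inE.
  by apply: (le_lt_trans nuT); exact: ltry.
pose nuf : {finite_measure set _ -> \bar R} :=
  HB.pack nu (Measure_isFinite.Build _ _ _ nu nufin).
have nu0 : nu set0 = 0%E by exact: (measure0 nuf).
(* A null set lies in an open set of measure below [d]. Any finitely many components of it, clamped
   to [[a, b]], are admissible in the definition of absolute continuity, so their total [nu]-mass is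
   below [e]. *)
have nuleb : nuf `<< leb.
  apply/null_content_dominatesP => N mN N0.
  apply/eqP; rewrite eq_le measure_ge0 andbT; apply/lee_addgt0Pr => e e0; rewrite add0e.
  have [d d0 dG] := acG e e0.
  have [|U [oU NU Ud]] := lebesgue_regularity_outer mN _ d0.
    by rewrite N0 ltry.
  have mU : measurable U by exact: open_measurable.
  have {}Ud : (leb U < d%:E)%E.
    apply: (le_lt_trans _ Ud).
    rewrite -[leLHS](_ : leb ((U `\` N) `|` N) = _); last by rewrite setUC setDUK.
    apply: (le_trans (measureU2 _ _ _)) => //; first exact: measurableD.
    by rewrite [X in (_ + X <= _)%E]N0 adde0.
  pose I i := open_disjoint_itv oU i.
  have UI : U = \bigcup_i I i := open_disjoint_itv_bigcup oU.
  have IU i : I i `<=` U by move=> x Ix; rewrite UI; exists i.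
  have tI : trivIset setT I by exact: open_disjoint_itv_trivIset.
  have oI i : open (I i) by exact: open_disjoint_itv_open.
  have mI i : measurable (I i) by exact: open_measurable.
  (* The pair [p] is the clamped component; an empty component is represented by [(a, a)]. *)
  have pI i : exists p : R * R, [/\ subitv a b p, (nu (I i) <= (G p.2 - G p.1)%:E)%E,
      ((p.2 - p.1)%:E <= leb (I i))%E & (I i = set0 /\ p = (a, a)) \/
      exists x y, [/\ x < y, I i = `]x, y[%classic & p = (clamp a b x, clamp a b y)]].
    have [I0|/set0P I0] := eqVneq (I i) set0.
      exists (a, a); split.
      - by rewrite /subitv/= lexx ab.
      - by rewrite I0 nu0 subrr.
      - by rewrite I0 measure0 subrr.
      - by left.
    have Iy : (leb (I i) < +oo)%E.
      apply: (@le_lt_trans _ _ (leb U)); last by apply: (lt_trans Ud); exact: ltry.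
      by apply: le_measure; [rewrite inE; exact: mI|rewrite inE; exact: mU|exact: IU].
    have [x [y [xy Ixy]]] := open_interval_bounded (oI i)
      (@open_disjoint_itv_is_interval _ _ oU i) I0 Iy.
    exists (clamp a b x, clamp a b y); split.
    - rewrite /subitv/=; have /andP[-> _] := clamp_itv x ab.
      by have /andP[_ ->] := clamp_itv y ab; rewrite clamp_homo// ltW.
    - rewrite -[leRHS](nuE _ _ (ltW xy)); apply: le_measure; [rewrite inE; exact: mI|by rewrite inE; exact: measurable_itv|].
      by rewrite Ixy; exact: subset_itv_oo_oc.
    - rewrite Ixy lebesgue_measure_itv/= lte_fin xy -EFinD lee_fin.
      exact: clamp_lip (ltW xy).
    - by right; exists x, y.
  have [p pP] := choice pI.
  rewrite (@le_trans _ _ (nu U))//; first by apply: le_measure; rewrite ?inE//; exact: mU.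
  have bigE (m : {measure set (measurableTypeR R) -> \bar R}) :
      m U = (\sum_(0 <= i <oo) m (I i))%E.
    rewrite [in LHS]UI measure_bigcup//; last by move=> i _; exact: mI.
    by apply: eq_eseriesl => i /=; rewrite mem_set.
  rewrite [leLHS](bigE nuf); apply: lime_le.
    by apply: is_cvg_nneseries => i _ _; exact: measure_ge0.
  apply: nearW => n.
  have sI (i : nat) : subitv a b (p i) by case: (pP i).
  have := dG [seq p i | i <- index_iota 0 n].
  rewrite !big_map all_map => dGp.
  apply: (@le_trans _ _ (\sum_(0 <= i < n) (G (p i).2 - G (p i).1)%:E)%E).
    by apply: lee_sum => i _; case: (pP i).
  rewrite sumEFin lee_fin; apply: ltW.
  apply: (@le_lt_trans _ _ (\sum_(0 <= i < n) `|G (p i).2 - G (p i).1|)).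
    by apply: ler_sum => i _; exact: ler_norm.
  apply: dGp.
  - by apply/allP => i _; exact: sI.
  - rewrite pairwise_map /index_iota subn0.
    have := iota_ltn_sorted 0 n; rewrite sorted_pairwise; last exact: ltn_trans.
    apply: sub_pairwise => i j ij; rewrite /relpre /=.
    have {}ij : (i < j)%N := ij.
    have [_ _ _ pi] := pP i; have [_ _ _ pj] := pP j.
    case: pi => [[_ ->]|[x [y [xy Ii pi]]]].
      by rewrite /nonoverlapping /=; have /andP[-> _] := sI j.
    case: pj => [[_ ->]|[x' [y' [xy' Ij pj]]]].
      by rewrite /nonoverlapping /= orbC; have /andP[-> _] := sI i.
    rewrite pi pj /nonoverlapping /=.
    have [yx'|x'y] := leP y x'; first by rewrite clamp_homo.
    have [y'x|xy''] := leP y' x; first by rewrite [X in _ || X]clamp_homo// orbT.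
    have : I i `&` I j = set0.
      by move/trivIsetP : tI; apply => //; rewrite neq_ltn ij.
    (* Overlapping components would share the midpoint between the larger left end and the smaller
       right end. *)
    rewrite Ii Ij => /seteqP[+ _] => /(_ ((Num.max x x' + Num.min y y') / 2)) [].
    rewrite !maxEle !minEle.
    by split; rewrite /= in_itv/=; case: (leP x x') => ?; case: (leP y y') => ?;
      apply/andP; split; lra.
  rewrite -lte_fin; apply: le_lt_trans Ud; rewrite -sumEFin.
  apply: (@le_trans _ _ (\sum_(0 <= i < n) leb (I i))%E).
    by apply: lee_sum => i _; case: (pP i).
  rewrite [leRHS](bigE leb).
  by apply: (le_trans (nneseries_lim_ge n _)).
have [g [g0 gfin gint gE]] := radon_nikodym_sigma_finite nuleb.
exists (fine \o g).
  by apply: (eq_integrable measurableT g) => // x _; rewrite /= fineK.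
move=> t /andP[at_ tb]; rewrite /Rintegral.
rewrite (eq_integral g); last by move=> x _; rewrite /= fineK.
have := gE `]a, t]%classic (measurable_itv _).
rewrite [nuf _]nuE// => <- /=.
by rewrite /H !clamp_id// ?lexx// at_.
Unshelve. all: by end_near. Qed.

Lemma derive1_near (F G : R -> R) t : {near t, F =1 G} ->
  derivable G t 1 -> derivable F t 1 /\ derive1 F t = derive1 G t.
Proof.
move=> FG dG; have GF : {near t, G =1 F} by apply: filterS FG => x ->.
split; first exact: near_eq_derivable GF dG.
by rewrite !derive1E; exact: near_eq_derive FG.
Qed.

Lemma derive1_cstD (c : R) (F : R -> R) t : derivable F t 1 ->
  derivable (fun y => c + F y) t 1 /\ derive1 (fun y => c + F y) t = derive1 F t.
Proof.
move=> dF; have dc : derivable (cst c : R -> R) t 1 by exact: derivable_cst.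
split; first exact: (derivableD dc dF).
rewrite !derive1E; have := deriveD dc dF.
by rewrite derive_cst add0r.
Qed.

(** The density is the difference of those of the two monotone parts. Lebesgue differentiation
    applies to its indefinite integral, which agrees with [F] near each interior point up to the
    constant [F a]. *)
Lemma abs_cont_FTC a b F : a < b -> abs_cont a b F ->
  exists g : R -> R, [/\ leb.-integrable setT (EFin \o g),
    (forall t, a <= t <= b -> F t = F a + \int[leb]_(s in `]a, t]) g s) &
    {ae leb, forall t, t \in `]a, b[ -> derivable F t 1 /\ derive1 F t = g t}].
Proof.
move=> ab acF; have [V [ndV acV] [ndW acW]] := abs_cont_decomposition (ltW ab) acF.
have [g1 g1i g1E] := nondecreasing_abs_cont_density (ltW ab) ndV acV.
have [g2 g2i g2E] := nondecreasing_abs_cont_density (ltW ab) ndW acW.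
pose g s := g1 s - g2 s.
have gi : leb.-integrable setT (EFin \o g).
  exact: (integrableB measurableT g1i g2i).
have FE t : a <= t <= b -> F t = F a + \int[leb]_(s in `]a, t]) g s.
  move=> tab; rewrite RintegralB//; last 2 first.
  - exact: integrableS g1i.
  - exact: integrableS g2i.
  by rewrite -g1E// -g2E//; ring.
exists g; split => //.
have gloc : locally_integrable setT g.
  by apply: open_integrable_locally => //; exact: openT.
have gy y : leb.-integrable [set` Interval (BRight a) (BRight y)] (EFin \o g).
  exact: integrableS gi.
move: (FTC1 gy gloc); apply: filterS; first exact: (ae_filter_ringOfSetsType leb).
move=> t tD; rewrite in_itv/= => /andP[at_ tb].
have [|dI dIE] := tD; first by rewrite lte_fin.
pose I y := F a + \int[leb]_(s in `]a, y]) g s.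
have [dI1 I1E] := derive1_cstD (F a) dI.
have [dF dFE] : derivable F t 1 /\ derive1 F t = derive1 I t.
  apply: derive1_near => //.
  near=> y; apply: FE.
  have : y \in `]a, b[ by near: y; apply: near_in_itvoo; rewrite in_itv/= at_.
  by rewrite in_itv/= => /andP[/ltW-> /ltW->].
split; first exact: dF.
by rewrite dFE I1E.
Unshelve. all: by end_near. Qed.

End abs_cont_density.

(** * Substitution and power integrals *)

Section substitution.
Variable R : realType.
Implicit Types (a b x y t : R) (F f g : R -> R).
Notation leb := (@lebesgue_measure R).

(** The shift by 3 keeps twice this length below [b - a], so the shrunken interval is nondegenerate
    for every [n]. *)
Let inner a b (n : nat) : R := (b - a) / n.+3%:R.

Let inner_lt a b n : a < b -> a + inner a b n < b - inner a b n.
Proof.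
move=> ab; rewrite /inner -subr_gt0.
have n0 : 0 < n.+3%:R :> R by rewrite ltr0n.
have n2 : 2 < n.+3%:R :> R by rewrite ltr_nat.
rewrite (_ : _ - _ = (b - a) * (n.+3%:R - 2) / n.+3%:R); last first.
  by field; rewrite gt_eqF.
by rewrite divr_gt0// mulr_gt0// subr_gt0.
Qed.

Let inner_gt0 a b n : a < b -> 0 < inner a b n.
Proof. by move=> ab; rewrite divr_gt0 ?subr_gt0// ltr0n. Qed.

Let inner_homo a b n m : a < b -> (n <= m)%N -> inner a b m <= inner a b n.
Proof.
move=> ab nm; rewrite ler_wpM2l ?subr_ge0 ?(ltW ab)//.
by rewrite lef_pV2 ?posrE ?ltr0n// ler_nat !ltnS.
Qed.

Let inner_small a b d : a < b -> 0 < d -> exists n, inner a b n <= d.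
Proof.
move=> ab d0; exists (Num.bound ((b - a) / d)).
rewrite ler_pdivrMr ?ltr0n// mulrC -ler_pdivrMr//; apply: ltW.
have := archi_boundP (divr_ge0 (ltW (_ : 0 < b - a)) (ltW d0)).
rewrite subr_gt0 => /(_ ab)/lt_le_trans; apply.
by rewrite ler_nat -addn3 leq_addr.
Qed.

(** Both [f] and [g] may be singular at the end points, as for powers at 0. The compact version is
    applied to a shrinking margin, and monotone convergence passes to the open intervals. *)
Lemma ge0_integration_by_substitution_oo F g f a b : a < b ->
  {in `[a, b] &, {homo F : x y / x < y}} ->
  (forall x, x \in `]a, b[ -> is_derive x 1 F (g x)) ->
  (forall x, x \in `]a, b[ -> {for x, continuous g}) ->
  (forall x, x \in `]a, b[ -> 0 <= g x) ->
  F x @[x --> a^'+] --> F a -> F x @[x --> b^'-] --> F b ->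
  (forall y, y \in `]F a, F b[ -> {for y, continuous f}) ->
  (forall y, y \in `]F a, F b[ -> 0 <= f y) ->
  (\int[leb]_(y in `]F a, F b[) (f y)%:E =
   \int[leb]_(x in `]a, b[) (f (F x) * g x)%:E)%E.
Proof.
move=> ab incF dF cg g0 Fa Fb cf f0.
pose an n := a + inner a b n; pose bn n := b - inner a b n.
have anbn n : an n < bn n by exact: inner_lt.
have aan n : a < an n by rewrite ltrDl inner_gt0.
have bnb n : bn n < b by rewrite ltrBlDr ltrDl inner_gt0.
have abn n x : an n <= x -> x <= bn n -> x \in `]a, b[.
  by move=> h1 h2; rewrite in_itv/= (lt_le_trans (aan n) h1) (le_lt_trans h2 (bnb n)).
have sub n x : x \in `[an n, bn n] -> x \in `]a, b[.
  by rewrite in_itv/= => /andP[]; exact: abn.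
have incF' x y : x \in `[a, b] -> y \in `[a, b] -> x <= y -> F x <= F y.
  by move=> xab yab; rewrite le_eqVlt => /predU1P[->//|/incF]; move=> /(_ xab yab)/ltW.
have oc x : x \in `]a, b[ -> x \in `[a, b] by exact: subset_itv_oo_cc.
have acc : a \in `[a, b] by rewrite in_itv/= lexx ltW.
have bcc : b \in `[a, b] by rewrite in_itv/= lexx ltW.
have Foo x : x \in `]a, b[ -> F x \in `]F a, F b[.
  move=> xab; have := xab; rewrite !in_itv/= => /andP[ax xb].
  by rewrite (incF a x acc (oc x xab) ax) (incF x b (oc x xab) bcc xb).
have UE : \bigcup_n `[an n, bn n]%classic = `]a, b[%classic.
  apply/seteqP; split => [x [n _] /sub//|x /=]; rewrite in_itv/= => /andP[ax xb].
  have d0 : 0 < Num.min (x - a) (b - x) by rewrite lt_min !subr_gt0 ax.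
  have [n] := inner_small ab d0; rewrite le_min => /andP[n1 n2].
  by exists n => //=; rewrite in_itv/= /an /bn; apply/andP; split; lra.
(* The one-sided limits of [F] at the ends are what makes the image intervals exhaust the open
   interval. *)
have UFE : \bigcup_n `[F (an n), F (bn n)]%classic = `]F a, F b[%classic.
  apply/seteqP; split => [y [n _] /=|y /=].
    rewrite !in_itv/= => /andP[h1 h2].
    have /andP[+ _] : F a < F (an n) < F b.
      by have := Foo (an n); rewrite in_itv/=; apply; apply: (abn n) => //; exact: ltW.
    have /andP[_ +] : F a < F (bn n) < F b.
      by have := Foo (bn n); rewrite in_itv/=; apply; apply: (abn n) => //; exact: ltW.
    by move=> h3 h4; rewrite (lt_le_trans h4 h1) (le_lt_trans h2 h3).
  rewrite in_itv/= => /andP[ay yb].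
  have [x1 [ax1 x1b Fx1]] : exists x1, [/\ a < x1, x1 < b & F x1 < y].
    near a^'+ => x; exists x; split.
    - by near: x; exact: nbhs_right_gt.
    - by near: x; exact: nbhs_right_lt.
    - by near: x; move/cvgr_lt : Fa; apply.
  have [x2 [ax2 x2b Fx2]] : exists x2, [/\ a < x2, x2 < b & y < F x2].
    near b^'- => x; exists x; split.
    - by near: x; exact: nbhs_left_gt.
    - by near: x; exact: nbhs_left_lt.
    - by near: x; move/cvgr_gt : Fb; apply.
  have d0 : 0 < Num.min (x1 - a) (b - x2) by rewrite lt_min !subr_gt0 ax1.
  have [n] := inner_small ab d0; rewrite le_min => /andP[n1 n2].
  exists n => //=; rewrite in_itv/=; apply/andP; split.
    apply: (le_trans _ (ltW Fx1)); apply: incF'; last by rewrite /an; lra.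
      by apply/oc/(abn n) => //; exact: ltW.
    by rewrite in_itv/= !ltW.
  apply: (le_trans (ltW Fx2)); apply: incF'; last by rewrite /bn; lra.
    by rewrite in_itv/= !ltW.
  by apply/oc/(abn n) => //; exact: ltW.
have ndU : nondecreasing_seq (fun n => `[an n, bn n]%classic).
  move=> n m nm; apply/subsetPset/subset_itv; rewrite leBSide/=.
    by rewrite lerD2l; exact: inner_homo.
  by rewrite lerD2l lerN2; exact: inner_homo.
have anI n : an n \in `[a, b] by apply/oc/(abn n) => //; exact: ltW.
have bnI n : bn n \in `[a, b] by apply/oc/(abn n) => //; exact: ltW.
have ndUF : nondecreasing_seq (fun n => `[F (an n), F (bn n)]%classic).
  move=> n m nm; apply/subsetPset/subset_itv; rewrite leBSide/=.
    by apply: incF' => //; rewrite lerD2l; exact: inner_homo.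
  by apply: incF' => //; rewrite lerD2l lerN2; exact: inner_homo.
have subF n y : y \in `[F (an n), F (bn n)] -> y \in `]F a, F b[.
  by move=> yn; move: (UFE) => /seteqP[+ _]; apply; exists n.
have cfn n : {within `[F (an n), F (bn n)], continuous f}.
  by apply: continuous_in_subspaceT => y; rewrite inE => /subF; exact: cf.
have cF x : x \in `]a, b[ -> {for x, continuous F}.
  by move=> xab; apply: differentiable_continuous; apply/derivable1_diffP; case: (dF x xab).
have cfF n : {within `[an n, bn n], continuous (fun x => f (F x) * g x)}.
  apply: continuous_in_subspaceT => x; rewrite inE => /sub xab.
  apply: cvgM; last exact: cg.
  by apply: continuous_comp; [exact: cF|apply: cf; exact: Foo].
have step n : (\int[leb]_(y in `[F (an n), F (bn n)]) (f y)%:E =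
    \int[leb]_(x in `[an n, bn n]) (f (F x) * g x)%:E)%E.
  have F'g x : x \in `]a, b[ -> derive1 F x = g x.
    by move=> xab; rewrite derive1E; have := dF x xab => -[].
  have nF'g x : x \in `]a, b[ -> {near x, derive1 F =1 g}.
    by move=> xab; near=> y; apply: F'g; near: y; exact: near_in_itvoo.
  have cF' x : x \in `]a, b[ -> derive1 F y @[y --> x] --> derive1 F x.
    move=> xab; rewrite F'g//; apply: cvg_trans (cg _ xab).
    by apply: near_eq_cvg; apply: filterS (nF'g _ xab) => y ->.
  rewrite (@integration_by_substitution_increasing _ F f (an n) (bn n))//.
  - apply: eq_integral => x; rewrite inE => /sub xab.
    by rewrite -[_ x]/(f (F x) * derive1 F x) F'g.
  - exact: ltW.
  - by move=> x y /sub/oc xab /sub/oc yab; exact: incF.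
  - by move=> x xn; apply: cF'; apply: sub; exact: subset_itv_oo_cc xn.
  - apply/cvg_ex; exists (derive1 F (an n)); apply: cvg_at_right_filter.
    by apply: cF'; apply: (abn n) => //; exact: ltW.
  - apply/cvg_ex; exists (derive1 F (bn n)); apply: cvg_at_left_filter.
    by apply: cF'; apply: (abn n) => //; exact: ltW.
  - split.
    + move=> x xn; have : x \in `]a, b[ by apply: sub; exact: subset_itv_oo_cc xn.
      by move=> /dF [].
    + by apply: cvg_at_right_filter; apply: cF; apply: (abn n) => //; exact: ltW.
    + by apply: cvg_at_left_filter; apply: cF; apply: (abn n) => //; exact: ltW.
have lim1 : (\int[leb]_(y in `[F (an n), F (bn n)]) (f y)%:E)%E @[n --> \oo] -->
    (\int[leb]_(y in `]F a, F b[) (f y)%:E)%E.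
  rewrite -UFE; apply: ge0_nondecreasing_set_cvg_integral => //.
  - move=> n; apply/measurable_EFinP.
    exact: subspace_continuous_measurable_fun.
  - by move=> n y /subF yab; rewrite lee_fin f0.
have lim2 : (\int[leb]_(x in `[an n, bn n]) (f (F x) * g x)%:E)%E @[n --> \oo] -->
    (\int[leb]_(x in `]a, b[) (f (F x) * g x)%:E)%E.
  rewrite -UE; apply: ge0_nondecreasing_set_cvg_integral => //.
  - move=> n; apply/measurable_EFinP.
    exact: subspace_continuous_measurable_fun.
  - by move=> n y /sub yab; rewrite lee_fin mulr_ge0 ?g0// f0 ?Foo.
rewrite -(cvg_lim _ lim1)// -(cvg_lim _ lim2)//.
by congr (limn _); apply/funext => n; exact: step.
Unshelve. all: by end_near. Qed.

End substitution.

Lemma le0_ger_powR_pos (R : realType) (p x y : R) : p <= 0 -> 0 < x -> x <= y ->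
  y `^ p <= x `^ p.
Proof.
move=> p0 x0 xy; have y0 := lt_le_trans x0 xy.
rewrite -(opprK p) (powRN x) (powRN y) lef_pV2 ?posrE ?powR_gt0//.
by rewrite ge0_ler_powR ?oppr_ge0 ?nnegrE ?(ltW x0) ?(ltW y0).
Qed.

(** * Power, Gamma, Laplace and Beta integrals *)

Section power_integrals.
Variable R : realType.
Implicit Types (a b c e x y t r s M : R).
Notation leb := (@lebesgue_measure R).

Lemma powR_continuous r x : 0 < x -> {for x, continuous (@powR R ^~ r)}.
Proof.
move=> x0; apply: differentiable_continuous; apply/derivable1_diffP.
by apply: derivable_powR; rewrite in_itv/= x0.
Qed.

Lemma powR_cvg_at_right r a : 0 < r -> 0 <= a ->
  x `^ r @[x --> a^'+] --> a `^ r.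
Proof.
move=> r0; rewrite le_eqVlt => /predU1P[<-|a0].
  by rewrite powR0 ?gt_eqF//; exact: powR_cvg0.
by apply: cvg_at_right_filter; exact: powR_continuous.
Qed.

Lemma powR_cvg_at_left r a : 0 < a -> x `^ r @[x --> a^'-] --> a `^ r.
Proof. by move=> a0; apply: cvg_at_left_filter; exact: powR_continuous. Qed.

Lemma powR_increasing r a b : 0 < r -> 0 <= a ->
  {in `[a, b] &, {homo (@powR R ^~ r) : x y / x < y}}.
Proof.
move=> r0 a0 x y; rewrite !in_itv/= => /andP[ax _] /andP[ay _].
by apply: gt0_ltr_powR => //; rewrite nnegrE (le_trans a0).
Qed.

Lemma integral_cst_oo c a b : a < b ->
  (\int[leb]_(x in `]a, b[) c%:E = (c * (b - a))%:E)%E.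
Proof.
move=> ab; have := @integral_cst _ _ _ leb `]a, b[%classic (measurable_itv _) c%:E.
rewrite /= => ->; rewrite lebesgue_measure_itv/= lte_fin ab.
by rewrite -EFinB -EFinM.
Qed.

Lemma ge0_integral_derive_oo (F g : R -> R) a b : a < b ->
  {in `[a, b] &, {homo F : x y / x < y}} ->
  (forall x, x \in `]a, b[ -> is_derive x 1 F (g x)) ->
  (forall x, x \in `]a, b[ -> {for x, continuous g}) ->
  (forall x, x \in `]a, b[ -> 0 <= g x) ->
  F x @[x --> a^'+] --> F a -> F x @[x --> b^'-] --> F b ->
  (\int[leb]_(x in `]a, b[) (g x)%:E = (F b - F a)%:E)%E.
Proof.
move=> ab incF dF cg g0 Fa Fb.
have := @ge0_integration_by_substitution_oo R F g (cst 1) a b ab incF dF cg g0 Fa Fb.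
under [in RHS]eq_integral do rewrite /= mul1r.
move=> <-; last 2 first.
- by move=> y _; exact: cvg_cst.
- by move=> y _.
by rewrite integral_cst_oo ?mul1r// incF// in_itv/= ?lexx ltW.
Qed.

Lemma integral_powR_oo r a b : 0 < r -> 0 <= a -> a < b ->
  (\int[leb]_(x in `]a, b[) (r * x `^ (r - 1))%:E = (b `^ r - a `^ r)%:E)%E.
Proof.
move=> r0 a0 ab.
have xgt0 x : x \in `]a, b[ -> 0 < x.
  by rewrite in_itv/= => /andP[+ _]; exact: le_lt_trans.
apply: (@ge0_integral_derive_oo (@powR R ^~ r)) => //.
- exact: powR_increasing.
- by move=> x /xgt0 x0; exact: is_derive1_powR.
- move=> x /xgt0 x0; apply: cvgM; first exact: cvg_cst.
  exact: powR_continuous.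
- by move=> x /xgt0 x0; rewrite mulr_ge0 ?powR_ge0 ?ltW.
- exact: powR_cvg_at_right.
- by apply: powR_cvg_at_left; exact: le_lt_trans ab.
Qed.

Lemma integrable_powR_oo r b : 0 < r -> 0 < b ->
  leb.-integrable `]0, b[ (fun x => (x `^ (r - 1))%:E).
Proof.
move=> r0 b0.
have -> : (fun x => (x `^ (r - 1))%:E) =
    (fun x => (r^-1)%:E * (r * x `^ (r - 1))%:E)%E.
  by apply/funext => x; rewrite -EFinM mulKf ?gt_eqF.
apply: integrableZl => //; apply/integrableP; split.
  by apply/measurable_EFinP; apply: measurable_funM => //; apply: measurable_funTS.
under eq_integral do rewrite gee0_abs ?lee_fin ?mulr_ge0 ?powR_ge0 ?(ltW r0)//.
by rewrite integral_powR_oo// ltry.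
Qed.

Lemma integral_powR_lty r b : 0 < r -> 0 < b ->
  (\int[leb]_(x in `]0%R, b[) (x `^ (r - 1))%:E < +oo)%E.
Proof.
move=> r0 b0; have /integrableP[_] := integrable_powR_oo r0 b0; apply: le_lt_trans.
rewrite le_eqVlt; apply/orP; left; apply/eqP; apply: eq_integral => x _.
by rewrite gee0_abs// lee_fin powR_ge0.
Qed.

(** Finiteness matters as much as the lower bound, because a divergent integral would make the real
    number [Gamma r] equal to 0. The integrand is dominated by the power on ]0, 1[ plus the
    exponential density. *)
Lemma Gamma_gt0 r : 0 < r <= 1 -> 0 < @Gamma R r.
Proof.
move=> /andP[r0 r1]; rewrite /Gamma /Rintegral.
have mf D : measurable_fun D (fun t : R => (t `^ (r - 1) * expR (- t))%:E).
  apply/measurable_EFinP; apply: measurable_funM; first exact: measurable_funTS.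
  by apply: measurable_funTS; apply: measurableT_comp.
apply: fine_gt0; apply/andP; split.
  apply: (@lt_le_trans _ _ (\int[leb]_(t in `]0%R, 1%R[) (expR (-1))%:E)%E).
    by rewrite integral_cst_oo// subr0 mulr1 lte_fin expR_gt0.
  apply: (@le_trans _ _ (\int[leb]_(t in `]0%R, 1%R[) (t `^ (r - 1) * expR (- t))%:E)%E).
    apply: ge0_le_integral => //.
    - exact: mf.
    - move=> t /=; rewrite in_itv/= => /andP[t0 t1].
      rewrite lee_fin -[leLHS]mul1r ler_pM ?expR_ge0//.
        rewrite -[leLHS](powRr0 t); apply: ger_powR; first by rewrite t0 ltW.
        by rewrite subr_le0.
      by rewrite ler_expR lerN2 ltW.
  apply: ge0_subset_integral => //.
  - exact: mf.
  - by move=> t _; rewrite lee_fin mulr_ge0 ?powR_ge0 ?expR_ge0.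
  - by apply: subset_itvl.
pose g (t : R) := ((fun t => (t `^ (r - 1))%:E) \_ `]0%R, 1%R[) t.
apply: (@le_lt_trans _ _
    (\int[leb]_(t in `]0%R, +oo[) (g t + (exponential_pdf 1 t)%:E))%E).
  apply: ge0_le_integral => //.
  - by move=> t _; rewrite lee_fin mulr_ge0 ?powR_ge0 ?expR_ge0.
  - exact: mf.
  - apply: emeasurable_funD.
      apply: measurable_funTS; apply/(measurable_restrictT _ _).1 => //.
      by apply/measurable_EFinP; exact: measurable_funTS.
    by apply: measurable_funTS; apply/measurable_EFinP; exact: measurable_exponential_pdf.
  move=> t /=; rewrite in_itv/= andbT => t0.
  rewrite /g patchE exponential_pdfE ?(ltW t0)// mulN1r mul1r.
  case: ifPn => [_|]; last first.
    rewrite notin_setE/= in_itv/= t0/= => /negP; rewrite -leNgt => t1.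
    rewrite add0e lee_fin ler_piMl ?expR_ge0//.
    by rewrite -[leRHS](powRr0 t); apply: ler_powR => //; rewrite subr_le0.
  rewrite -EFinD lee_fin (@le_trans _ _ (t `^ (r - 1)))// ?lerDl ?expR_ge0//.
  by rewrite ler_piMr ?powR_ge0// -expR0 ler_expR oppr_le0 ltW.
have mg : measurable_fun setT g.
  apply/(measurable_restrictT _ _).1 => //.
  by apply/measurable_EFinP; exact: measurable_funTS.
have g0 t : (0 <= g t)%E.
  by rewrite /g patchE; case: ifP => _ //; rewrite lee_fin powR_ge0.
have me : measurable_fun setT (fun t => (@exponential_pdf R 1 t)%:E).
  by apply/measurable_EFinP; exact: measurable_exponential_pdf.
rewrite ge0_integralD//; last 3 first.
- exact: measurable_funTS.
- by move=> t _; rewrite lee_fin exponential_pdf_ge0.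
- exact: measurable_funTS.
apply: lte_add_pinfty.
  apply: (@le_lt_trans _ _ (\int[leb]_t g t)%E).
    by apply: ge0_subset_integral.
  rewrite -integral_mkcond.
  exact: integral_powR_lty.
apply: (@le_lt_trans _ _ (\int[leb]_t (exponential_pdf 1 t)%:E)%E).
  apply: ge0_subset_integral => //.
  by move=> t _; rewrite lee_fin exponential_pdf_ge0.
by rewrite integral_exponential_pdf// ltry.
Qed.

(** Dominated convergence along integer values of [M]; monotonicity in [M] then covers all larger
    reals. *)
Lemma Laplace_powR_small r b e : 0 < r -> 0 < b -> 0 < e ->
  exists2 M0 : R, 0 < M0 & forall M, M0 <= M ->
  (\int[leb]_(y in `]0%R, b[) (y `^ (r - 1) * expR (- (M * y)))%:E <= e%:E)%E.
Proof.
move=> r0 b0 e0.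
have mf M : measurable_fun `]0, b[ (fun y => (y `^ (r - 1) * expR (- (M * y)))%:E).
  apply/measurable_EFinP; apply: measurable_funM; first exact: measurable_funTS.
  apply: measurable_funTS; apply: measurableT_comp => //.
  by apply: measurableT_comp => //; apply: measurable_funM.
have ptw : {ae leb, forall y, `]0, b[%classic y ->
    (y `^ (r - 1) * expR (- (n%:R * y)))%:E @[n --> \oo] --> 0%E}.
  apply: aeW => y /=; rewrite in_itv/= => /andP[y0 yb].
  apply: cvg_EFin; first exact: nearW.
  rewrite -(mulr0 (y `^ (r - 1))); apply: cvgMr.
  under eq_fun do rewrite -mulrN expRM_natl.
  by apply: cvg_expr; rewrite ger0_norm ?expR_ge0// -expR0 ltr_expR oppr_lt0.
have dom : {ae leb, forall y n, `]0, b[%classic y ->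
    (`|(y `^ (r - 1) * expR (- (n%:R * y)))%:E| <= (y `^ (r - 1))%:E)%E}.
  apply: aeW => y n /=; rewrite in_itv/= => /andP[y0 yb].
  rewrite ger0_norm ?mulr_ge0 ?powR_ge0 ?expR_ge0//.
  rewrite lee_fin ler_piMr ?powR_ge0// -expR0 ler_expR oppr_le0.
  by rewrite mulr_ge0// ltW.
have [_ _] := @dominated_convergence _ _ _ leb `]0, b[%classic (measurable_itv _)
  (fun n y => (y `^ (r - 1) * expR (- (n%:R * y)))%:E) (cst 0%E) _
  (fun n => mf n%:R) (measurable_cst _) ptw (integrable_powR_oo r0 b0) dom.
rewrite integral0 => /fine_cvgP[_] /cvgrPdist_lt /(_ _ e0)[N _ HN].
exists (N%:R + 1) => [|M NM]; first by rewrite ltr_wpDl.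
have fin n : (\int[leb]_(y in `]0%R, b[) (y `^ (r - 1) * expR (- (n%:R * y)))%:E)%E
    \is a fin_num.
  apply: integrable_fin_num => //.
  apply: le_integrable (integrable_powR_oo r0 b0) => //; first exact: mf.
  move=> y /=; rewrite in_itv/= => /andP[y0 yb].
  rewrite ger0_norm ?mulr_ge0 ?powR_ge0 ?expR_ge0// ger0_norm ?powR_ge0//.
  rewrite lee_fin ler_piMr ?powR_ge0// -expR0 ler_expR oppr_le0.
  by rewrite mulr_ge0// ltW.
apply: (@le_trans _ _ (\int[leb]_(y in `]0%R, b[) (y `^ (r - 1) * expR (- (N%:R * y)))%:E)%E).
  apply: ge0_le_integral => //.
  - by move=> y _; rewrite lee_fin mulr_ge0 ?powR_ge0 ?expR_ge0.
  - exact: mf.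
  - exact: mf.
  - move=> y /=; rewrite in_itv/= => /andP[y0 yb].
    rewrite lee_fin ler_wpM2l ?powR_ge0// ler_expR lerN2 ler_wpM2r ?(ltW y0)//.
    by apply: le_trans NM; rewrite lerDl.
rewrite -(fineK (fin N)) lee_fin; have := HN N (leqnn N).
rewrite /= sub0r normrN => /ltW; apply: le_trans; exact: ler_norm.
Qed.

(** Cut at 1/2: on each half one factor is bounded and the other integrable. Both factors are at
    least 1 on ]0, 1[, which bounds the integral from below. *)
Lemma Beta_fin r s : 0 < r <= 1 -> 0 < s <= 1 -> exists2 B : R, 0 < B &
  (\int[leb]_(y in `]0%R, 1%R[) ((1 - y) `^ (r - 1) * y `^ (s - 1))%:E = B%:E)%E.
Proof.
move=> /andP[r0 r1] /andP[s0 s1].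
have m1y t D : measurable_fun D (fun y => (1 - y) `^ t : R).
  apply: measurable_funTS; apply: (@measurableT_comp _ _ _ _ _ _ (@powR R ^~ t)) => //.
  exact: measurable_funB.
have mf D : measurable_fun D (fun y => ((1 - y) `^ (r - 1) * y `^ (s - 1))%:E).
  by apply/measurable_EFinP; apply: measurable_funM => //; exact: measurable_funTS.
have yI y : y \in `]0, 1[ -> 0 < 1 - y.
  by rewrite in_itv/= subr_gt0 => /andP[].
(* The factor singular at 1 has the explicit primitive 1 - (1 - y)^r. *)
have refl : (\int[leb]_(y in `]0%R, 1%R[) (r * (1 - y) `^ (r - 1))%:E = 1)%E.
  pose F y : R := 1 - (1 - y) `^ r.
  have dI y : 0 < 1 - y -> is_derive y 1 F (r * (1 - y) `^ (r - 1)).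
    move=> y0.
    have d1 : is_derive y 1 (fun y : R => 1 - y) (-1).
      by have := is_deriveB (is_derive_cst (1 : R) y 1) (is_derive_id y 1); rewrite sub0r.
    have d2 := @is_derive1_comp _ (@powR R ^~ r) (fun y => 1 - y) y _ _ (is_derive1_powR r y0) d1.
    have := is_deriveB (is_derive_cst (1 : R) y 1) d2.
    by rewrite sub0r mulrN1 opprK.
  have -> : 1%E = (F 1 - F 0)%:E.
    by rewrite /F !subr0 subrr powR1 powR0 ?gt_eqF// !subrr !subr0.
  apply: (@ge0_integral_derive_oo F) => //.
  - move=> x y; rewrite !in_itv/= => /andP[x0 x1] /andP[y0 y1] xy.
    by rewrite ltrD2l ltrN2; apply: gt0_ltr_powR; rewrite ?nnegrE; lra.
  - by move=> x /yI; exact: dI.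
  - move=> x /yI x0; apply: cvgM; first exact: cvg_cst.
    apply: (@continuous_comp _ _ _ (fun y => 1 - y) (@powR R ^~ (r - 1))).
      by apply: cvgB; [exact: cvg_cst|exact: cvg_id].
    exact: powR_continuous.
  - by move=> x /yI x0; rewrite mulr_ge0 ?powR_ge0 ?ltW.
  - apply: cvg_at_right_filter; apply: differentiable_continuous.
    by apply/derivable1_diffP; have [] := dI 0; rewrite subr0.
  - rewrite /F subrr powR0 ?gt_eqF//; apply: cvgB; first exact: cvg_cst.
    apply/cvgrPdist_lt => e e0; near=> y.
    rewrite sub0r normrN ger0_norm ?powR_ge0//.
    have -> : e = (e `^ r^-1) `^ r by rewrite -powRrM mulVf ?gt_eqF// powRr1// ltW.
    have y1 : y < 1 by near: y; exact: nbhs_left_lt.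
    apply: gt0_ltr_powR; rewrite ?nnegrE ?powR_ge0 ?subr_ge0 ?(ltW y1)//.
    rewrite ltrBlDl -ltrBlDr; near: y; apply: nbhs_left_gt.
    by rewrite gtrBl powR_gt0.
have refl_lty : (\int[leb]_(y in `]0%R, 1%R[) ((1 - y) `^ (r - 1))%:E < +oo)%E.
  under eq_integral => y _ do rewrite -[X in X%:E](mulKf (lt0r_neq0 r0)) EFinM.
  rewrite ge0_integralZl//.
  - by rewrite refl mule1 ltry.
  - by apply/measurable_EFinP; apply: measurable_funM => //; exact: m1y.
  - by move=> y _; rewrite lee_fin mulr_ge0 ?powR_ge0 ?ltW.
  - by rewrite lee_fin invr_ge0 ltW.
have ylty := integral_powR_lty s0 ltr01.
have half c y : c <= 1 -> 0 < y -> 2^-1 <= y -> y `^ (c - 1) <= 2 `^ (1 - c) :> R.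
  move=> c1 y0 y2; rewrite -(opprB 1 c) powRN -powR_inv1 ?powR_ge0//.
  rewrite powRAC powR_inv1 ?(ltW y0)//.
  apply: ge0_ler_powR; rewrite ?subr_ge0 ?nnegrE ?invr_ge0 ?(ltW y0)//.
  by rewrite -[leRHS]invrK lef_pV2 ?posrE ?invr_gt0.
have m1 : measurable_fun (`]0, 1[%classic : set (measurableTypeR R))
    (fun y => (2 `^ (1 - r))%:E * (y `^ (s - 1))%:E)%E.
  by apply: measurable_funeM; apply/measurable_EFinP; exact: measurable_funTS.
have m2 : measurable_fun (`]0, 1[%classic : set (measurableTypeR R))
    (fun y => (2 `^ (1 - s))%:E * ((1 - y) `^ (r - 1))%:E)%E.
  by apply: measurable_funeM; apply/measurable_EFinP; exact: m1y.
have Blty : (\int[leb]_(y in `]0%R, 1%R[) ((1 - y) `^ (r - 1) * y `^ (s - 1))%:E < +oo)%E.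
  apply: (@le_lt_trans _ _ (\int[leb]_(y in `]0%R, 1%R[)
    ((2 `^ (1 - r))%:E * (y `^ (s - 1))%:E + (2 `^ (1 - s))%:E * ((1 - y) `^ (r - 1))%:E))%E).
    apply: ge0_le_integral => //.
    - by move=> y _; rewrite lee_fin mulr_ge0 ?powR_ge0.
    - exact: mf.
    - exact: emeasurable_funD.
    move=> y yI'; have y1 := yI _ yI'; move: yI'; rewrite /= in_itv/= => /andP[y0 _].
    rewrite -!EFinM -EFinD lee_fin; have [y2|y2] := leP y 2^-1.
      rewrite (@le_trans _ _ (2 `^ (1 - r) * y `^ (s - 1)))//.
        by rewrite ler_wpM2r ?powR_ge0// half//; lra.
      by rewrite lerDl mulr_ge0 ?powR_ge0.
    rewrite mulrC (@le_trans _ _ (2 `^ (1 - s) * (1 - y) `^ (r - 1)))//.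
      by rewrite ler_wpM2r ?powR_ge0// half//; lra.
    by rewrite lerDr mulr_ge0 ?powR_ge0.
  rewrite ge0_integralD//; last 2 first.
  - by move=> y _; rewrite -EFinM lee_fin mulr_ge0 ?powR_ge0.
  - by move=> y _; rewrite -EFinM lee_fin mulr_ge0 ?powR_ge0.
  apply: lte_add_pinfty; rewrite ge0_integralZl ?lee_fin ?powR_ge0//.
  - by apply: lte_mul_pinfty => //; rewrite lee_fin powR_ge0.
  - by apply/measurable_EFinP; exact: measurable_funTS.
  - by move=> y _; rewrite lee_fin powR_ge0.
  - by apply: lte_mul_pinfty => //; rewrite lee_fin powR_ge0.
  - by apply/measurable_EFinP; exact: m1y.
  - by move=> y _; rewrite lee_fin powR_ge0.
have B1 : (1 <= \int[leb]_(y in `]0%R, 1%R[) ((1 - y) `^ (r - 1) * y `^ (s - 1))%:E)%E.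
  apply: (@le_trans _ _ (\int[leb]_(y in `]0%R, 1%R[) 1%E)%E).
    by rewrite integral_cst_oo// subr0 mulr1.
  apply: ge0_le_integral => //; first exact: mf.
  move=> y; rewrite /= in_itv/= => /andP[y0 y1].
  rewrite lee_fin -[leLHS]mul1r ler_pM//.
    rewrite -[leLHS](powRr0 (1 - y)); apply: ger_powR; rewrite ?subr_le0//.
    by rewrite subr_gt0 y1 gerBl ltW.
  rewrite -[leLHS](powRr0 y); apply: ger_powR; rewrite ?subr_le0//.
  by rewrite y0 ltW.
exists (fine (\int[leb]_(y in `]0%R, 1%R[) ((1 - y) `^ (r - 1) * y `^ (s - 1))%:E)).
  by apply: fine_gt0; rewrite (lt_le_trans _ B1).
by rewrite fineK// ge0_fin_numE// (le_trans _ B1).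
Unshelve. all: by end_near. Qed.
End power_integrals.

(** * Fractional integral kernels *)

Section EKkernel.
Variables (R : realType) (a b sigma : R).
Hypotheses (a0 : 0 <= a) (ab : a < b) (sigma0 : 0 < sigma).
Implicit Types (s t r x y ga be C M e : R) (z : R * R).
Notation leb := (@lebesgue_measure R).

Definition psid t : R := sigma * t `^ (sigma - 1).

(* Kernel of [C * Gamma ga] times the fractional integral of order [ga] with
   respect to psi(t) = t^sigma, restricted to ]a, b[; [psid] is psi'. *)
Definition EKker ga C z : R :=
  if [&& a < z.2, z.2 < b & z.2 < z.1]
  then C * (z.1 `^ sigma - z.2 `^ sigma) `^ (ga - 1) * psid z.2 else 0.

(* Bielecki weight: the kernel of any positive order acts on the corresponding
   L^1 space with norm tending to 0 as [M] grows, see [EKker_small]. *)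
Definition EKw M t : R :=
  if (a < t) && (t < b) then psid t * expR (- (M * t `^ sigma)) else 0.

Lemma psid_ge0 t : 0 <= psid t.
Proof. by rewrite mulr_ge0 ?powR_ge0// ltW. Qed.

Lemma psid_gt0 t : 0 < t -> 0 < psid t.
Proof. by move=> t0; rewrite mulr_gt0 ?powR_gt0. Qed.

Lemma measurable_psid : measurable_fun setT psid.
Proof. by apply: measurable_funM. Qed.

Lemma measurable_EKker ga C : measurable_fun setT (EKker ga C).
Proof.
have m1 r : measurable_fun setT (fun z => z.1 `^ r : R).
  by apply: (@measurableT_comp _ _ _ _ _ _ (@powR R ^~ r)).
have m2 r : measurable_fun setT (fun z => z.2 `^ r : R).
  by apply: (@measurableT_comp _ _ _ _ _ _ (@powR R ^~ r)).
apply: measurable_fun_if => //.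
- by apply: measurable_and; [|apply: measurable_and]; exact: measurable_fun_ltr.
- apply: measurable_funTS; apply: measurable_funM; last exact: measurable_funM.
  apply: measurable_funM => //.
  apply: (@measurableT_comp _ _ _ _ _ _ (@powR R ^~ (ga - 1))) => //.
  exact: measurable_funB.
Qed.

Lemma EKker_ge0 ga C z : 0 <= C -> 0 <= EKker ga C z.
Proof.
move=> C0; rewrite /EKker; case: ifP => // _.
exact: mulr_ge0 (mulr_ge0 C0 (powR_ge0 _ _)) (psid_ge0 _).
Qed.

Lemma measurable_EKw M : measurable_fun setT (EKw M).
Proof.
apply: measurable_fun_if => //.
- by apply: measurable_and; exact: measurable_fun_ltr.
- apply: measurable_funTS; apply: measurable_funM; first exact: measurable_psid.
  apply: measurableT_comp => //; apply: measurableT_comp => //.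
  exact: measurable_funM.
Qed.

Lemma EKw_ge0 M t : 0 <= EKw M t.
Proof. by rewrite /EKw; case: ifP => // _; rewrite mulr_ge0 ?psid_ge0 ?expR_ge0. Qed.

Lemma EKw_neq0 M t : (EKw M t != 0) = (t \in `]a, b[).
Proof.
rewrite /EKw in_itv/=; case: ifP => [/andP[at_ _]|_]; last by rewrite eqxx.
by rewrite gt_eqF// mulr_gt0 ?expR_gt0// psid_gt0// (le_lt_trans a0).
Qed.

Lemma integral_ifoo s t (h : R -> R) :
  (\int[leb]_x (if (s < x < t) then h x else 0)%:E =
   \int[leb]_(x in `]s, t[) (h x)%:E)%E.
Proof.
rewrite [RHS]integral_mkcond; apply: eq_integral => x _.
rewrite patchE; case: ifPn => xst; first by rewrite mem_set//= in_itv.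
by rewrite memNset//= in_itv/=; exact/negP.
Qed.

Let sub_psi_deriv s x : 0 < x ->
  is_derive x 1 (fun t => t `^ sigma - s `^ sigma) (psid x).
Proof.
move=> x0; have := is_deriveB (is_derive1_powR sigma x0) (is_derive_cst (s `^ sigma) x 1).
by rewrite subr0.
Qed.

Let psid_continuous x : 0 < x -> {for x, continuous psid}.
Proof. by move=> x0; apply: cvgM; [exact: cvg_cst|exact: powR_continuous]. Qed.

(** Substitute y = psi(t) - psi(s). The exponential splits into exp(- M psi(s)) exp(- M y), and the
    factor psi'(s) of the kernel completes the first part to the weight at [s]; what remains is [C]
    times a truncated Laplace transform of y^(ga - 1). *)
Lemma EKker_small ga C e : 0 < ga -> 0 <= C -> 0 < e ->
  exists2 M0 : R, 0 < M0 & forall M, M0 <= M -> forall s,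
  (\int[leb]_t (EKw M t * EKker ga C (t, s))%:E <= (e * EKw M s)%:E)%E.
Proof.
move=> ga0 C0 e0; have b0 : 0 < b := le_lt_trans a0 ab.
(* [C] may be 0, so the Laplace bound is taken at [e / (C + 1)]. *)
have C1 : 0 < C + 1 by rewrite ltr_wpDl.
have [M0 M00 HM] := Laplace_powR_small ga0 (powR_gt0 sigma b0) (divr_gt0 e0 C1).
exists M0 => // M M0M s.
have [sI|sI] := boolP (s \in `]a, b[); last first.
  rewrite integral0_eq ?lee_fin ?mulr_ge0 ?EKw_ge0 ?(ltW e0)// => t _.
  rewrite /EKker/=; case: ifP => [/and3P[h1 h2 _]|_]; last by rewrite mulr0.
  by move: sI; rewrite in_itv/= h1 h2.
have /andP[as_ sb] : a < s < b by rewrite in_itv in sI.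
have s0 : 0 < s := le_lt_trans a0 as_.
pose F t := t `^ sigma - s `^ sigma.
pose f y := y `^ (ga - 1) * expR (- (M * y)).
have Fs : F s = 0 by rewrite /F subrr.
have Fb : 0 < F b by rewrite subr_gt0; apply: gt0_ltr_powR; rewrite ?nnegrE ?ltW.
have Ib : (\int[leb]_(y in `]0%R, F b[) (f y)%:E =
    \int[leb]_(t in `]s, b[) (f (F t) * psid t)%:E)%E.
  rewrite -Fs; apply: ge0_integration_by_substitution_oo => //.
  - move=> x y xI yI xy; rewrite ltrD2r.
    exact: (powR_increasing sigma0 (ltW s0) xI yI).
  - move=> x; rewrite in_itv/= => /andP[sx _]; apply: sub_psi_deriv.
    exact: lt_trans sx.
  - move=> x; rewrite in_itv/= => /andP[sx _]; apply: psid_continuous.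
    exact: lt_trans sx.
  - by move=> x _; exact: psid_ge0.
  - by apply: cvgB; [apply: powR_cvg_at_right => //; exact: ltW|exact: cvg_cst].
  - by apply: cvgB; [exact: powR_cvg_at_left|exact: cvg_cst].
  - move=> y; rewrite Fs in_itv/= => /andP[y0 _].
    apply: cvgM; first exact: powR_continuous.
    apply: continuous_comp; last exact: continuous_expR.
    by apply: cvgN; apply: cvgM; [exact: cvg_cst|exact: cvg_id].
  - by move=> y _; rewrite mulr_ge0 ?powR_ge0 ?expR_ge0.
have mf : measurable_fun setT (fun y => (f y)%:E).
  apply/measurable_EFinP; apply: measurable_funM => //.
  by apply: measurableT_comp => //; apply: measurableT_comp => //; exact: measurable_funM.
have f0 y : (0 <= (f y)%:E)%E by rewrite lee_fin mulr_ge0 ?powR_ge0 ?expR_ge0.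
(* Enlarging the range of integration to ]0, b^sigma[ makes the bound uniform in [s]. *)
have Ile : (\int[leb]_(t in `]s, b[) (f (F t) * psid t)%:E <= (e / (C + 1))%:E)%E.
  rewrite -Ib; apply: (le_trans _ (HM M M0M)).
  apply: ge0_subset_integral => //.
  - exact: measurable_funTS.
  - by apply: subset_itvl; rewrite bnd_simp /F gerBl powR_ge0.
pose K := C * EKw M s.
have K0 : 0 <= K by rewrite mulr_ge0 ?EKw_ge0.
have step : (\int[leb]_t (EKw M t * EKker ga C (t, s))%:E =
    K%:E * \int[leb]_(t in `]s, b[) (f (F t) * psid t)%:E)%E.
  rewrite -ge0_integralZl//; last 2 first.
  - apply/measurable_EFinP; apply: measurable_funTS.
    apply: measurable_funM; last exact: measurable_psid.
    apply: (@measurableT_comp _ _ _ _ _ _ f) => //; first exact/measurable_EFinP.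
    exact: measurable_funB.
  - by move=> t _; rewrite lee_fin mulr_ge0 ?psid_ge0// -lee_fin.
  under [RHS]eq_integral do rewrite -EFinM.
  rewrite -integral_ifoo; apply: eq_integral => t _; congr EFin.
  rewrite {1}/EKw /EKker/= as_ sb/=.
  have [st|ts] := ltP s t; last by rewrite mulr0.
  have [tb|] := ltP t b; last by rewrite andbF mul0r.
  rewrite (lt_trans as_ st)/= /K /f /EKw as_ sb/= /F.
  rewrite (_ : expR (- (M * t `^ sigma)) =
    expR (- (M * s `^ sigma)) * expR (- (M * (t `^ sigma - s `^ sigma)))).
    by ring.
  by rewrite -expRD; congr expR; ring.
rewrite step; apply: (le_trans (lee_wpmul2l _ Ile)); first by rewrite lee_fin.
rewrite -EFinM lee_fin /K mulrAC ler_wpM2r ?EKw_ge0// mulrA ler_pdivrMr//.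
by rewrite mulrC ler_wpM2l ?(ltW e0)// lerDl.
Qed.

(** Under y = (psi(r) - psi(s)) / D with D = psi(t) - psi(s), the powers of D have total exponent ga
    + be - 1 = 0, so the Beta constant depends on neither [s] nor [t]. *)
Lemma psi_beta ga be : 0 < ga -> 0 < be -> ga + be = 1 ->
  exists2 B : R, 0 < B & forall s t, 0 <= s -> s < t ->
  (\int[leb]_(r in `]s, t[) ((t `^ sigma - r `^ sigma) `^ (ga - 1) *
    (r `^ sigma - s `^ sigma) `^ (be - 1) * psid r)%:E = B%:E)%E.
Proof.
move=> ga0 be0 gb1.
have [B B0 BE] : exists2 B : R, 0 < B &
  (\int[leb]_(y in `]0%R, 1%R[) ((1 - y) `^ (ga - 1) * y `^ (be - 1))%:E = B%:E)%E.
  by apply: Beta_fin; rewrite ?ga0 ?be0/=; lra.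
exists B => // s t s0 st.
have t0 : 0 < t := le_lt_trans s0 st.
pose D := t `^ sigma - s `^ sigma.
have D0 : 0 < D by rewrite subr_gt0; apply: gt0_ltr_powR; rewrite ?nnegrE ?(ltW t0).
pose F r := (r `^ sigma - s `^ sigma) / D.
pose f y := (1 - y) `^ (ga - 1) * y `^ (be - 1).
have Fs : F s = 0 by rewrite /F subrr mul0r.
have Ft : F t = 1 by rewrite /F divff// gt_eqF.
have Ib : (\int[leb]_(y in `]0%R, 1%R[) (f y)%:E =
    \int[leb]_(r in `]s, t[) (f (F r) * (psid r / D))%:E)%E.
  rewrite -Fs -Ft; apply: ge0_integration_by_substitution_oo => //.
  - move=> x y xI yI xy; rewrite ltr_pM2r ?invr_gt0// ltrD2r.
    exact: (powR_increasing sigma0 s0 xI yI).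
  - move=> x; rewrite in_itv/= => /andP[sx _].
    have := is_deriveZ D^-1 (sub_psi_deriv s (le_lt_trans s0 sx)).
    rewrite (_ : D^-1 *: psid x = psid x / D); last exact: mulrC.
    by congr (is_derive _ _ _ _); apply/funext => y; exact: mulrC.
  - move=> x; rewrite in_itv/= => /andP[sx _]; apply: cvgMl.
    by apply: psid_continuous; exact: le_lt_trans sx.
  - by move=> x _; rewrite mulr_ge0 ?psid_ge0 ?invr_ge0 ?ltW.
  - apply: cvgMl; apply: cvgB; last exact: cvg_cst.
    exact: powR_cvg_at_right.
  - by apply: cvgMl; apply: cvgB; [exact: powR_cvg_at_left|exact: cvg_cst].
  - move=> y; rewrite Fs Ft in_itv/= => /andP[y0 y1].
    apply: cvgM; last exact: powR_continuous.
    apply: (@continuous_comp _ _ _ (fun y => 1 - y) (@powR R ^~ (ga - 1))).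
      by apply: cvgB; [exact: cvg_cst|exact: cvg_id].
    by apply: powR_continuous; rewrite subr_gt0.
  - by move=> y _; rewrite mulr_ge0 ?powR_ge0.
rewrite -BE Ib; apply: eq_integral => r; rewrite inE/= in_itv/= => /andP[sr rt].
congr EFin; rewrite /f /F.
have r0 : 0 < r := le_lt_trans s0 sr.
have Drt : 0 < t `^ sigma - r `^ sigma.
  by rewrite subr_gt0; apply: gt0_ltr_powR; rewrite ?nnegrE ?ltW.
have Drs : 0 < r `^ sigma - s `^ sigma.
  by rewrite subr_gt0; apply: gt0_ltr_powR; rewrite ?nnegrE ?(ltW r0).
have -> : 1 - (r `^ sigma - s `^ sigma) / D = (t `^ sigma - r `^ sigma) / D.
  by rewrite -[X in X - _](divff (lt0r_neq0 D0)) -mulrBl; congr (_ / _); rewrite /D; ring.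
rewrite !powRM ?invr_ge0 ?(ltW D0) ?(ltW Drt) ?(ltW Drs)//.
have DD : D^-1 `^ (ga - 1) * D^-1 `^ (be - 1) * D^-1 = 1.
  rewrite -[X in _ * X]powRr1 ?invr_ge0 ?(ltW D0)//.
  have Di : D^-1 != 0 by rewrite invr_eq0 gt_eqF.
  rewrite -powRD ?Di ?implybT// -powRD ?Di ?implybT//.
  by rewrite (_ : _ + _ = 0) ?powRr0//; lra.
have alg (pr u v i j k : R) : i * j * k = 1 ->
    u * v * pr = u * i * (v * j) * (pr * k).
  by move=> h; transitivity (u * v * pr * (i * j * k)); [rewrite h mulr1|ring].
exact: alg.
Qed.

(** The factor psi'(r) of the left kernel is the Jacobian in [psi_beta]; the factor psi'(s) of the
    right one survives and is the kernel of order 1. *)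
Lemma EKker_comp ga be : 0 < ga -> 0 < be -> ga + be = 1 ->
  exists2 B : R, 0 < B & forall C1 C2, 0 <= C1 -> 0 <= C2 ->
  forall s t, t \in `]a, b[ ->
  (\int[leb]_r (EKker ga C1 (t, r) * EKker be C2 (r, s))%:E)%E =
  (EKker 1 (C1 * C2 * B) (t, s))%:E.
Proof.
move=> ga0 be0 gb1; have [B B0 BE] := psi_beta ga0 be0 gb1.
exists B => // C1 C2 C10 C20 s t; rewrite in_itv/= => /andP[at_ tb].
have [/andP[as_ st]|sI] := boolP ((a < s) && (s < t)); last first.
  rewrite /EKker/= [in RHS]ifF; last first.
    by apply/negP => /and3P[h1 _ h2]; move: sI; rewrite h1 h2.
  apply: integral0_eq => r _.
  case: ifP => [/and3P[_ _ rt]|_]; last by rewrite mul0r.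
  case: ifP => [/and3P[as_ _ sr]|_]; last by rewrite mulr0.
  by move: sI; rewrite as_ (lt_trans sr rt).
have sb : s < b := lt_trans st tb.
have s0 : 0 < s := le_lt_trans a0 as_.
rewrite (_ : (EKker 1 (C1 * C2 * B) (t, s))%:E = ((C1 * C2 * psid s)%:E * B%:E)%E); last first.
  by rewrite -EFinM /EKker/= as_ sb st/= subrr powRr0; congr EFin; ring.
rewrite -(BE s t (ltW s0) st) -ge0_integralZl//; last 3 first.
- apply/measurable_EFinP; apply: measurable_funTS.
  apply: measurable_funM; last exact: measurable_psid.
  apply: measurable_funM.
    apply: (@measurableT_comp _ _ _ _ _ _ (@powR R ^~ (ga - 1))) => //.
    exact: measurable_funB.
  apply: (@measurableT_comp _ _ _ _ _ _ (@powR R ^~ (be - 1))) => //.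
  exact: measurable_funB.
- move=> r _; rewrite lee_fin; apply: mulr_ge0; first by rewrite mulr_ge0 ?powR_ge0.
  exact: psid_ge0.
- by rewrite lee_fin; apply: mulr_ge0; [exact: mulr_ge0|exact: psid_ge0].
under [RHS]eq_integral do rewrite -EFinM.
rewrite -integral_ifoo; apply: eq_integral => r _; congr EFin.
rewrite /EKker/= as_ sb/=.
have [sr|rs] := ltP s r; last by rewrite mulr0.
have [rt|tr] := ltP r t; last by rewrite !andbF mul0r.
rewrite (lt_trans as_ sr) (lt_trans rt tb)/=.
have alg (c1 c2 u v p1 p2 : R) :
  c1 * u * p1 * (c2 * v * p2) = c1 * c2 * p2 * (u * v * p1) by ring.
exact: alg.
Qed.

End EKkernel.

Lemma near_eq_continuous (R : realType) (F G : R -> R) t : {near t, F =1 G} ->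
  {for t, continuous G} -> {for t, continuous F}.
Proof.
move=> FG cG; rewrite /prop_for /continuous_at (nbhs_singleton FG).
apply: cvg_trans cG; apply: near_eq_cvg.
by apply: filterS FG => x ->.
Qed.

(** * Absolute continuity of indefinite integrals *)

Section abs_cont_integral.
Variable R : realType.
Implicit Types (a b e x y t : R) (F G g : R -> R).
Notation leb := (@lebesgue_measure R).

Lemma abs_cont_integral a b g : leb.-integrable setT (EFin \o g) ->
  abs_cont a b (fun t => \int[leb]_(s in `]a, t]) g s).
Proof.
move=> gi e e0; have [d [d0 dg]] := integral_normr_continuous gi e0.
have gS A : measurable A -> leb.-integrable A (EFin \o g).
  by move=> mA; exact: integrableS gi.
exists d => // N x y xy tI sd.
pose U : set R := \big[setU/set0]_(i < N) `]x i, y i[%classic.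
have mU : measurable (U : set (measurableTypeR R)) by apply: bigsetU_measurable.
have mug A : measurable_fun A (fun s : measurableTypeR R => `|(g s)%:E|)%E.
  apply: measurableT_comp => //; apply: measurable_funTS.
  exact: (measurable_int leb gi).
have fing A : measurable (A : set (measurableTypeR R)) ->
    (\int[leb]_(s in A) (`|g s|)%:E)%E \is a fin_num.
  move=> mA; apply: (@integrable_fin_num _ _ _ leb A mA (fun s => `|(g s)%:E|)%E).
  by apply: integrable_abse; exact: gS.
have le1 : \sum_(i < N) `|\int[leb]_(s in `]a, y i]) g s - \int[leb]_(s in `]a, x i]) g s|
    <= \int[leb]_(s in U) `|g s|.
  rewrite -lee_fin /Rintegral fineK ?fing// ge0_integral_bigsetU//; last 2 first.
  - exact: index_enum_uniq.
  - exact: sub_trivIset tI.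
  rewrite -sumEFin; apply: lee_sum => i _.
  have [/andP[axi xyi] yb] := xy i.
  rewrite Rintegral_itvB//; last exact: gS.
  apply: (@le_trans _ _ (\int[leb]_(s in `]x i, y i]) `|g s|)%:E).
    by rewrite lee_fin le_normr_Rintegral//; exact: gS.
  rewrite /Rintegral fineK; last exact: fing.
  rewrite le_eqVlt; apply/orP; left; apply/eqP; symmetry.
  apply: integral_itv_bndo_bndc; exact: mug.
apply: (le_lt_trans le1); apply: dg => //.
have mUE : leb U = (\sum_(i < N) leb `]x i, y i[)%E by rewrite measure_bigsetU_ord.
apply: (@le_lt_trans _ _ (\sum_(i < N) (y i - x i)%:E)%E); last by rewrite sumEFin lte_fin.
apply: (@le_trans _ _ (leb U)) => //; rewrite mUE; apply: lee_sum => i _.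
rewrite lebesgue_measure_itv/= lte_fin.
have [/andP[_ xyi] _] := xy i; case: ltP => // yx.
by rewrite lee_fin subr_ge0.
Qed.

Lemma abs_cont_small a b F e : abs_cont a b F -> 0 < e ->
  exists2 d : R, 0 < d & forall x y, a <= x <= y -> y <= b -> y - x < d ->
    `|F y - F x| < e.
Proof.
move=> acF e0; have [d d0 dF] := acF e e0; exists d => // x y axy yb yxd.
have := dF 1%N (fun=> x) (fun=> y); rewrite !big_ord1; apply => //.
by apply/trivIsetP => i j _ _; rewrite !ord1 eqxx.
Qed.

Lemma abs_cont_continuous a b F x : abs_cont a b F -> x \in `]a, b[ ->
  {for x, continuous F}.
Proof.
move=> acF xab; apply/cvgrPdist_lt => e e0.
have [d d0 dF] := abs_cont_small acF e0.
have nbd : \forall y \near nbhs x, `|x - y| < d.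
  by apply/nbhs_ballP; exists d.
near=> y; have [yx|xy] := leP y x.
  apply: dF.
  - have: y \in `]a, b[ by near: y; apply: near_in_itvoo.
    by rewrite in_itv/= yx andbT => /andP[/ltW].
  - by have := xab; rewrite in_itv/= => /andP[_ /ltW].
  - apply: (le_lt_trans (ler_norm _)).
    by near: y; exact: nbd.
rewrite distrC; apply: dF.
- by rewrite (ltW xy) andbT; have := xab; rewrite in_itv/= => /andP[/ltW].
- have: y \in `]a, b[ by near: y; apply: near_in_itvoo.
  by rewrite in_itv/= => /andP[_ /ltW].
- apply: (le_lt_trans (ler_norm _)); rewrite distrC.
  by near: y; exact: nbd.
Unshelve. all: by end_near. Qed.

Lemma abs_cont_cvg_at_right a b F : a < b -> abs_cont a b F ->
  F x @[x --> a^'+] --> F a.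
Proof.
move=> ab acF; apply/cvgrPdist_lt => e e0.
have [d d0 dF] := abs_cont_small acF e0.
near=> y; rewrite distrC; apply: dF.
- by rewrite lexx/=; apply: ltW.
- by near: y; exact: nbhs_right_le.
- by rewrite ltrBlDl; near: y; apply: nbhs_right_lt; rewrite ltrDl.
Unshelve. all: by end_near. Qed.

End abs_cont_integral.

(** * Primitives with respect to psi *)

Section psi_primitive.
Variables (R : realType) (a b sigma : R).
Hypotheses (a0 : 0 <= a) (ab : a < b) (sigma0 : 0 < sigma).
Implicit Types (s t x y ga be C M e c : R) (f g : R -> R).
Notation leb := (@lebesgue_measure R).
Notation w0 := (EKw a b sigma 0).
Notation L1D := (wL1 leb w0).
Notation I1 := (kop leb (EKker a b sigma 1 1)).

Lemma EKw0E t : w0 t = if (a < t) && (t < b) then psid sigma t else 0.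
Proof. by rewrite /EKw mul0r oppr0 expR0 mulr1. Qed.

Lemma EKker1E C t s : EKker a b sigma 1 C (t, s) = if s < t then C * w0 s else 0.
Proof.
rewrite /EKker EKw0E/= subrr powRr0 mulr1.
by case: (a < s); case: (s < b); case: (s < t); rewrite //= ?mulr0.
Qed.

(** On ]a, b[ the exponential factor lies between exp(- M b^sigma) and 1. Hence [M] can be tuned for
    norm estimates without changing the space. *)
Lemma wL1_EKw M f : 0 <= M -> wL1 leb (EKw a b sigma M) f <-> L1D f.
Proof.
move=> M0; split.
  apply: (@wL1_weight_le _ _ _ _ _ _ (expR (M * b `^ sigma)));
    rewrite ?expR_ge0//; try exact: measurable_EKw; try exact: EKw_ge0.
  move=> t.
  rewrite EKw0E /EKw; case: ifP => [/andP[at_ tb]|_]; last by rewrite mulr0.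
  rewrite mulrCA -expRD ler_peMr ?psid_ge0//.
  rewrite -expR0 ler_expR subr_ge0 ler_wpM2l// ltW// gt0_ltr_powR//.
    by rewrite nnegrE ltW// (le_lt_trans a0).
  by rewrite nnegrE ltW// (le_lt_trans a0).
apply: (@wL1_weight_le _ _ _ _ _ _ 1);
  rewrite ?ler01//; try exact: measurable_EKw; try exact: EKw_ge0.
move=> t; rewrite EKw0E mul1r /EKw; case: ifP => // _.
  rewrite ler_piMr ?psid_ge0// -expR0 ler_expR oppr_le0 mulr_ge0//.
  exact: powR_ge0.
Qed.

Lemma L1D_cst c : L1D (fun=> c).
Proof.
split; first exact: measurable_cst.
rewrite /wnorm; under eq_integral do rewrite EKw0E mulrC EFinM.
rewrite ge0_integralZl//; last 2 first.
- apply/measurable_EFinP; apply: measurable_fun_if => //.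
    by apply: measurable_and; exact: measurable_fun_ltr.
  by apply: measurable_funTS; exact: measurable_psid.
- by move=> t _; rewrite lee_fin; case: ifP => // _; exact: psid_ge0.
by rewrite integral_ifoo integral_powR_oo// -EFinM ltry.
Qed.

Lemma L1D_integrable f : L1D f -> leb.-integrable setT (EFin \o (fun s => w0 s * f s)).
Proof.
move=> [mf fy]; apply/integrableP; split.
  by apply/measurable_EFinP; apply: measurable_funM => //; exact: measurable_EKw.
apply: le_lt_trans fy; rewrite le_eqVlt; apply/orP; left; apply/eqP.
by apply: eq_integral => s _; rewrite /= normrM (ger0_norm (EKw_ge0 _ _ _ _ _)).
Qed.

Lemma I1E f t : I1 f t = \int[leb]_(s in `]a, t]) (w0 s * f s).
Proof.
rewrite Rintegral_mkcond; congr fine; apply: ae_eq_integral_nonmeas.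
exists [set t]; split => //; first exact: lebesgue_measure_set1.
move=> s /=; apply: contra_notP => /eqP st _.
rewrite EKker1E patchE mem_setE in_itv/= le_eqVlt (negbTE st)/= mul1r EKw0E.
by case: (a < s); case: (s < t); rewrite /= ?mul0r.
Qed.
End psi_primitive.

Section psi_primitive_calculus.
Variables (R : realType) (a b sigma : R).
Hypotheses (a0 : 0 <= a) (ab : a < b) (sigma0 : 0 < sigma).
Implicit Types (s t x y ga be C M e c : R) (f g : R -> R).
Notation leb := (@lebesgue_measure R).
Notation w0 := (EKw a b sigma 0).
Notation L1D := (wL1 leb w0).
Notation I1 := (kop leb (EKker a b sigma 1 1)).

(** Boundedness is borrowed from a weight whose [M] makes the operator norm at most 1. *)
Lemma L1D_kop ga C f : 0 < ga -> 0 <= C -> L1D f ->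
  L1D (kop leb (EKker a b sigma ga C) f).
Proof.
move=> ga0 C0 f1; have [M M0 HM] := EKker_small a0 ab sigma0 ga0 C0 (@ltr01 R).
have {}f1 := proj2 (wL1_EKw a0 ab sigma0 f (ltW M0)) f1.
apply: (proj1 (wL1_EKw a0 ab sigma0 _ (ltW M0))).
apply: (@wL1_kop _ (measurableTypeR R) R leb (EKw a b sigma M) (measurable_EKw a b sigma M) (EKw_ge0 a b sigma0 M) _ 1).
- exact: measurable_EKker.
- by move=> z; exact: EKker_ge0.
- exact: ler01.
- exact: HM.
- exact: f1.
Qed.

Lemma I1_abs_cont f : L1D f -> abs_cont a b (I1 f).
Proof.
move=> f1; rewrite (_ : I1 f = fun t => \int[leb]_(s in `]a, t]) (w0 s * f s)).
  exact: abs_cont_integral (L1D_integrable sigma0 f1).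
by apply/funext => t; exact: I1E.
Qed.

Lemma I1_cvg0 f : L1D f -> I1 f t @[t --> a^'+] --> (0 : R).
Proof.
move=> /I1_abs_cont /(abs_cont_cvg_at_right ab).
by rewrite [X in _ --> X -> _]I1E set_itv_ge ?Rintegral_set0// bnd_simp ltxx.
Qed.

Let I1_fun f : I1 f = fun t => \int[leb]_(s in [set` Interval (BRight a) (BRight t)]) (w0 s * f s).
Proof. by apply/funext => t; exact: I1E. Qed.

Lemma I1_derive_ae f : L1D f -> {ae leb, forall t, t \in `]a, b[ ->
  derivable (I1 f) t 1 /\ derive1 (I1 f) t = psid sigma t * f t}.
Proof.
move=> f1; have fi := L1D_integrable sigma0 f1.
have gy y : leb.-integrable [set` Interval (BRight a) (BRight y)]
    (EFin \o (fun s => w0 s * f s)) by exact: integrableS fi.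
have gloc : locally_integrable [set: R] (fun s => w0 s * f s).
  by apply: open_integrable_locally => //; exact: openT.
move: (FTC1 gy gloc); apply: filterS; first exact: (ae_filter_ringOfSetsType leb).
move=> t H tab; have [|dI dE] := H; first by move: tab; rewrite in_itv/= => /andP[].
rewrite I1_fun; split => //; rewrite dE EKw0E.
by move: tab; rewrite in_itv/= => ->.
Qed.

Lemma I1_derive f t : L1D f -> t \in `]a, b[ -> {for t, continuous f} ->
  derivable (I1 f) t 1 /\ derive1 (I1 f) t = psid sigma t * f t.
Proof.
move=> f1 tab ft; have fi := L1D_integrable sigma0 f1.
have gy : leb.-integrable [set` Interval (BRight a) (BRight b)]
    (EFin \o (fun s => w0 s * f s)) by exact: integrableS fi.
have /andP[at_ tb] : a < t < b by move: tab; rewrite in_itv.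
have wE : {near t, w0 =1 psid sigma}.
  near=> x; rewrite EKw0E ifT//.
  by have : x \in `]a, b[ by [near: x; exact: near_in_itvoo]; rewrite in_itv.
have pt : {for t, continuous (psid sigma)}.
  apply: cvgM; first exact: cvg_cst.
  exact: powR_continuous (le_lt_trans a0 at_).
have wt : {for t, continuous w0}.
  exact: near_eq_continuous wE pt.
have [] := continuous_FTC1 tb gy at_ (cvgM wt ft).
rewrite I1_fun => ? ->; split=> //.
by rewrite EKw0E at_ tb.
Unshelve. all: by end_near. Qed.

Lemma I1_inj f : L1D f -> (forall t, t \in `]a, b[ -> I1 f t = 0) ->
  {ae leb, forall t, t \in `]a, b[ -> f t = 0}.
Proof.
move=> f1 f0; move: (I1_derive_ae f1).
apply: filterS; first exact: (ae_filter_ringOfSetsType leb).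
move=> t H tab; have [_ dE] := H tab.
have : {near t, I1 f =1 cst 0}.
  by near=> x; apply: f0; near: x; exact: near_in_itvoo.
move=> /derive1_near/(_ (derivable_cst _ _ _))[_]; rewrite dE.
rewrite derive1_cst => /eqP; rewrite mulf_eq0 => /orP[|/eqP//].
by rewrite gt_eqF// psid_gt0//; move: tab; rewrite in_itv/= => /andP[/(le_lt_trans a0)].
Unshelve. all: by end_near. Qed.

End psi_primitive_calculus.

(** * Iterated primitives *)

Section rho_primitives.
Variables (R : realType) (a b sigma : R).
Hypotheses (a0 : 0 <= a) (ab : a < b) (sigma0 : 0 < sigma).
Implicit Types (s t x y M : R) (f g F G psi : R -> R) (c : nat -> R) (i j m : nat).
Notation leb := (@lebesgue_measure R).
Notation w0 := (EKw a b sigma 0).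
Notation L1D := (wL1 leb w0).
Notation I1 := (kop leb (EKker a b sigma 1 1)).

Lemma eq_on_itvoo_near F G t : {in `]a, b[, F =1 G} -> t \in `]a, b[ ->
  {near t, F =1 G}.
Proof.
move=> FG tab; near=> x; apply: FG; near: x; exact: near_in_itvoo.
Unshelve. all: by end_near. Qed.

Lemma rho_near F G t : {near t, F =1 G} -> derivable G t 1 ->
  derivable F t 1 /\ rho sigma F t = rho sigma G t.
Proof.
by move=> FG dG; have [dF E] := derive1_near FG dG; rewrite /rho E.
Qed.

Lemma rho_eq_in F G : {in `]a, b[, F =1 G} ->
  {in `]a, b[, rho sigma F =1 rho sigma G}.
Proof.
move=> FG t tab; rewrite /rho; congr (_ * _); rewrite !derive1E.
by apply: near_eq_derive; exact: eq_on_itvoo_near FG tab.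
Qed.

Lemma iter_rho_eq_in F G j : {in `]a, b[, F =1 G} ->
  {in `]a, b[, iter j (rho sigma) F =1 iter j (rho sigma) G}.
Proof. by move=> FG; elim: j => // j; exact: rho_eq_in. Qed.

Fixpoint Jit c psi i : R -> R :=
  if i is i'.+1 then fun t => c i + I1 (Jit c psi i') t else psi.

Lemma L1D_Jit c psi i : L1D psi -> L1D (Jit c psi i).
Proof.
move=> psi1; elim: i => //= i ih; apply: wL1D; first exact: measurable_EKw.
- exact: EKw_ge0.
- exact: L1D_cst.
- by apply: L1D_kop.
Qed.

Lemma abs_cont_Jit c psi i : L1D psi -> abs_cont a b (Jit c psi i.+1).
Proof.
move=> psi1 e e0; have [d d0 dF] := I1_abs_cont sigma0 (L1D_Jit c i psi1) e0.
exists d => // N x y xy tI sd; apply: le_lt_trans (dF N x y xy tI sd).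
by apply: ler_sum => k _; rewrite /= opprD addrACA subrr add0r.
Qed.

Lemma Jit_continuous c psi i t : L1D psi -> t \in `]a, b[ ->
  {for t, continuous (Jit c psi i.+1)}.
Proof. by move=> psi1; apply: abs_cont_continuous; exact: abs_cont_Jit. Qed.

Lemma Jit_cvg c psi i : L1D psi ->
  Jit c psi i.+1 t @[t --> a^'+] --> c i.+1.
Proof.
move=> psi1; rewrite -[X in _ --> X]addr0; apply: cvgD; first exact: cvg_cst.
exact: I1_cvg0 (L1D_Jit c i psi1).
Qed.

Let psid_neq0 t : t \in `]a, b[ -> psid sigma t != 0.
Proof.
rewrite in_itv/= => /andP[at_ _].
by rewrite gt_eqF// psid_gt0// (le_lt_trans a0).
Qed.

Let rho_shift c psi i f t : t \in `]a, b[ ->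
  derivable (I1 (Jit c psi i)) t 1 /\ derive1 (I1 (Jit c psi i)) t = psid sigma t * f t ->
  derivable (Jit c psi i.+1) t 1 /\ rho sigma (Jit c psi i.+1) t = f t.
Proof.
move=> tab [dI dE].
have [dJ JE] := derive1_cstD (c i.+1) dI; split; first exact: dJ.
by rewrite /rho [derive1 _ _]JE dE mulKf//; exact: psid_neq0.
Qed.

(** From the second primitive on, the integrand is continuous, so the derivative exists at every
    interior point; for the first primitive it is known only almost everywhere. *)
Lemma rho_Jit c psi i t : L1D psi -> t \in `]a, b[ ->
  derivable (Jit c psi i.+2) t 1 /\ rho sigma (Jit c psi i.+2) t = Jit c psi i.+1 t.
Proof.
move=> psi1 tab; apply: rho_shift => //; apply: I1_derive => //.
- exact: L1D_Jit.
- exact: Jit_continuous.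
Qed.

Lemma rho_Jit_ae c psi : L1D psi -> {ae leb, forall t, t \in `]a, b[ ->
  rho sigma (Jit c psi 1) t = psi t}.
Proof.
move=> psi1; move: (I1_derive_ae sigma0 psi1).
apply: filterS; first exact: (ae_filter_ringOfSetsType leb).
by move=> t H tab; exact: (@rho_shift c psi 0%N psi t tab (H tab)).2.
Qed.

Lemma iter_rho_Jit c psi j i : L1D psi ->
  {in `]a, b[, iter j (rho sigma) (Jit c psi (j + i.+1)) =1 Jit c psi i.+1}.
Proof.
move=> psi1; elim: j i => // j ih i t tab; rewrite iterS addSnnS.
by rewrite (rho_eq_in (ih i.+1) tab) (rho_Jit _ _ psi1 tab).2.
Qed.

Lemma iter_rho_Jit_ae c psi i : (0 < i)%N -> L1D psi ->
  {ae leb, forall t, t \in `]a, b[ -> iter i (rho sigma) (Jit c psi i) t = psi t}.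
Proof.
case: i => // i _ psi1; move: (rho_Jit_ae c psi1).
apply: filterS; first exact: (ae_filter_ringOfSetsType leb).
move=> t H tab; rewrite iterS -(H tab).
by apply: rho_eq_in tab => s sab; rewrite -addn1 iter_rho_Jit.
Qed.

(** The case [m < i] serves the initial conditions: there the same function represents derivatives
    of lower order. *)
Lemma ACpsi_Jit c psi m i : (0 < m <= i)%N -> L1D psi ->
  ACpsi a b sigma m (Jit c psi i).
Proof.
case: m => // m /andP[_ mi] psi1.
have eqJ j : (j <= m)%N -> {in `]a, b[, iter j (rho sigma) (Jit c psi i) =1
    Jit c psi (i - j).-1.+1}.
  move=> jm t tab; rewrite -[in LHS](subnKC (leq_trans jm (ltnW mi))).
  rewrite -[X in (j + X)%N]prednK ?iter_rho_Jit//.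
  by rewrite subn_gt0 (leq_ltn_trans jm).
split.
- move=> j; rewrite ltnS => jm t tab.
  have ij : (i - j).-1.+1 = (i - j).-2.+2.
    have : (1 < i - j)%N by rewrite ltn_subRL addn1 (leq_ltn_trans jm mi).
    by case: (i - j)%N => [|[]].
  have [] := @rho_near _ _ t (eq_on_itvoo_near (eqJ j (ltnW jm)) tab) => //.
  by rewrite ij; exact: (rho_Jit _ _ psi1 tab).1.
- exists (Jit c psi (i - m).-1.+1); first exact: abs_cont_Jit.
  by move=> t tab; rewrite eqJ.
Qed.

End rho_primitives.

(** * Abel's equation and the fixed point *)

Section abel_equation.
Variables (R : realType) (a b sigma : R).
Hypotheses (a0 : 0 <= a) (ab : a < b) (sigma0 : 0 < sigma).
Implicit Types (s t x y M c C ga be : R) (f g psi phi kappa : R -> R).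
Notation leb := (@lebesgue_measure R).
Notation w0 := (EKw a b sigma 0).
Notation L1D := (wL1 leb w0).
Notation EKop ga C := (kop leb (EKker a b sigma ga C)).
Notation I1 := (EKop 1 1).

Lemma EKker_neq0 ga C t s : EKker a b sigma ga C (t, s) != 0 -> s \in `]a, b[.
Proof.
by rewrite /EKker in_itv/=; case: ifP => [/and3P[-> ->]//|_]; rewrite eqxx.
Qed.

Lemma EKop_ext ga C f g t : {ae leb, forall s, s \in `]a, b[ -> f s = g s} ->
  EKop ga C f t = EKop ga C g t.
Proof.
move=> fg; apply: kop_ext; move: fg.
apply: filterS; first exact: (ae_filter_ringOfSetsType leb).
by move=> s fg /EKker_neq0; exact: fg.
Qed.

Lemma EKop_integrable_ae ga C f : 0 < ga -> 0 <= C -> L1D f ->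
  {ae leb, forall t, t \in `]a, b[ ->
    leb.-integrable setT (fun s => (EKker a b sigma ga C (t, s) * f s)%:E)}.
Proof.
move=> ga0 C0 f1; have [M M0 HM] := EKker_small a0 ab sigma0 ga0 C0 (@ltr01 R).
have {}f1 := proj2 (wL1_EKw a0 ab sigma0 f (ltW M0)) f1.
have := @kop_integrable_ae _ (measurableTypeR R) R leb (EKw a b sigma M)
  (measurable_EKw a b sigma M) (EKw_ge0 a b sigma0 M) _ 1
  (measurable_EKker a b sigma ga C) (fun z => EKker_ge0 a b sigma0 ga z C0)
  ler01 (HM M (lexx M)) f f1.
by apply: filterS => t H tab; apply: H; rewrite EKw_neq0.
Qed.

(** The composed kernel has order 1, hence is bounded by a multiple of the weight. Fubini therefore
    applies at every [t] of ]a, b[, not merely at almost every one. *)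
Lemma EKop_comp ga be : 0 < ga -> 0 < be -> ga + be = 1 ->
  exists2 B : R, 0 < B & forall C1 C2 f t, 0 <= C1 -> 0 <= C2 -> L1D f ->
  t \in `]a, b[ -> EKop ga C1 (EKop be C2 f) t = C1 * C2 * B * I1 f t.
Proof.
move=> ga0 be0 gb; have [B B0 HB] := EKker_comp b a0 sigma0 ga0 be0 gb.
exists B => // C1 C2 f t C10 C20 f1 tab.
have ki : leb.-integrable setT (fun s => (EKker a b sigma 1 1 (t, s) * f s)%:E).
  have := L1D_integrable sigma0 f1.
  apply: le_integrable => //.
    apply/measurable_EFinP; apply: measurable_funM; last by case: f1.
    by apply: measurable_section; exact: measurable_EKker.
  move=> s _; rewrite /= lee_fin EKker1E mul1r; case: ifP => // _.
  by rewrite mul0r normr0.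
have EB s : (EKker a b sigma 1 (C1 * C2 * B) (t, s) =
    C1 * C2 * B * EKker a b sigma 1 1 (t, s)).
  by rewrite !EKker1E mul1r; case: ifP => // _; rewrite mulr0.
rewrite (@kop_comp _ (measurableTypeR R) R leb _ _ (EKker a b sigma 1 (C1 * C2 * B))).
- rewrite /kop -RintegralZl//; apply: eq_Rintegral => s _.
  by rewrite EB mulrA.
- exact: measurable_EKker.
- exact: measurable_EKker.
- by case: f1.
- by move=> z; exact: EKker_ge0.
- by move=> z; exact: EKker_ge0.
- by move=> s; exact: HB.
- rewrite (_ : (fun s => _) = (fun s => (C1 * C2 * B)%:E *
    (EKker a b sigma 1 1 (t, s) * f s)%:E)%E); first exact: integrableZl.
  by apply/funext => s; rewrite EB -EFinM mulrA.
Qed.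

Let beta_integrand p q x y r : R :=
  (y `^ sigma - r `^ sigma) `^ p * (r `^ sigma - x `^ sigma) `^ q * psid sigma r.

Let measurable_beta_integrand p q x y :
  measurable_fun setT (fun r => (beta_integrand p q x y r)%:E).
Proof.
apply/measurable_EFinP; apply: measurable_funM; last exact: measurable_psid.
apply: measurable_funM.
  by apply: (@measurableT_comp _ _ _ _ _ _ (@powR R ^~ p)) => //; exact: measurable_funB.
by apply: (@measurableT_comp _ _ _ _ _ _ (@powR R ^~ q)) => //; exact: measurable_funB.
Qed.

Let beta_integrand_ge0 p q x y r : 0 <= beta_integrand p q x y r.
Proof. exact: mulr_ge0 (mulr_ge0 (powR_ge0 _ _) (powR_ge0 _ _)) (psid_ge0 sigma0 _). Qed.

(** Take a multiple of (psi(t) - psi(a))^(be - 1): its integral of order [ga] is the Beta integral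
    with lower end [a], which is constant in [t]. *)
Lemma abel_kernel ga be : 0 < ga -> 0 < be -> ga + be = 1 ->
  exists2 kappa, L1D kappa & forall t, t \in `]a, b[ ->
    EKop ga (Gamma ga)^-1 kappa t = 1.
Proof.
move=> ga0 be0 gb; have [B B0 HB] := psi_beta sigma0 ga0 be0 gb.
have G0 : 0 < Gamma ga by apply: Gamma_gt0; rewrite ga0/=; lra.
pose C := Gamma ga / B.
have C0 : 0 < C by rewrite divr_gt0.
pose kappa t := C * (t `^ sigma - a `^ sigma) `^ (be - 1).
have mk : measurable_fun setT kappa.
  apply: measurable_funM => //.
  by apply: (@measurableT_comp _ _ _ _ _ _ (@powR R ^~ (be - 1))) => //; exact: measurable_funB.
have HB' t : a < t -> (\int[leb]_(r in `]a, t[) (beta_integrand (ga - 1) (be - 1) a t r)%:E = B%:E)%E.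
  exact: HB.
exists kappa.
  (* On ]a, b[ the factor (psi(b) - psi(r))^(ga - 1) is at least [m], since its exponent is not
     positive. So the Beta integrand over ]a, b[ dominates psi' [kappa] up to the factor [C / m]. *)
  split => //; pose m := (b `^ sigma - a `^ sigma) `^ (ga - 1).
  have m0 : 0 < m.
    rewrite powR_gt0// subr_gt0 gt0_ltr_powR// nnegrE// ltW//.
    exact: le_lt_trans ab.
  apply: (@le_lt_trans _ _ ((C / m)%:E *
      \int[leb]_(r in `]a, b[) (beta_integrand (ga - 1) (be - 1) a b r)%:E)%E); last first.
    by rewrite HB'// -EFinM ltry.
  have Cm : 0 <= C / m by rewrite divr_ge0 ?ltW.
  rewrite -ge0_integralZl//; last 2 first.
  - by apply: measurable_funTS; exact: measurable_beta_integrand.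
  - by move=> r _; rewrite lee_fin; exact: beta_integrand_ge0.
  under [leRHS]eq_integral do rewrite -EFinM.
  rewrite -integral_ifoo /wnorm; apply: ge0_le_integral => //.
  - by move=> r _; rewrite lee_fin mulr_ge0 ?EKw_ge0.
  - by apply: measurable_wnorm => //; exact: measurable_EKw.
  - apply/measurable_EFinP; apply: measurable_fun_if => //.
      by apply: measurable_and; exact: measurable_fun_ltr.
    apply: measurable_funTS; apply: measurable_funM => //.
    by have /measurable_EFinP := measurable_beta_integrand (ga - 1) (be - 1) a b.
  move=> r _; rewrite lee_fin EKw0E; case: ifP => [/andP[ar rb]|_]; last by rewrite mul0r.
  have r0 := le_lt_trans a0 ar; have b0 := lt_trans r0 rb.
  rewrite ger0_norm; last exact: mulr_ge0 (ltW C0) (powR_ge0 _ _).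
  rewrite /beta_integrand /kappa.
  have alg (d c1 p q n : R) : 0 <= d -> 0 <= c1 -> 0 <= p -> 0 < n -> n <= q ->
      d * (c1 * p) <= c1 / n * (q * p * d).
    move=> d0 c10 p0 n0 nq; rewrite (_ : c1 / n * _ = d * (c1 * p) * (q / n)); last by ring.
    by apply: ler_peMr; [rewrite !mulr_ge0|rewrite ler_pdivlMr// mul1r].
  apply: (alg _ _ _ _ _ (psid_ge0 sigma0 r) (ltW C0) (powR_ge0 _ _) m0).
  have le1 : 0 < b `^ sigma - r `^ sigma by rewrite subr_gt0 gt0_ltr_powR// nnegrE ltW.
  have ga1 : ga - 1 <= 0 by lra.
  apply: (le0_ger_powR_pos ga1 le1).
  by rewrite lerD2l lerN2 ltW// gt0_ltr_powR// nnegrE// ltW.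
move=> t tab; have /andP[at_ tb] : a < t < b by rewrite in_itv in tab.
rewrite /kop /Rintegral.
have -> : (\int[leb]_s (EKker a b sigma ga (Gamma ga)^-1 (t, s) * kappa s)%:E =
   (B^-1)%:E * \int[leb]_(r in `]a, t[) (beta_integrand (ga - 1) (be - 1) a t r)%:E)%E.
  rewrite -ge0_integralZl ?lee_fin ?invr_ge0 ?(ltW B0)//; last 2 first.
  - by apply: measurable_funTS; exact: measurable_beta_integrand.
  - by move=> r _; rewrite lee_fin; exact: beta_integrand_ge0.
  under [RHS]eq_integral do rewrite -EFinM.
  rewrite -integral_ifoo; apply: eq_integral => r _; congr EFin.
  rewrite /EKker/=; have [ar|ra] := ltP a r; last by rewrite mul0r.
  have [rt|tr] := ltP r t; last by rewrite !andbF mul0r.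
  rewrite (lt_trans rt tb)/= /kappa /C /beta_integrand.
  have alg (G p q d : R) : G != 0 -> B != 0 -> G^-1 * p * d * (G / B * q) = B^-1 * (p * q * d).
    by move=> G1 B1; field; rewrite ?G1 ?B1.
  by apply: alg; rewrite gt_eqF.
by rewrite HB'// -EFinM mulVf ?gt_eqF.
Qed.

Definition Iop ga phi : R -> R :=
  if ga == 0 then phi else EKop ga (Gamma ga)^-1 phi.

(* The kernels of orders [ga] and [1 - ga] compose to a constant multiple of the
   kernel of order 1 (Beta integral), which is injective by differentiation. *)
Lemma abel_equation ga : 0 <= ga < 1 ->
  exists kappa be C, [/\ 0 < be, 0 <= C, L1D kappa &
  forall c psi phi, L1D psi -> L1D phi ->
    {ae leb, forall t, t \in `]a, b[ -> Iop ga phi t = c + I1 psi t} <->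
    {ae leb, forall t, t \in `]a, b[ -> phi t = c * kappa t + EKop be C psi t}].
Proof.
rewrite /Iop => /andP[]; rewrite le_eqVlt eq_sym => /predU1P[->|ga0] ga1.
  (* At order 0 the operator [Iop] is the identity and the two equations coincide. *)
  exists (cst 1), 1, 1; split => //; first exact: L1D_cst.
  move=> c psi phi _ _; rewrite eqxx.
  by split; (apply: filterS; first exact: (ae_filter_ringOfSetsType leb)) => t;
    rewrite mulr1.
rewrite gt_eqF//.
have [be be0 gb] : exists2 be, 0 < be & ga + be = 1.
  by exists (1 - ga); rewrite ?subr_gt0// addrC subrK.
have [kappa kappa1 kappaE] := abel_kernel ga0 be0 gb.
have [B B0 HB] := EKop_comp ga0 be0 gb.
have [B' B'0 HB'] := EKop_comp be0 ga0 (etrans (addrC _ _) gb).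
have G0 : 0 < Gamma ga by apply: Gamma_gt0; rewrite ga0 ltW.
have Gi : 0 <= (Gamma ga)^-1 by rewrite invr_ge0 ltW.
(* [C] normalises the kernel of order [be] so that composing it with the integral of order [ga]
   gives exactly [I1]. *)
have [C C0 IC] : exists2 C, 0 < C & (Gamma ga)^-1 * C * B = 1.
  exists (Gamma ga / B); first by rewrite divr_gt0.
  by rewrite mulrA mulVf ?gt_eqF// mul1r mulVf// gt_eqF.
exists kappa, be, C; split; [exact: be0|exact: ltW|exact: kappa1|].
move=> c psi phi psi1 phi1.
have K1 : L1D (EKop be C psi) by apply: L1D_kop => //; exact: ltW.
have ck1 : L1D (fun t => c * kappa t).
  by apply: wL1Z kappa1; [exact: measurable_EKw|exact: EKw_ge0].
pose chi t := c * kappa t + EKop be C psi t.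
have chi1 : L1D chi by apply: wL1D => //; [exact: measurable_EKw|exact: EKw_ge0].
have Ichi : {ae leb, forall t, t \in `]a, b[ ->
    EKop ga (Gamma ga)^-1 chi t = c + I1 psi t}.
  move: (EKop_integrable_ae ga0 Gi kappa1) (EKop_integrable_ae ga0 Gi K1).
  apply: filterS2; first exact: (ae_filter_ringOfSetsType leb).
  move=> t /[swap] K /[swap] tab /(_ tab) k; have {}K := K tab.
  have -> : EKop ga (Gamma ga)^-1 chi t =
      c * EKop ga (Gamma ga)^-1 kappa t + EKop ga (Gamma ga)^-1 (EKop be C psi) t.
    exact: (@kop_linear _ (measurableTypeR R) R leb _ c kappa _ t k K).
  by rewrite kappaE// mulr1 HB ?(ltW C0)// IC mul1r.
split=> [Iphi|phiE]; last first.
  move: Ichi; apply: filterS; first exact: (ae_filter_ringOfSetsType leb).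
  by move=> t It tab; rewrite -It//; exact: EKop_ext.
have d1 : L1D (fun t => phi t - chi t).
  by apply: wL1B => //; [exact: measurable_EKw|exact: EKw_ge0].
have Id : {ae leb, forall t, t \in `]a, b[ ->
    EKop ga (Gamma ga)^-1 (fun t => phi t - chi t) t = 0}.
  have Idiff : {ae leb, forall t, t \in `]a, b[ ->
      EKop ga (Gamma ga)^-1 phi t = EKop ga (Gamma ga)^-1 chi t}.
    move: Iphi Ichi; apply: filterS2; first exact: (ae_filter_ringOfSetsType leb).
    by move=> t I1t I2t tab; rewrite I1t// I2t.
  move: (EKop_integrable_ae ga0 Gi phi1) (EKop_integrable_ae ga0 Gi chi1) Idiff.
  apply: filterS3; first exact: (ae_filter_ringOfSetsType leb).
  move=> t k1 k2 k3 tab.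
  have -> : (fun s => phi s - chi s) = (fun s => -1 * chi s + phi s).
    by apply/funext => s; rewrite mulN1r addrC.
  rewrite (@kop_linear _ (measurableTypeR R) R leb _ _ chi _ t (k2 tab) (k1 tab)).
  by rewrite (k3 tab) mulN1r addNr.
(* Applying the kernel of order [be] to a function that vanishes almost everywhere leaves a positive
   multiple of [I1] of the difference. *)
have : forall t, t \in `]a, b[ -> I1 (fun t => phi t - chi t) t = 0.
  move=> t tab; have := HB' C _ _ t (ltW C0) Gi d1 tab.
  rewrite (@EKop_ext be C _ (fun=> 0) t Id) {1}/kop.
  under eq_Rintegral do rewrite mulr0.
  rewrite Rintegral_cst// mul0r => /esym/eqP.
  have nz : C / Gamma ga * B' != 0 by rewrite gt_eqF// mulr_gt0// divr_gt0.
  by rewrite mulf_eq0 (negbTE nz) => /eqP.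
move=> /(I1_inj a0 sigma0 d1); apply: filterS; first exact: (ae_filter_ringOfSetsType leb).
by move=> t H tab; apply/eqP; rewrite -subr_eq0; apply/eqP/H.
Qed.

End abel_equation.

(** * The fixed point equation *)

Section fixed_point.
Variables (R : realType) (a b sigma : R).
Hypotheses (a0 : 0 <= a) (ab : a < b) (sigma0 : 0 < sigma).
Implicit Types (s t x y M C ga be : R) (f g psi phi kappa : R -> R) (c : nat -> R).
Notation leb := (@lebesgue_measure R).
Notation w0 := (EKw a b sigma 0).
Notation L1D := (wL1 leb w0).
Notation EKop ga C := (kop leb (EKker a b sigma ga C)).
Notation I1 := (EKop 1 1).
Notation J := (Jit a b sigma).

Let EKop_lip ga C M e f g : 0 <= C -> 0 <= e -> 0 <= M ->
  (forall s, (\int[leb]_t (EKw a b sigma M t * EKker a b sigma ga C (t, s))%:E <=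
    (e * EKw a b sigma M s)%:E)%E) ->
  L1D f -> L1D g ->
  (wnorm leb (EKw a b sigma M) (fun t => EKop ga C f t - EKop ga C g t)%R <=
   e%:E * wnorm leb (EKw a b sigma M) (fun t => f t - g t)%R)%E.
Proof.
move=> C0 e0 M0 HM f1 g1.
have {}f1 := proj2 (wL1_EKw a0 ab sigma0 f M0) f1.
have {}g1 := proj2 (wL1_EKw a0 ab sigma0 g M0) g1.
exact: (@kop_lipschitz _ (measurableTypeR R) R leb (EKw a b sigma M)
  (measurable_EKw a b sigma M) (EKw_ge0 a b sigma0 M) _ e
  (measurable_EKker a b sigma ga C) (fun z => EKker_ge0 a b sigma0 ga z C0)
  e0 HM f g f1 g1).
Qed.

Let J_lip M c psi1 psi2 i : 0 <= M ->
  (forall s, (\int[leb]_t (EKw a b sigma M t * EKker a b sigma 1 1 (t, s))%:E <=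
    (1 * EKw a b sigma M s)%:E)%E) ->
  L1D psi1 -> L1D psi2 ->
  (wnorm leb (EKw a b sigma M) (fun t => J c psi1 i t - J c psi2 i t)%R <=
   wnorm leb (EKw a b sigma M) (fun t => psi1 t - psi2 t)%R)%E.
Proof.
move=> M0 HM L1 L2; elim: i => // i; apply: le_trans.
rewrite -[leRHS]mul1e; have := EKop_lip (@ler01 R) (@ler01 R) M0 HM
  (L1D_Jit a0 ab sigma0 c i L1) (L1D_Jit a0 ab sigma0 c i L2).
by congr (_ <= _)%E; apply: eq_integral => t _ /=; rewrite opprD addrACA subrr add0r.
Qed.

(** For [M] large the kernel of order [be] has norm at most 1 / (2 K) and [I1] has norm at most 1,
    so the iterated primitives do not expand distances. With the constant [K] of [G] the map [S]
    contracts by 1/2. *)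
Lemma abel_fixpoint ga n c (G : (R -> R) -> R -> R) K : 0 <= ga < 1 -> 0 < K ->
  (forall phi, L1D phi -> L1D (G phi)) ->
  (forall phi1 phi2 t, `|G phi1 t - G phi2 t| <= K * `|phi1 t - phi2 t|) ->
  exists phi, [/\ L1D phi,
    {ae leb, forall t, t \in `]a, b[ -> Iop a b sigma ga phi t = J c (G phi) n.+1 t} &
    forall phi', L1D phi' ->
      {ae leb, forall t, t \in `]a, b[ -> Iop a b sigma ga phi' t = J c (G phi') n.+1 t} ->
      {ae leb, forall t, t \in `]a, b[ -> phi' t = phi t}].
Proof.
move=> ga01 K0 G1 GK.
have [kappa [be [C [be0 C0 kappa1 H]]]] := abel_equation a0 ab sigma0 ga01.
pose S phi t := c n.+1 * kappa t + EKop be C (J c (G phi) n) t.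
have e0 : 0 < (K *+ 2)^-1 by rewrite invr_gt0 mulrn_wgt0.
have [M1 M10 HM1] := EKker_small a0 ab sigma0 be0 C0 e0.
have [M2 M20 HM2] := EKker_small a0 ab sigma0 (@ltr01 R) (@ler01 R) (@ltr01 R).
pose M := Num.max M1 M2.
have M0 : 0 <= M by rewrite le_max ltW.
have {}HM1 : forall s, _ := HM1 M ltac:(by rewrite /M le_max lexx).
have {}HM2 : forall s, _ := HM2 M ltac:(by rewrite /M le_max lexx orbT).
have mw := measurable_EKw a b sigma M.
have w_ge0 := EKw_ge0 a b sigma0 M.
have JG1 phi : L1D phi -> L1D (J c (G phi) n).
  by move=> phi1; apply: L1D_Jit => //; exact: G1.
have S1 phi : L1D phi -> L1D (S phi).
  move=> phi1; apply: wL1D; [exact: measurable_EKw|exact: EKw_ge0| |].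
    by apply: wL1Z kappa1; [exact: measurable_EKw|exact: EKw_ge0].
  by apply: L1D_kop => //; exact: JG1.
have toM phi : L1D phi -> wL1 leb (EKw a b sigma M) phi.
  exact: proj2 (wL1_EKw a0 ab sigma0 phi M0).
have ofM phi : wL1 leb (EKw a b sigma M) phi -> L1D phi.
  exact: proj1 (wL1_EKw a0 ab sigma0 phi M0).
have SM phi : wL1 leb (EKw a b sigma M) phi -> wL1 leb (EKw a b sigma M) (S phi).
  by move=> /ofM/S1/toM.
have Sk phi1 phi2 : wL1 leb (EKw a b sigma M) phi1 -> wL1 leb (EKw a b sigma M) phi2 ->
   (wnorm leb (EKw a b sigma M) (fun t => S phi1 t - S phi2 t)%R <=
    (2^-1)%:E * wnorm leb (EKw a b sigma M) (fun t => phi1 t - phi2 t)%R)%E.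
  move=> /ofM L1 /ofM L2.
  have -> : (fun t => S phi1 t - S phi2 t) = (fun t =>
      EKop be C (J c (G phi1) n) t - EKop be C (J c (G phi2) n) t).
    by apply/funext => t; rewrite /S opprD addrACA subrr add0r.
  apply: (le_trans (EKop_lip C0 (ltW e0) M0 HM1 (JG1 _ L1) (JG1 _ L2))).
  apply: (le_trans (lee_wpmul2l _ (J_lip c n M0 HM2 (G1 _ L1) (G1 _ L2)))).
    by rewrite lee_fin ltW.
  apply: (@le_trans _ _ ((K *+ 2)^-1%:E *
      (K%:E * wnorm leb (EKw a b sigma M) (fun t => phi1 t - phi2 t)%R))%E).
    apply: lee_wpmul2l; first by rewrite lee_fin ltW.
    have [mG1 _] := G1 _ L1; have [mG2 _] := G1 _ L2.
    have [m1 _] := L1; have [m2 _] := L2.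
    apply: wnorm_scale_le => //; [exact: ltW|exact: measurable_funB|exact: measurable_funB].
  rewrite muleA -EFinM (_ : (K *+ 2)^-1 * K = 2^-1)//.
  by have := lt0r_neq0 K0 => ?; field.
have half01 : 0 <= (2^-1 : R) < 1 by rewrite invr_ge0 ler0n/= invf_lt1 ?ltr1n.
have fixE phi : L1D phi -> wnorm leb (EKw a b sigma M) (fun t => S phi t - phi t) = 0%E <->
    {ae leb, forall t, t \in `]a, b[ -> phi t = S phi t}.
  move=> L1; have [mphi _] := L1; have [mS _] := S1 _ L1.
  split=> [N0|phiE].
    have := @wnorm_eq0 _ (measurableTypeR R) R leb _ mw w_ge0
      (fun t => S phi t - phi t) (measurable_funB mS mphi) N0.
    apply: filterS => t H0 tab; apply/esym/eqP; rewrite -subr_eq0; apply/eqP/H0.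
    by rewrite EKw_neq0.
  rewrite /wnorm -(integral0 leb setT); apply: ae_eq_integral_nonmeas.
  move: phiE; apply: filterS; first exact: (ae_filter_ringOfSetsType leb).
  move=> t H0 _ /=; have [tab|] := boolP (t \in `]a, b[).
    by rewrite -H0// subrr normr0 mulr0.
  by rewrite -(EKw_neq0 b a0 sigma0 M) negbK => /eqP ->; rewrite mul0r.
have [phi phiM phiE] := @contraction_fixpoint _ (measurableTypeR R) R leb _ mw w_ge0 S _
  half01 SM Sk.
have L1 := ofM _ phiM.
exists phi; split; first exact: L1.
  by apply/H => //; [exact: JG1|exact: proj1 (fixE phi L1) phiE].
move=> phi' L1' /H -/(_ (JG1 _ L1') L1') /(fixE phi' L1') phi'E.
have N0 := @contraction_unique _ (measurableTypeR R) R leb _ mw w_ge0 S _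
  half01 SM Sk _ _ (toM _ L1') phiM phi'E phiE.
have [m1 _] := L1; have [m2 _] := L1'.
have := @wnorm_eq0 _ (measurableTypeR R) R leb _ mw w_ge0
  (fun t => phi' t - phi t) (measurable_funB m2 m1) N0.
apply: filterS => t H0 tab; apply/eqP; rewrite -subr_eq0; apply/eqP/H0.
by rewrite EKw_neq0.
Qed.

End fixed_point.

(** The value F(t, phi(t)) exceeds c exactly when F(t, q) - K |phi(t) - q| does for some rational q.
    One direction is the Lipschitz bound; for the other, q is taken within (F(t, phi(t)) - c) / (2
    K) of phi(t). *)
Lemma measurable_lipschitz_superposition d (T : measurableType d) (R : realType)
    (F : T -> R -> R) (K : R) (phi : T -> R) : 0 < K ->
  (forall q : rat, measurable_fun setT (fun t => F t (ratr q))) ->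
  (forall t x y, `|F t x - F t y| <= K * `|x - y|) ->
  measurable_fun setT phi -> measurable_fun setT (fun t => F t (phi t)).
Proof.
move=> K0 mF FK mphi mT; apply: (measurability _ (RGenOInfty.measurableE R)) => //.
move=> _ [_ [c ->] <-]; rewrite setTI.
have -> : (fun t => F t (phi t)) @^-1` `]c, +oo[%classic = \bigcup_(q in [set: rat])
    (fun t => F t (ratr q) - K * `|phi t - ratr q|) @^-1` `]c, +oo[%classic.
  apply/seteqP; split=> [t|t [q _]] /=; rewrite !in_itv/= !andbT => h.
    have e0 : 0 < (F t (phi t) - c) / (2 * K) by rewrite divr_gt0 ?subr_gt0// mulr_gt0.
    have [q] : exists q, ratr q \in `](phi t), (phi t + (F t (phi t) - c) / (2 * K))[.
      by apply: rat_in_itvoo; rewrite ltrDl.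
    rewrite in_itv/= => /andP[q1 q2]; exists q => //=.
    rewrite in_itv/= andbT.
    have := FK t (phi t) (ratr q); rewrite ler_distl => /andP[_].
    move: q2; rewrite -ltrBlDl ltr_pdivlMr ?mulr_gt0// distrC gtr0_norm ?subr_gt0//.
    by lra.
  have := FK t (phi t) (ratr q); rewrite ler_distl => /andP[+ _].
  by lra.
apply: bigcupT_measurable_rat => q; rewrite -[X in measurable X]setTI.
apply: measurable_funB => //; apply: measurable_funM => //.
by apply: measurableT_comp => //; exact: measurable_funB.
Qed.

(** * Passage between the spaces [L1psi] and L^1(psi' dt) *)

Section weighted_integrability.
Variables (R : realType) (a b sigma : R).
Hypotheses (a0 : 0 <= a) (ab : a < b) (sigma0 : 0 < sigma).
Implicit Types (s t x y r : R) (g h u phi : R -> R).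
Notation leb := (@lebesgue_measure R).
Notation w0 := (EKw a b sigma 0).
Notation L1D := (wL1 leb w0).

Let psid_powR r t : 0 < t -> sigma * t `^ (sigma * (r + 1) - 1) = psid sigma t * t `^ (sigma * r).
Proof.
move=> t0; rewrite /psid -mulrA -powRD; last by rewrite (gt_eqF t0) implybT.
by congr (_ * _ `^ _); lra.
Qed.

(** By [psid_powR], multiplication by t^(sigma r) carries one weight into the other up to the factor
    sigma. Extending by 0 off ]a, b[ gives a Borel function on the line. *)
Lemma L1psi_L1D r g : L1psi a b sigma (r + 1) g ->
  exists2 phi, L1D phi & {ae leb, forall t, t \in `]a, b[ -> phi t = t `^ (sigma * r) * g t}.
Proof.
move=> [h [mh gh hy]].
pose k t := t `^ (sigma * r) * h t.
have mk : measurable_fun `]a, b[ k.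
  apply: measurable_funM; first exact: measurable_funTS.
  by apply: measurable_funS mh => //; exact: subset_itv_oo_cc.
exists (k \_ `]a, b[).
  split; first by apply/(measurable_restrictT _ _).1 => //.
  apply: (@le_lt_trans _ _ (sigma%:E *
    \int[leb]_(t in `[a, b]) (t `^ (sigma * (r + 1) - 1) * `|h t|)%:E)%E); last first.
    by rewrite lte_mul_pinfty// lee_fin ltW.
  have mf D : measurable D -> D `<=` `[a, b] ->
      measurable_fun D (fun t => (t `^ (sigma * (r + 1) - 1) * `|h t|)%:E).
    move=> mD Dab; apply/measurable_EFinP; apply: measurable_funM.
      exact: measurable_funTS.
    by apply: measurableT_comp => //; exact: measurable_funS mh.
  rewrite -ge0_integralZl//; last 3 first.
  - exact: mf.
  - by move=> t _; rewrite lee_fin mulr_ge0 ?powR_ge0.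
  - by rewrite lee_fin ltW.
  rewrite /wnorm; apply: (@le_trans _ _ (\int[leb]_(t in `]a, b[)
      (sigma%:E * (t `^ (sigma * (r + 1) - 1) * `|h t|)%:E))%E); last first.
    apply: ge0_subset_integral => //.
    - by apply: measurable_funeM; exact: mf.
    - by move=> t _; rewrite mule_ge0 ?lee_fin ?(ltW sigma0) ?mulr_ge0 ?powR_ge0.
    - exact: subset_itv_oo_cc.
  rewrite [leRHS]integral_mkcond le_eqVlt; apply/orP; left; apply/eqP.
  apply: eq_integral => t _; rewrite !patchE mem_setE EKw0E in_itv/=.
  case: ifP => [/andP[at_ tb]|_]; last by rewrite mul0r.
  rewrite -EFinM mulrA psid_powR ?(le_lt_trans a0)// -mulrA.
  by rewrite /k normrM (ger0_norm (powR_ge0 _ _)) !mulrA.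
apply: filterS gh => t H tab; rewrite patchE mem_setE tab /k H//=.
exact: subset_itv_oo_cc tab.
Qed.

Lemma negligible_endpoints : leb.-negligible [set a; b].
Proof.
have n1 x : leb.-negligible [set x].
  by exists [set x]; split => //; exact: lebesgue_measure_set1.
exact: negligibleU (n1 a) (n1 b).
Qed.

Lemma L1D_L1psi r g phi : L1D phi ->
  {ae leb, forall t, t \in `]a, b[ -> g t = t `^ (- (sigma * r)) * phi t} ->
  L1psi a b sigma (r + 1) g.
Proof.
move=> [mphi phiy] gE; exists (fun t => t `^ (- (sigma * r)) * phi t); split.
- by apply: measurable_funTS; exact: measurable_funM.
- apply: negligibleS (negligibleU gE negligible_endpoints) => t /=.
  apply: contra_notP => /not_orP[/contrapT h1 h2].
  rewrite in_itv/= => /andP[at_ tb]; apply: h1; rewrite in_itv/= !lt_neqAle at_ tb !andbT.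
  by apply/andP; split; apply/eqP => h3; apply: h2; [left|right].
- apply: (@le_lt_trans _ _ ((sigma^-1)%:E * wnorm leb w0 phi)%E); last first.
    by rewrite lte_mul_pinfty// lee_fin invr_ge0 ltW.
  rewrite /wnorm -ge0_integralZl//; last 3 first.
  - by apply: measurable_wnorm => //; exact: measurable_EKw.
  - by move=> t _; rewrite lee_fin mulr_ge0 ?EKw_ge0.
  - by rewrite lee_fin invr_ge0 ltW.
  rewrite le_eqVlt; apply/orP; left; apply/eqP; rewrite [LHS]integral_mkcond.
  apply: ae_eq_integral_nonmeas; apply: negligibleS negligible_endpoints => t /=.
  apply: contra_notP => nab _.
  have ta : t != a by apply/eqP => h; apply: nab; left.
  have tb : t != b by apply/eqP => h; apply: nab; right.
  rewrite patchE mem_setE EKw0E in_itv/= !le_eqVlt eq_sym (negbTE ta) (negbTE tb)/=.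
  case: ifP => [/andP[at_ _]|_]; last by rewrite mul0r mule0.
  have t0 := le_lt_trans a0 at_.
  rewrite -EFinM; congr EFin.
  rewrite normrM (ger0_norm (powR_ge0 _ _)) /psid.
  have -> : t `^ (sigma * (r + 1) - 1) = sigma^-1 * (psid sigma t * t `^ (sigma * r)).
    by rewrite -psid_powR// mulKf ?gt_eqF.
  have alg (i p u x : R) : u != 0 -> i * (p * u) * (u^-1 * x) = i * (p * x).
    by move=> u0; field.
  by rewrite powRN; apply: alg; rewrite gt_eqF// powR_gt0.
Qed.

End weighted_integrability.

(** * The Cauchy problem *)

Section nemytskii.
Variables (R : realType) (a b sigma alpha eta : R) (f : R -> R -> R) (K : R).
Hypotheses (a0 : 0 <= a) (ab : a < b) (sigma0 : 0 < sigma) (K0 : 0 < K).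
Implicit Types (s t x y r : R) (g h u phi : R -> R).
Notation leb := (@lebesgue_measure R).
Notation w0 := (EKw a b sigma 0).
Notation L1D := (wL1 leb w0).

Hypothesis fL1 : forall x, L1psi a b sigma (eta + 1)
  (fun t => f t (t `^ (- (sigma * (alpha + eta))) * x)).
Hypothesis fLip : forall t, t \in `]a, b] -> forall x y,
  `|f t x - f t y| <= K * t `^ (sigma * alpha) * `|x - y|.

(* [f t (t^(- sigma (alpha + eta)) q)] has an integrable Borel representative for
   each [q].  Removing one null set makes them agree for all rational [q] at once;
   the Lipschitz condition then gives measurability of the superposition. *)
Lemma superposition_operator : exists G : (R -> R) -> R -> R,
  [/\ forall phi, L1D phi -> L1D (G phi),
      forall phi1 phi2 t, `|G phi1 t - G phi2 t| <= K * `|phi1 t - phi2 t| &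
      {ae leb, forall t, t \in `]a, b[ -> forall phi,
        G phi t = t `^ (sigma * eta) * f t (t `^ (- (sigma * (alpha + eta))) * phi t)}].
Proof.
pose p t := t `^ (- (sigma * (alpha + eta))).
have /choice[g gP] : forall q : rat, exists g, L1D g /\
    {ae leb, forall t, t \in `]a, b[ -> g t = t `^ (sigma * eta) * f t (p t * ratr q)}.
  by move=> q; have [g g1 gE] := L1psi_L1D a0 sigma0 (fL1 (ratr q)); exists g.
(* The rationals are enumerated by [unpickle]; indices that encode no rational repeat the case of
   0. *)
have [A [mA A0 AP]] : leb.-negligible (\bigcup_n ~` [set t | t \in `]a, b[ ->
    let q : rat := odflt 0 (unpickle n) in g q t = t `^ (sigma * eta) * f t (p t * ratr q)]).
  by apply: negligible_bigcup => n; exact: (gP _).2.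
have gE q t : ~ A t -> t \in `]a, b[ -> g q t = t `^ (sigma * eta) * f t (p t * ratr q).
  move=> nAt tab; apply: contrapT => H; apply: nAt; apply: AP.
  by exists (pickle q) => // /(_ tab); rewrite pickleK.
pose D : set R := `]a, b[ `\` A.
have mD : measurable (D : set (measurableTypeR R)) by exact: measurableD.
pose F t x := ((fun t => t `^ (sigma * eta) * f t (p t * x)) \_ D) t.
have FE t x : D t -> F t x = t `^ (sigma * eta) * f t (p t * x).
  by move=> Dt; rewrite /F patchE mem_set.
have FN t x : ~ D t -> F t x = 0 by move=> Dt; rewrite /F patchE memNset.
have FLip t x y : `|F t x - F t y| <= K * `|x - y|.
  have [Dt|Dt] := pselect (D t); last first.
    by rewrite !FN// subrr normr0 mulr_ge0// ltW.
  have [/= tab _] := Dt; have /andP[at_ tb] : a < t < b by move: tab; rewrite in_itv.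
  have t0 := le_lt_trans a0 at_.
  rewrite !FE// -mulrBr normrM (ger0_norm (powR_ge0 _ _)).
  have tab' : t \in `]a, b] by rewrite in_itv/= at_ ltW.
  apply: (le_trans (ler_wpM2l (powR_ge0 _ _) (fLip tab' _ _))).
  rewrite -mulrBr normrM (ger0_norm (powR_ge0 _ _)).
  (* The three exponents sum to 0, which leaves the constant [K] free of [t]. *)
  have E : t `^ (sigma * eta) * t `^ (sigma * alpha) * p t = 1.
    rewrite /p -!powRD ?(gt_eqF t0) ?implybT//.
    by rewrite (_ : _ - _ = 0) ?powRr0//; ring.
  have alg (e1 e2 e3 z : R) : e1 * e2 * e3 = 1 -> e1 * (K * e2 * (e3 * z)) <= K * z.
    move=> h; rewrite (_ : e1 * (K * e2 * (e3 * z)) = K * (e1 * e2 * e3) * z).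
      by rewrite h mulr1.
    by ring.
  exact: alg.
have FL1 q : L1D (fun t => F t (ratr q)).
  have [g1 _] := gP q; have [mg _] := g1.
  have FgE : (fun t => F t (ratr q)) = g q \_ D.
    apply/funext => t; have [Dt|Dt] := pselect (D t).
      rewrite FE// patchE mem_set// gE//; first by case: Dt.
      by case: Dt.
    by rewrite FN// patchE memNset.
  rewrite FgE; apply: (@wL1_scale_le _ (measurableTypeR R) R leb w0 1 _ (g q)
    (measurable_EKw a b sigma 0) (EKw_ge0 a b sigma0 0) ler01 _ g1).
    exact: ((measurable_restrictT (g q) mD).1 (measurable_funTS mg)).
  move=> t; rewrite mul1r patchE; case: ifP => // _.
  by rewrite (_ : point = 0)// normr0.
exists (fun phi t => F t (phi t)); split => //.
- move=> phi phi1; have [mphi _] := phi1.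
  have mG : measurable_fun setT (fun t => F t (phi t)).
    apply: (measurable_lipschitz_superposition K0) => // q.
    by case: (FL1 q).
  have [m0 _] := FL1 0.
  (* The difference is bounded by K |phi|, and the value at 0 is integrable by hypothesis. *)
  have -> : (fun t => F t (phi t)) = (fun t => (F t (phi t) - F t (ratr 0)) + F t (ratr 0)).
    by apply/funext => t; rewrite subrK.
  apply: wL1D (FL1 0); [exact: measurable_EKw|exact: EKw_ge0|].
  apply: (@wL1_scale_le _ (measurableTypeR R) R leb w0 K _ phi
    (measurable_EKw a b sigma 0) (EKw_ge0 a b sigma0 0) (ltW K0) _ phi1).
    exact: measurable_funB.
  by move=> t; apply: (le_trans (FLip _ _ _)); rewrite rmorph0 subr0.
- exists A; split => // t; apply: contra_notP => nAt tab phi.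
  by rewrite FE//; split.
Qed.

End nemytskii.

Section EKint_Iop.
Variables (R : realType) (a b sigma : R).
Hypotheses (a0 : 0 <= a) (ab : a < b) (sigma0 : 0 < sigma).
Implicit Types (s t x y r e ga gam eta : R) (g h u phi : R -> R).
Notation leb := (@lebesgue_measure R).
Notation w0 := (EKw a b sigma 0).
Notation L1D := (wL1 leb w0).

(** The power s^(sigma e) of the integrand goes into [phi], and sigma times the remaining s^(sigma -
    1) is psi'. The end points [a] and [t], where the kernel is cut off, form a null set. *)
Lemma EKint_Iop e ga u phi : 0 <= ga < 1 -> L1D phi ->
  {ae leb, forall s, s \in `]a, b[ -> phi s = s `^ (sigma * e) * u s} ->
  {ae leb, forall t, t \in `]a, b[ ->
    EKint a sigma e ga u t = t `^ (- (sigma * (ga + e))) * Iop a b sigma ga phi t}.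
Proof.
move=> /andP[]; rewrite le_eqVlt eq_sym => ga0 ga1 phi1 phiE.
have [ga00|/negPf ga00] := eqVneq ga 0.
  move: phiE; apply: filterS; first exact: (ae_filter_ringOfSetsType leb).
  move=> t H tab; rewrite /EKint /Iop ga00 eqxx add0r H// mulrA -powRD.
    by rewrite addNr powRr0 mul1r.
  have t0 : 0 < t by move: tab; rewrite in_itv/= => /andP[/(le_lt_trans a0)].
  by rewrite (gt_eqF t0) implybT.
move: ga0; rewrite ga00/= => ga0.
have G0 : 0 < Gamma ga by apply: Gamma_gt0; rewrite ga0 ltW.
have Gi : 0 <= (Gamma ga)^-1 by rewrite invr_ge0 ltW.
move: (EKop_integrable_ae a0 ab sigma0 ga0 Gi phi1).
apply: filterS; first exact: (ae_filter_ringOfSetsType leb).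
move=> t H tab; have {}H := H tab; rewrite /EKint /Iop ga00.
have /andP[at_ tb] : a < t < b by rewrite in_itv in tab.
have -> : \int[leb]_(s in `[a, t]) (s `^ (sigma * e + sigma - 1) * u s /
     (t `^ sigma - s `^ sigma) `^ (1 - ga)) =
   Gamma ga / sigma * kop leb (EKker a b sigma ga (Gamma ga)^-1) phi t.
  rewrite /kop -RintegralZl// Rintegral_mkcond; congr fine.
  apply: ae_eq_integral_nonmeas.
  have nat_ := @negligible_endpoints R a t.
  apply: negligibleS (negligibleU phiE nat_) => s /=.
  apply: contra_notP => /not_orP[/contrapT h1 h2] _; congr EFin.
  have sa : s != a by apply/eqP => h; apply: h2; left.
  have st : s != t by apply/eqP => h; apply: h2; right.
  rewrite patchE mem_setE in_itv/= !le_eqVlt eq_sym (negbTE sa) (negbTE st)/=.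
  rewrite /EKker/=; have [as_|_] := ltP a s; last by rewrite mul0r mulr0.
  have [lst|_] := ltP s t; last by rewrite /= andbF mul0r mulr0.
  have sb := lt_trans lst tb; have s0 := le_lt_trans a0 as_.
  rewrite sb/= h1 ?in_itv/= ?as_//.
  rewrite -(opprB 1 ga) powRN /psid -addrA (@powRD _ s (sigma * e) (sigma - 1)) ?(gt_eqF s0) ?implybT//.
  have alg (G i p q v : R) : G != 0 -> sigma != 0 ->
      p * q * v * i = G / sigma * (G^-1 * i * (sigma * q) * (p * v)).
    by move=> G1 s1; field; rewrite ?G1 ?s1.
  by apply: alg; rewrite ?gt_eqF.
have alg (G p I : R) : G != 0 -> sigma != 0 -> sigma * p / G * (G / sigma * I) = p * I.
  by move=> G1 s1; field; rewrite ?G1 ?s1.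
by apply: alg; rewrite ?gt_eqF.
Qed.

(** The outer power of t cancels because m + eta = ga + (eta + gam), with m the ceiling of [gam]. *)
Lemma EKpre_Iop eta gam u phi : let ga := (ceiln gam)%:R - gam in
  0 <= ga < 1 -> L1D phi ->
  {ae leb, forall s, s \in `]a, b[ -> phi s = s `^ (sigma * (eta + gam)) * u s} ->
  {ae leb, forall t, t \in `]a, b[ -> EKpre a sigma eta gam u t = Iop a b sigma ga phi t}.
Proof.
move=> ga ga01 phi1 phiE; have := EKint_Iop ga01 phi1 phiE.
apply: filterS; first exact: (ae_filter_ringOfSetsType leb).
move=> t H tab; rewrite /EKpre H// mulrA -powRD; last first.
  have t0 : 0 < t by move: tab; rewrite in_itv/= => /andP[/(le_lt_trans a0)].
  by rewrite (gt_eqF t0) implybT.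
have -> : sigma * ((ceiln gam)%:R + eta) - sigma * (ga + (eta + gam)) = 0.
  by rewrite /ga; ring.
by rewrite powRr0 mul1r.
Qed.

End EKint_Iop.

Lemma ceilnP (R : realType) (x : R) n : n%:R < x <= n.+1%:R -> ceiln x = n.+1.
Proof.
move=> /andP[nx xn]; rewrite /ceiln (_ : Num.ceil x = n.+1 :> int)//.
apply/eqP; rewrite ceil_eq (_ : n.+1%:Z - 1 = n%:Z) ?nx//.
by rewrite -addn1 PoszD addrK.
Qed.

Lemma ceiln_itv (R : realType) (x : R) : 0 < x ->
  exists n, ceiln x = n.+1 /\ n%:R < x <= n.+1%:R.
Proof.
move=> x0; rewrite /ceiln; have := ceil_eq x (Num.ceil x); rewrite eqxx.
have : 0 < Num.ceil x by rewrite ceil_gt0.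
case: (Num.ceil x) => [[|n]|//] // _ /esym/andP[h1 h2]; exists n; split => //.
rewrite h2 andbT; apply: le_lt_trans h1.
by rewrite -[n.+1]addn1 PoszD addrK.
Qed.

(** * Continuous representatives of classes *)

Section representatives.
Variables (R : realType) (a b sigma : R).
Hypotheses (a0 : 0 <= a) (ab : a < b) (sigma0 : 0 < sigma).
Implicit Types (s t x y l r eta gam : R) (g h u w phi F : R -> R) (i j m : nat).
Notation leb := (@lebesgue_measure R).

Lemma ae_itvoo_exists x y (P : R -> Prop) : x < y ->
  {ae leb, forall s, s \in `]x, y[ -> P s} -> exists2 s, s \in `]x, y[ & P s.
Proof.
move=> xy PD; apply: contrapT => nP.
have : leb.-negligible `]x, y[.
  by apply: negligibleS PD => s /= sxy H; apply: nP; exists s => //; exact: H.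
move=> /negligibleP => /(_ (measurable_itv _)).
rewrite /= lebesgue_measure_itv/= lte_fin xy -EFinB => /eqP.
by rewrite eqe subr_eq0 gt_eqF.
Qed.

(** If [g t] were outside [C], so would be the values on some interval to the left of [t], which is
    not a null set. *)
Lemma ae_continuous_closed x y g (C : set R) t : t \in `]x, y[ ->
  {for t, continuous g} -> closed C ->
  {ae leb, forall s, s \in `]x, y[ -> C (g s)} -> C (g t).
Proof.
move=> txy ct cC CD; apply: contrapT => nCt.
have /nbhs_ballP[e /= e0 eC] : nbhs t (g @^-1` (~` C)).
  apply: ct; apply: open_nbhs_nbhs; split => //; exact: closed_openC.
have /andP[xt ty] : x < t < y by rewrite in_itv in txy.
pose m := Num.max x (t - e).
have mt : m < t by rewrite gt_max xt ltrBlDr ltrDl.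
have [s smt Cs] : exists2 s, s \in `]m, t[ & C (g s).
  apply: ae_itvoo_exists => //; move: CD.
  apply: filterS; first exact: (ae_filter_ringOfSetsType leb).
  move=> s H; rewrite in_itv/= => /andP[ms st]; apply: H.
  rewrite in_itv/= (lt_trans st ty) andbT.
  by apply: le_lt_trans ms; rewrite le_max lexx.
move: smt; rewrite in_itv/= => /andP[ms st]; apply: eC Cs.
rewrite /ball/= gtr0_norm ?subr_gt0// ltrBlDr -ltrBlDl.
by apply: le_lt_trans ms; rewrite le_max lexx orbT.
Qed.

Lemma ACpsi_continuous m w t : (0 < m)%N -> ACpsi a b sigma m w ->
  t \in `]a, b[ -> {for t, continuous w}.
Proof.
case: m => [//|[|m]] _ [dw [F acF Fw]] tab.
  apply: near_eq_continuous (abs_cont_continuous acF tab).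
  by apply: eq_on_itvoo_near tab => s sab; rewrite Fw.
exact/differentiable_continuous/derivable1_diffP/(dw 0%N).
Qed.

Lemma ae_eq_continuous g h : (forall t, t \in `]a, b[ -> {for t, continuous g}) ->
  (forall t, t \in `]a, b[ -> {for t, continuous h}) ->
  {ae leb, forall t, t \in `]a, b[ -> g t = h t} -> {in `]a, b[, g =1 h}.
Proof.
move=> cg ch gh t tab; apply/eqP; rewrite -subr_eq0; apply/eqP.
apply: (@ae_continuous_closed a b (fun t => g t - h t) [set 0] t) => //.
- by apply: cvgB; [exact: cg|exact: ch].
- move: gh; apply: filterS; first exact: (ae_filter_ringOfSetsType leb).
  by move=> s H sab /=; rewrite H// subrr.
Qed.

(** Near [a] the closed condition of being within [e] of [l] holds almost everywhere for [g], hence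
    everywhere by continuity. *)
Lemma ae_cvg_continuous g h l : (forall t, t \in `]a, b[ -> {for t, continuous g}) ->
  {ae leb, forall t, t \in `]a, b[ -> h t = g t} ->
  h t @[t --> a^'+] --> l -> g t @[t --> a^'+] --> l.
Proof.
move=> cg gh /cvgrPdist_le hl; apply/cvgrPdist_le => e e0.
have [d /= d0 hd] := hl e e0.
pose m := Num.min b (a + d).
near=> t.
have tm : t \in `]a, m[.
  rewrite in_itv/=; apply/andP; split; first by near: t; exact: nbhs_right_gt.
  by near: t; apply: nbhs_right_lt; rewrite lt_min ab ltrDl.
have mb : m <= b by rewrite ge_min lexx.
have md : m <= a + d by rewrite ge_min lexx orbT.
apply: (@ae_continuous_closed a m g [set x | `|l - x| <= e] t tm).
- by apply: cg; apply: subset_itvl tm; rewrite bnd_simp.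
- rewrite (_ : [set x | `|l - x| <= e] = (fun x => `|l - x|) @^-1` [set x | x <= e])//.
  apply: closed_comp; last exact: closed_le.
  move=> x _; apply: cvg_norm; apply: cvgB; [exact: cvg_cst|exact: cvg_id].
- move: gh; apply: filterS; first exact: (ae_filter_ringOfSetsType leb).
  move=> s H sam /=; rewrite -H; last by apply: subset_itvl sam; rewrite bnd_simp.
  move: sam; rewrite in_itv/= => /andP[as_ sm].
  apply: hd => //=; rewrite ltr0_norm ?subr_lt0// opprB ltrBlDl.
  exact: lt_le_trans md.
Unshelve. all: by end_near. Qed.

Lemma derive1_0_cvg0 F : (forall t, t \in `]a, b[ -> derivable F t 1 /\ derive1 F t = 0) ->
  F t @[t --> a^'+] --> (0 : R) -> {in `]a, b[, F =1 cst 0}.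
Proof.
move=> dF F0 t tab.
have Fx x : a < x -> x < t -> F x = F t.
  move=> ax xt; have xab z : z \in `[x, t] -> z \in `]a, b[.
    by move: tab; rewrite !in_itv/= => /andP[_ tb] /andP[xz zt]; rewrite (lt_le_trans ax xz) (le_lt_trans zt tb).
  have [| |z zxt] := @MVT R F (derive1 F) x t xt.
  - move=> z zxt; have [dz _] := dF z (xab z (subset_itv_oo_cc zxt)).
    by rewrite derive1E; exact: DeriveDef.
  - apply: derivable_within_continuous => z /xab /dF[].
    done.
  - have [_ ->] := dF z (xab z (subset_itv_oo_cc zxt)).
    by rewrite mul0r => /eqP; rewrite subr_eq0 => /eqP.
have := F0; have : F x @[x --> a^'+] --> F t.
  apply: (@cvg_trans _ (cst (F t) x @[x --> a^'+])); last exact: cvg_cst.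
  apply: near_eq_cvg; near=> x; rewrite (Fx x)//.
  by near: x; apply: nbhs_right_lt; move: tab; rewrite in_itv/= => /andP[].
move=> H1 H2; exact: (cvg_unique _ H1 H2).
Unshelve. all: by end_near. Qed.

(** Frees the derivative from the choice made by [xget]: representatives are continuous and agree
    almost everywhere, so they coincide on ]a, b[. *)
Lemma EKderivE eta gam u w : (0 < ceiln gam)%N -> EKreps a b sigma eta gam u w ->
  {in `]a, b[, EKderiv a b sigma eta gam u =1
    fun t => t `^ (- (sigma * eta)) * iter (ceiln gam) (rho sigma) w t}.
Proof.
move=> m0 wE t tab; rewrite /EKderiv; congr (_ * _).
apply: iter_rho_eq_in tab; have [w1 w1E] := xgetPex (EKpre a sigma eta gam u) (ex_intro _ w wE).
have [w2 w2E] := wE.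
apply: ae_eq_continuous.
- by move=> s; exact: ACpsi_continuous w1.
- by move=> s; exact: ACpsi_continuous w2.
- apply: filterS2 w1E w2E => s h1 h2 sab; rewrite h1//; by rewrite h2.
Qed.

End representatives.

(** * The initial value problem for powers of [rho] *)

Section initial_value_problem.
Variables (R : realType) (a b sigma : R).
Hypotheses (a0 : 0 <= a) (ab : a < b) (sigma0 : 0 < sigma).
Implicit Types (s t : R) (w psi : R -> R) (c : nat -> R) (i k n : nat).
Notation leb := (@lebesgue_measure R).
Notation w0 := (EKw a b sigma 0).
Notation L1D := (wL1 leb w0).
Notation J := (Jit a b sigma).

(** The induction starts from the highest derivative rho^n w, which is absolutely continuous and so
    the integral of its derivative. At each lower order [w] and the iterated primitive have the same
    derivative and the same limit at [a]. *)
Lemma ACpsi_eq_Jit n w psi c : L1D psi -> ACpsi a b sigma n.+1 w ->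
  {ae leb, forall t, t \in `]a, b[ -> iter n.+1 (rho sigma) w t = psi t} ->
  (forall k, (0 < k <= n.+1)%N ->
    iter (n.+1 - k) (rho sigma) w t @[t --> a^'+] --> c k) ->
  {in `]a, b[, w =1 J c psi n.+1}.
Proof.
move=> psi1 [dw [F acF Fw]] wpsi wc.
suff H i : (i < n.+1)%N -> {in `]a, b[, iter (n - i) (rho sigma) w =1 J c psi i.+1}.
  by move=> t tab; rewrite -H// subnn.
have psid_gt t : t \in `]a, b[ -> 0 < psid sigma t.
  by rewrite in_itv/= => /andP[at_ _]; rewrite psid_gt0// (le_lt_trans a0).
have nearD t : \forall t \near a^'+, t \in `]a, b[.
  near=> s; rewrite in_itv/=; apply/andP; split; near: s.
    exact: nbhs_right_gt.
  exact: nbhs_right_lt.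
elim: i => [|i ih] ilt.
- have [g [gi FE dF]] := abs_cont_FTC ab acF.
  have Fc : F a = c 1%N.
    have Fa := abs_cont_cvg_at_right ab acF.
    have : F t @[t --> a^'+] --> c 1%N.
      have := wc 1%N isT; rewrite subn1 /=; apply: cvg_trans.
      by apply: near_eq_cvg; near=> t; rewrite Fw//; near: t; exact: nearD.
    by move=> h; exact: (cvg_unique _ Fa h).
  have gpsi : {ae leb, forall t, t \in `]a, b[ -> g t = psid sigma t * psi t}.
    move: dF wpsi; apply: filterS2; first exact: (ae_filter_ringOfSetsType leb).
    move=> t h1 h2 tab; have [_ <-] := h1 tab; rewrite -h2// iterS.
    rewrite -(rho_eq_in sigma Fw tab) /rho mulVKf//.
    by have := psid_gt _ tab; rewrite /psid => /gt_eqF ->.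
  move=> t tab; rewrite subn0 -Fw//.
  have /andP[at_ tb] : a < t < b by rewrite in_itv in tab.
  rewrite FE ?(ltW at_) ?(ltW tb)// Fc/= I1E; congr (_ + _); congr fine.
  apply: ae_eq_integral_nonmeas; move: gpsi.
  apply: filterS; first exact: (ae_filter_ringOfSetsType leb).
  move=> s h; rewrite /= in_itv/= => /andP[as_ st]; have sb := le_lt_trans st tb.
  by rewrite EKw0E as_ sb/= h// in_itv/= as_.
- have ni : (n - i = (n - i.+1).+1)%N by rewrite subnSK.
  have dg t : t \in `]a, b[ -> derivable (iter (n - i.+1) (rho sigma) w) t 1.
    by apply: dw; rewrite -ni ltnS leq_subr.
  have H0 : {in `]a, b[, (fun t => iter (n - i.+1) (rho sigma) w t - J c psi i.+2 t) =1 cst 0}.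
    apply: derive1_0_cvg0.
      move=> t tab; have [dJ JE] := rho_Jit a0 ab sigma0 c i psi1 tab.
      split; first exact: derivableB (dg t tab) dJ.
      rewrite derive1E deriveB//; last exact: dg.
      rewrite -!derive1E; apply/eqP; rewrite subr_eq0; apply/eqP.
      have := ih (ltnW ilt) t tab; rewrite ni iterS -JE /rho.
      by apply: mulfI; rewrite invr_eq0 gt_eqF//; exact: psid_gt.
    rewrite -(subrr (c i.+2)); apply: cvgB; last exact: Jit_cvg.
    by have := wc i.+2; rewrite subSS; apply.
  by move=> t tab; apply/eqP; rewrite -subr_eq0; apply/eqP/H0.
Unshelve. all: by end_near. Qed.

End initial_value_problem.

Theorem theorem5p13 (R : realType) (a b : R) (ha : 0 <= a) (hab : a < b)
    (alpha sigma eta : R) (halpha : 0 < alpha) (hsigma : 0 < sigma)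
    (c : nat -> R) (f : R -> R -> R)
    (hfL1 : forall x : R,
      L1psi a b sigma (eta + 1)
        (fun t => f t (t `^ (- (sigma * (alpha + eta))) * x)))
    (hfLip : exists2 K : R, 0 < K &
      forall t : R, t \in `]a, b] -> forall x y : R,
        `|f t x - f t y| <= K * t `^ (sigma * alpha) * `|x - y|) :
  exists u : R -> R,
    [/\ Lalpha a b sigma eta alpha u,
        EKCauchy a b sigma eta alpha c f u &
        forall v : R -> R,
          Lalpha a b sigma eta alpha v ->
          EKCauchy a b sigma eta alpha c f v ->
          ae_eq (@lebesgue_measure R) `]a, b[%classic v u].
Proof.
pose leb := @lebesgue_measure R.
have ae2 (P Q S : R -> Prop) : {ae leb, forall t, P t} -> {ae leb, forall t, Q t} ->
    (forall t, P t -> Q t -> S t) -> {ae leb, forall t, S t}.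
  move=> aP aQ PQS; move: aP aQ; apply: filterS2 PQS.
  exact: (ae_filter_ringOfSetsType leb).
have aeT (g1 g2 g3 : R -> R) : {ae leb, forall t, t \in `]a, b[ -> g1 t = g2 t} ->
    {ae leb, forall t, t \in `]a, b[ -> g2 t = g3 t} ->
    {ae leb, forall t, t \in `]a, b[ -> g1 t = g3 t}.
  by move=> h12 h23; apply: (ae2 _ _ _ h12 h23) => t h1 h2 tab; rewrite h1// h2.
have aeC (g1 g2 : R -> R) : {ae leb, forall t, t \in `]a, b[ -> g1 t = g2 t} ->
    {ae leb, forall t, t \in `]a, b[ -> g2 t = g1 t}.
  by move=> h; apply: (ae2 _ _ _ h h) => t h1 _ tab; rewrite h1.
have [K K0 fLip] := hfLip.
have [G [G1 GLip GE]] := superposition_operator ha hsigma K0 hfL1 fLip.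
(* From here on [n] is one less than the ceiling of [alpha], so there are [n.+1] initial values. *)
have [n [nE /andP[nalpha alphan]]] := ceiln_itv halpha.
pose ga : R := n.+1%:R - alpha.
have ga01 : 0 <= ga < 1 by rewrite subr_ge0 alphan/= ltrBlDr -natr1 addrC ltrD2l.
have [phi [phi1 Iphi phiU]] := abel_fixpoint ha hab hsigma n c ga01 K0 G1 GLip.
have gt0 t : t \in `]a, b[ -> 0 < t.
  by rewrite in_itv/= => /andP[/(le_lt_trans ha)].
have powM t r s : t \in `]a, b[ -> t `^ r * t `^ s = t `^ (r + s).
  by move=> tab; rewrite -powRD// (gt_eqF (gt0 _ tab)) implybT.
have ck k : (k < n.+1)%N -> ceiln (alpha - k%:R) = (n - k).+1.
  move=> kn; apply: ceilnP; rewrite natrB//; apply/andP; split.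
    by rewrite ltrD2r.
  by rewrite -natr1 natrB// addrAC natr1 lerD2r.
have gak k : (k < n.+1)%N -> (ceiln (alpha - k%:R))%:R - (alpha - k%:R) = ga.
  by move=> kn; rewrite ck// -natr1 natrB// /ga -natr1; ring.
(* All the fractional integrals in the problem are almost everywhere the same function, so one
   representative decides both the equation and the initial conditions. *)
have IE u psi : wL1 leb (EKw a b sigma 0) psi ->
    {ae leb, forall t, t \in `]a, b[ -> psi t = t `^ (sigma * (alpha + eta)) * u t} ->
  [/\ {ae leb, forall t, t \in `]a, b[ ->
        EKpre a sigma eta alpha u t = Iop a b sigma ga psi t},
     forall k, (k < n.+1)%N -> {ae leb, forall t, t \in `]a, b[ ->
        EKpre a sigma 0 (alpha - k%:R) (fun t => t `^ (sigma * (k%:R + eta)) * u t) t =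
        Iop a b sigma ga psi t} &
     {ae leb, forall t, t \in `]a, b[ ->
        EKint a sigma (alpha - n.+1%:R) (n.+1%:R - alpha)
           (fun t => t `^ (sigma * (n.+1%:R + eta)) * u t) t =
        Iop a b sigma ga psi t}].
  move=> psi1 psiE.
  have psiM r1 r2 : r1 + r2 = alpha + eta -> {ae leb, forall t, t \in `]a, b[ ->
      psi t = t `^ (sigma * r1) * (t `^ (sigma * r2) * u t)}.
    move=> r12; move: psiE; apply: filterS; first exact: (ae_filter_ringOfSetsType leb).
    by move=> t h tab; rewrite h// mulrA powM// -mulrDr r12.
  split.
  - rewrite /ga -nE; apply: EKpre_Iop => //; first by rewrite nE.
    by rewrite (addrC eta).
  - move=> k kn; rewrite -(gak k kn); apply: EKpre_Iop => //; first by rewrite gak.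
    by apply: psiM; ring.
  - have := @EKint_Iop _ a b sigma ha hab hsigma (alpha - n.+1%:R) ga _ _ ga01 psi1
      (psiM (alpha - n.+1%:R) (n.+1%:R + eta) ltac:(ring)).
    apply: filterS; first exact: (ae_filter_ringOfSetsType leb).
    move=> t h tab; rewrite h// (_ : ga + (alpha - n.+1%:R) = 0); last by rewrite /ga; ring.
    by rewrite mulr0 oppr0 powRr0 mul1r.
pose w := Jit a b sigma c (G phi) n.+1.
pose u t := t `^ (- (sigma * (alpha + eta))) * phi t.
exists u.
have uE t : t \in `]a, b[ -> phi t = t `^ (sigma * (alpha + eta)) * u t.
  by move=> tab; rewrite /u mulrA powM// subrr powRr0 mul1r.
have [u1 u2 u3] := IE u phi phi1 (aeW leb uE).
have w1 m : (0 < m <= n.+1)%N -> ACpsi a b sigma m w.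
  by move=> mn; apply: ACpsi_Jit => //; exact: G1.
have ure1 : EKreps a b sigma eta alpha u w.
  split; first by rewrite nE; apply: w1; rewrite leqnn.
  exact/aeC/(aeT _ _ _ u1 Iphi).
have Dphi : {ae leb, forall t, t \in `]a, b[ ->
    EKderiv a b sigma eta alpha u t = t `^ (- (sigma * eta)) * G phi t}.
  have := iter_rho_Jit_ae ha hab hsigma c (ltn0Sn n) (G1 _ phi1).
  apply: filterS; first exact: (ae_filter_ringOfSetsType leb).
  by move=> t h tab; rewrite (EKderivE _ ure1) ?nE// h.
have toD t : (t \in `]a, b[) -> t `^ (- (sigma * eta)) * t `^ (sigma * eta) = 1.
  by move=> tab; rewrite powM// addNr powRr0.
split.
- split.
  + by apply: L1D_L1psi phi1 _ => //; exact: aeW.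
  + by exists w.
  + exact: L1D_L1psi (G1 _ phi1) Dphi.
- rewrite /EKCauchy nE; split.
  + apply: (ae2 _ _ _ Dphi GE) => t h1 h2 tab.
    by rewrite h1// h2// mulrA toD// mul1r.
  + case=> // k /= kn; pose v t := t `^ (sigma * (k.+1%:R + eta)) * u t.
    have ure2 : EKreps a b sigma 0 (alpha - k.+1%:R) v w.
      split; first by rewrite ck//; apply: w1 => /=; exact: leq_subr.
      exact/aeC/(aeT _ _ _ (u2 k.+1 kn) Iphi).
    split; first by exists w.
    have := @Jit_cvg _ _ _ _ ha hab hsigma c _ k (G1 _ phi1); apply: cvg_trans.
    apply: near_eq_cvg; near=> t.
    have tab : t \in `]a, b[.
      rewrite in_itv/=; apply/andP; split; near: t; first exact: nbhs_right_gt.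
      exact: nbhs_right_lt.
    rewrite (EKderivE _ ure2)//; last by rewrite ck.
    rewrite mulr0 oppr0 powRr0 mul1r ck//.
    rewrite -(iter_rho_Jit ha hab hsigma c (n - k.+1).+1 k (G1 _ phi1) tab) /w.
    by rewrite addSn subnK.
  + exists w; last exact: (@Jit_cvg _ _ _ _ ha hab hsigma c _ n (G1 _ phi1)).
    exact/aeC/(aeT _ _ _ u3 Iphi).
(* For uniqueness the reduction is reversed: the representative [wv] is shown to be the iterated
   primitive of [G psi], so [psi] solves the equation for which [phiU] gives uniqueness. *)
- move=> v [v1 v2 v3]; rewrite /EKCauchy nE => -[veq vk vn].
  have [psi psi1 psiE] := L1psi_L1D ha hsigma v1.
  have [p1 p2 p3] := IE v psi psi1 psiE.
  have [wv [wv1 wv2]] := v2.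
  have wvI : {ae leb, forall t, t \in `]a, b[ -> wv t = Iop a b sigma ga psi t}.
    exact: aeT wv2 p1.
  have cwv t : t \in `]a, b[ -> {for t, continuous wv}.
    by apply: ACpsi_continuous wv1 => //; rewrite nE.
  have wvpsi : {ae leb, forall t, t \in `]a, b[ -> iter n.+1 (rho sigma) wv t = G psi t}.
    have eqD : {ae leb, forall t, t \in `]a, b[ ->
        t `^ (- (sigma * eta)) * iter n.+1 (rho sigma) wv t = f t (v t)}.
      apply: (ae2 _ _ _ veq veq) => t h _ tab; rewrite -h//.
      by rewrite (EKderivE _ (conj wv1 wv2)) ?nE.
    have eqG : {ae leb, forall t, t \in `]a, b[ ->
        G psi t = t `^ (sigma * eta) * f t (v t)}.
      apply: (ae2 _ _ _ psiE GE) => t h1 h2 tab; rewrite h2// h1//.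
      by rewrite mulrA powM// addNr powRr0 mul1r.
    apply: (ae2 _ _ _ eqD eqG) => t h1 h2 tab; rewrite h2// -h1// mulrA.
    by rewrite mulrC [X in _ * X]mulrC toD// mulr1.
  have wvc k : (0 < k <= n.+1)%N ->
      iter (n.+1 - k) (rho sigma) wv t @[t --> a^'+] --> c k.
    case: k => // k /=; rewrite ltnS leq_eqVlt => /predU1P[->|kn].
      (* The last condition concerns a class only; its limit is carried over to the continuous
         representative [wv]. *)
      rewrite subnn /=; have [w' w'E w'c] := vn.
      apply: (ae_cvg_continuous hab cwv _ w'c).
      exact: aeT (aeT _ _ _ w'E p3) (aeC _ _ wvI).
    have [[wk [wk1 wk2]] kc] := vk k.+1 kn.
    (* The representatives for the different orders are continuous and almost everywhere equal,
       hence equal on ]a, b[. *)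
    have wkE : {in `]a, b[, wk =1 wv}.
      apply: ae_eq_continuous => //.
        by move=> t; apply: ACpsi_continuous wk1; rewrite ck.
      exact: aeT (aeT _ _ _ wk2 (p2 k.+1 kn)) (aeC _ _ wvI).
    move: kc; apply: cvg_trans; apply: near_eq_cvg; near=> t.
    have tab : t \in `]a, b[.
      rewrite in_itv/=; apply/andP; split; near: t; first exact: nbhs_right_gt.
      exact: nbhs_right_lt.
    rewrite (EKderivE _ (conj wk1 wk2))//; last by rewrite ck.
    rewrite mulr0 oppr0 powRr0 mul1r ck// subSn//.
    by rewrite (iter_rho_eq_in sigma _ wkE tab).
  have wvJ := ACpsi_eq_Jit ha hab hsigma (G1 _ psi1) (eq_ind _ (fun m => ACpsi a b sigma m wv) wv1 _ nE) wvpsi wvc.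
  have psiphi : {ae leb, forall t, t \in `]a, b[ -> psi t = phi t}.
    apply: phiU => //; apply: (ae2 _ _ _ wvI wvI) => t h _ tab.
    by rewrite -h// wvJ.
  apply: (ae2 _ _ _ psiphi psiE) => t h1 h2 tab.
  by rewrite /u -h1// h2// mulrA powM// addNr powRr0 mul1r.
Unshelve. all: by end_near. Qed.
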